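(* Consider the equation $y''=P(x,y)+3Q(x,y)y'+3R(x,y)y'^2+S(x,y)y'^3$ near a point $p$ of the $(x,y)$-plane, with $A,B,F,N,\Omega,\Theta,Z$ computed from its coefficients as in the context. Suppose the equation belongs to the seventh case of intermediate degeneration, i.e. $A$ and $B$ do not vanish simultaneously, and $F=0$, $N=0$, $\Omega=0$ identically. Then the Lie algebra of point symmetries of the equation is two-dimensional if and only if $$L=Z-\tfrac12\Theta^2$$ is identically zero. In that case this two-dimensional algebra is solvable but not Abelian.
   Context: Setting. $P,Q,R,S$ are smooth real functions of $(x,y)$ near a point $p$. Everything is local (germs at $p$): ''$=0$'' means identically in a neighbourhood of $p$, ''$\ne0$'' means non-vanishing at $p$ (hence near $p$). Subscripts $x,y$ denote partial derivatives; $x^1=x$, $x^2=y$, $\partial_1=\partial_x$, $\partial_2=\partial_y$. The algebra of point symmetries is the Lie algebra of (germs of) vector fields on the $(x,y)$-plane whose local flows map graphs of solutions to graphs of solutions. Basic quantities. $A=P_{yy}-2Q_{xy}+R_{xx}+2PS_x+SP_x-3PR_y-3RP_y-3QR_x+6QQ_y$, $B=S_{xx}-2R_{xy}+Q_{yy}-2SP_y-PS_y+3SQ_x+3QS_x+3RQ_y-6RR_x$. $F$ is defined by $F^5=ABA_y+ABB_x-A^2B_y-B^2A_x-PB^3+3QAB^2-3RA^2B+SA^3$. $G=-BB_x-3AB_y+4BA_y+3SA^2-6RAB+3QB^2$, $\;H=-AA_y-3BA_x+4AB_x-3PB^2+6QAB-3RA^2$. Assume $(A,B)\neq(0,0)$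 and $F=0$. Where two expressions are given below, one for $B\ne0$ and one for $A\neq0$, they agree when both apply. $N=\frac{G}{3B}$ (if $B\ne0$), $N=-\frac{H}{3A}$ (if $A\ne0$). If $B\ne0$: $\varphi_1=-3A\frac{AS-B_y}{5B^2}-3\frac{A_y+B_x-3AR}{5B}-\frac65Q$, $\varphi_2=3\frac{AS-B_y}{5B}-\frac35R$. If $A\ne0$: $\varphi_1=-3\frac{BP+A_x}{5A}+\frac35Q$, $\varphi_2=3B\frac{BP+A_x}{5A^2}-3\frac{B_x+A_y+3BQ}{5A}+\frac65R$. $\Omega=\frac53(\partial_y\varphi_1-\partial_x\varphi_2)$. Curvature (when $N=0$, $\Omega=0$). Let $\varGamma^k_{ij}=\varGamma^k_{ji}$ be: $\varGamma^1_{11}=Q-\frac23\varphi_1$, $\varGamma^1_{12}=R-\frac13\varphi_2$, $\varGamma^1_{22}=S$, $\varGamma^2_{11}=-P$, $\varGamma^2_{12}=-Q-\frac13\varphi_1$, $\varGamma^2_{22}=-R-\frac23\varphi_2$. Put $\rho^k_q=\partial_1\varGamma^k_{2q}-\partial_2\varGamma^k_{1q}+\sum_{s=1}^2(\varGamma^k_{1s}\varGamma^s_{2q}-\varGamma^k_{2s}\varGamma^s_{1q})$. Define $\omega_1=\frac{\rho^1_1}{B}$, $\omega_2=\frac{\rho^1_2}{B}$ (if $B\ne0$); $\omega_1=-\frac{\rho^2_1}{A}$, $\omega_2=-\frac{\rho^2_2}{A}$ (if $A\neq0$). $\Theta=\omega_2/B$ (if $B\ne0$), $\Theta=\omega_1/A$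 (if $A\neq0$). $\theta_1=\Theta_x-2\varphi_1\Theta$, $\theta_2=\Theta_y-2\varphi_2\Theta$; $C=\theta^1=\theta_2$, $D=\theta^2=-\theta_1$. $Z=CD(D_y-C_x)+C^2D_x-D^2C_y-PC^3-3QC^2D-3RCD^2-SD^3$. *)

(* Defs.v *)
From Stdlib Require Import Reals Lra.
From Coquelicot Require Import Coquelicot.

Set Implicit Arguments.
Unset Strict Implicit.
Unset Printing Implicit Defensive.

Open Scope R_scope.

(** * Germs of functions of two variables

    A germ at [(px, py)] is represented by a total function [R -> R -> R] that
    is only ever looked at near [(px, py)]. *)

Definition dx (f : R -> R -> R) (x y : R) : R := Derive (fun u => f u y) x.
Definition dy (f : R -> R -> R) (x y : R) : R := Derive (fun v => f x v) y.

Definition smooth_near (f : R -> R -> R) (px py : R) : Prop :=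
  locally_2d (fun x y => forall n, ex_diff_n f n x y) px py.

Definition zero_near (f : R -> R -> R) (px py : R) : Prop :=
  locally_2d (fun x y => f x y = 0) px py.

(** Analogue of Coquelicot's [ex_diff_n] for three variables. *)
Fixpoint ex_diff3_n (f : R -> R -> R -> R) (n : nat) (t x y : R) : Prop :=
  continuous (fun q : R * R * R => f (fst (fst q)) (snd (fst q)) (snd q)) (t, x, y) /\
  match n with
  | O => True
  | S m =>
      ex_derive (fun s => f s x y) t /\
      ex_derive (fun u => f t u y) x /\
      ex_derive (fun v => f t x v) y /\
      ex_diff3_n (fun t x y => Derive (fun s => f s x y) t) m t x y /\
      ex_diff3_n (fun t x y => Derive (fun u => f t u y) x) m t x y /\
      ex_diff3_n (fun t x y => Derive (fun v => f t x v) y) m t x y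
  end.

(** * The equation [y'' = P + 3 Q y' + 3 R y'^2 + S y'^3] *)

Record ode : Type := MkOde {
  cP : R -> R -> R;
  cQ : R -> R -> R;
  cR : R -> R -> R;
  cS : R -> R -> R
}.

Definition smooth_ode (E : ode) (px py : R) : Prop :=
  smooth_near (cP E) px py /\ smooth_near (cQ E) px py /\
  smooth_near (cR E) px py /\ smooth_near (cS E) px py.

Definition ode_rhs (E : ode) (x y p : R) : R :=
  cP E x y + 3 * cQ E x y * p + 3 * cR E x y * p ^ 2 + cS E x y * p ^ 3.

Definition solution_on (E : ode) (f : R -> R) (a b : Rbar) : Prop :=
  forall x : R, Rbar_lt a x -> Rbar_lt x b ->
    ex_derive f x /\ ex_derive (Derive f) x /\
    Derive (Derive f) x = ode_rhs E x (f x) (Derive f x).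

(** * The basic quantities *)

Definition invA (E : ode) (x y : R) : R :=
  let P := cP E in let Q := cQ E in let R_ := cR E in let S := cS E in
  dy (dy P) x y - 2 * dy (dx Q) x y + dx (dx R_) x y
  + 2 * P x y * dx S x y + S x y * dx P x y
  - 3 * P x y * dy R_ x y - 3 * R_ x y * dy P x y
  - 3 * Q x y * dx R_ x y + 6 * Q x y * dy Q x y.

Definition invB (E : ode) (x y : R) : R :=
  let P := cP E in let Q := cQ E in let R_ := cR E in let S := cS E in
  dx (dx S) x y - 2 * dy (dx R_) x y + dy (dy Q) x y
  - 2 * S x y * dy P x y - P x y * dy S x y
  + 3 * S x y * dx Q x y + 3 * Q x y * dx S x y
  + 3 * R_ x y * dy Q x y - 6 * R_ x y * dx R_ x y.

(** The real fifth root; [sign 0 = 0] makes the value at [0] correct. *)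
Definition fifth_root (z : R) : R := sign z * Rpower (Rabs z) (/ 5).

Lemma fifth_root_pow (z : R) : fifth_root z ^ 5 = z.
Proof.
  unfold fifth_root; rewrite Rpow_mult_distr.
  destruct (Req_dec z 0) as [-> | Hz]; [rewrite sign_0; ring|].
  rewrite <- (@Rpower_pow 5 (Rpower _ _)) by apply exp_pos.
  rewrite Rpower_mult.
  replace (/ 5 * INR 5) with 1 by (simpl; field).
  rewrite Rpower_1 by now apply Rabs_pos_lt.
  destruct (Rdichotomy _ _ Hz) as [H | H].
  - rewrite sign_eq_m1, Rabs_left by easy; ring.
  - rewrite sign_eq_1, Rabs_right by lra; ring.
Qed.

Definition invF (E : ode) (x y : R) : R :=
  let P := cP E x y in let Q := cQ E x y in
  let R_ := cR E x y in let S := cS E x y in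
  let a := invA E x y in let b := invB E x y in
  fifth_root
    (a * b * dy (invA E) x y + a * b * dx (invB E) x y
     - a ^ 2 * dy (invB E) x y - b ^ 2 * dx (invA E) x y
     - P * b ^ 3 + 3 * Q * a * b ^ 2 - 3 * R_ * a ^ 2 * b + S * a ^ 3).

Definition invG (E : ode) (x y : R) : R :=
  let Q := cQ E x y in let R_ := cR E x y in let S := cS E x y in
  let a := invA E x y in let b := invB E x y in
  - b * dx (invB E) x y - 3 * a * dy (invB E) x y + 4 * b * dy (invA E) x y
  + 3 * S * a ^ 2 - 6 * R_ * a * b + 3 * Q * b ^ 2.

Definition invH (E : ode) (x y : R) : R :=
  let P := cP E x y in let Q := cQ E x y in let R_ := cR E x y in
  let a := invA E x y in let b := invB E x y in
  - a * dy (invA E) x y - 3 * b * dx (invA E) x y + 4 * a * dx (invB E) x y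
  - 3 * P * b ^ 2 + 6 * Q * a * b - 3 * R_ * a ^ 2.

(** [invN], [phi1], [phi2], [omega] and [Theta] are each given by two expressions,
    one for [invA <> 0] and one for [invB <> 0]. A [chart] says which family of
    expressions is used; it is applicable when the corresponding function is nonzero
    at the base point, so that [(invA, invB) <> (0, 0)] means that some chart is
    applicable. *)
Inductive chart : Type := chartA | chartB.

Definition applicable (E : ode) (c : chart) (px py : R) : Prop :=
  match c with
  | chartA => invA E px py <> 0
  | chartB => invB E px py <> 0
  end.

Definition invN (c : chart) (E : ode) (x y : R) : R :=
  match c with
  | chartA => - invH E x y / (3 * invA E x y)
  | chartB => invG E x y / (3 * invB E x y)
  end.

Definition phi1 (c : chart) (E : ode) (x y : R) : R :=
  let P := cP E x y in let Q := cQ E x y in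
  let R_ := cR E x y in let S := cS E x y in
  let a := invA E x y in let b := invB E x y in
  match c with
  | chartA => - 3 * ((b * P + dx (invA E) x y) / (5 * a)) + 3 / 5 * Q
  | chartB => - 3 * a * ((a * S - dy (invB E) x y) / (5 * b ^ 2))
              - 3 * ((dy (invA E) x y + dx (invB E) x y - 3 * a * R_) / (5 * b))
              - 6 / 5 * Q
  end.

Definition phi2 (c : chart) (E : ode) (x y : R) : R :=
  let P := cP E x y in let Q := cQ E x y in
  let R_ := cR E x y in let S := cS E x y in
  let a := invA E x y in let b := invB E x y in
  match c with
  | chartA => 3 * b * ((b * P + dx (invA E) x y) / (5 * a ^ 2))
              - 3 * ((dx (invB E) x y + dy (invA E) x y + 3 * b * Q) / (5 * a))
              + 6 / 5 * R_
  | chartB => 3 * ((a * S - dy (invB E) x y) / (5 * b)) - 3 / 5 * R_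
  end.

Definition Omega (c : chart) (E : ode) (x y : R) : R :=
  5 / 3 * (dy (phi1 c E) x y - dx (phi2 c E) x y).

(** * The curvature and [Theta] *)

Inductive idx : Type := i1 | i2.

Definition partial (i : idx) : (R -> R -> R) -> R -> R -> R :=
  match i with i1 => dx | i2 => dy end.

Definition sum_idx (f : idx -> R) : R := f i1 + f i2.

(** [Gamma c E k i j] is the component with upper index [k] and lower indices
    [i], [j]. *)
Definition Gamma (c : chart) (E : ode) (k i j : idx) (x y : R) : R :=
  match k, i, j with
  | i1, i1, i1 => cQ E x y - 2 / 3 * phi1 c E x y
  | i1, i1, i2 | i1, i2, i1 => cR E x y - 1 / 3 * phi2 c E x y
  | i1, i2, i2 => cS E x y
  | i2, i1, i1 => - cP E x y
  | i2, i1, i2 | i2, i2, i1 => - cQ E x y - 1 / 3 * phi1 c E x y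
  | i2, i2, i2 => - cR E x y - 2 / 3 * phi2 c E x y
  end.

(** [rho c E k q]: upper index [k], lower index [q]. *)
Definition rho (c : chart) (E : ode) (k q : idx) (x y : R) : R :=
  partial i1 (Gamma c E k i2 q) x y - partial i2 (Gamma c E k i1 q) x y
  + sum_idx (fun s => Gamma c E k i1 s x y * Gamma c E s i2 q x y
                      - Gamma c E k i2 s x y * Gamma c E s i1 q x y).

Definition omega (c : chart) (E : ode) (q : idx) (x y : R) : R :=
  match c with
  | chartA => - (rho c E i2 q x y / invA E x y)
  | chartB => rho c E i1 q x y / invB E x y
  end.

Definition Theta (c : chart) (E : ode) (x y : R) : R :=
  match c with
  | chartA => omega c E i1 x y / invA E x y
  | chartB => omega c E i2 x y / invB E x y
  end.

Definition theta1 (c : chart) (E : ode) (x y : R) : R :=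
  dx (Theta c E) x y - 2 * phi1 c E x y * Theta c E x y.

Definition theta2 (c : chart) (E : ode) (x y : R) : R :=
  dy (Theta c E) x y - 2 * phi2 c E x y * Theta c E x y.

Definition invC (c : chart) (E : ode) (x y : R) : R := theta2 c E x y.
Definition invD (c : chart) (E : ode) (x y : R) : R := - theta1 c E x y.

Definition invZ (c : chart) (E : ode) (x y : R) : R :=
  let C_ := invC c E x y in let D_ := invD c E x y in
  C_ * D_ * (dy (invD c E) x y - dx (invC c E) x y)
  + C_ ^ 2 * dx (invD c E) x y - D_ ^ 2 * dy (invC c E) x y
  - cP E x y * C_ ^ 3 - 3 * cQ E x y * C_ ^ 2 * D_
  - 3 * cR E x y * C_ * D_ ^ 2 - cS E x y * D_ ^ 3.

Definition invL (c : chart) (E : ode) (x y : R) : R :=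
  invZ c E x y - 1 / 2 * Theta c E x y ^ 2.

(** * Germs of vector fields *)

Record vfield : Type := MkVfield { v1 : R -> R -> R; v2 : R -> R -> R }.

Definition vcomb (a : R) (X : vfield) (b : R) (Y : vfield) : vfield :=
  MkVfield (fun x y => a * v1 X x y + b * v1 Y x y)
           (fun x y => a * v2 X x y + b * v2 Y x y).

Definition vzero : vfield := MkVfield (fun _ _ => 0) (fun _ _ => 0).

Definition bracket (X Y : vfield) : vfield :=
  let apply (W : vfield) (f : R -> R -> R) x y :=
    v1 W x y * dx f x y + v2 W x y * dy f x y in
  MkVfield (fun x y => apply X (v1 Y) x y - apply Y (v1 X) x y)
           (fun x y => apply X (v2 Y) x y - apply Y (v2 X) x y).

Definition veq_near (px py : R) (X Y : vfield) : Prop :=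
  locally_2d (fun x y => v1 X x y = v1 Y x y /\ v2 X x y = v2 Y x y) px py.

(** * Lie algebras of germs of vector fields, as predicates on representatives *)

Definition two_dimensional (px py : R) (g : vfield -> Prop) : Prop :=
  exists X Y : vfield,
    (forall a b, veq_near px py (vcomb a X b Y) vzero -> a = 0 /\ b = 0) /\
    (forall W, g W <-> exists a b, veq_near px py W (vcomb a X b Y)).

Definition abelian (px py : R) (g : vfield -> Prop) : Prop :=
  forall X Y, g X -> g Y -> veq_near px py (bracket X Y) vzero.

(** The linear span (as germs) of the brackets of elements of [g]. *)
Inductive derived (px py : R) (g : vfield -> Prop) : vfield -> Prop :=
  | derived_bracket X Y : g X -> g Y -> derived px py g (bracket X Y)
  | derived_zero : derived px py g vzero
  | derived_comb a X b Y :
      derived px py g X -> derived px py g Y -> derived px py g (vcomb a X b Y)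
  | derived_germ X Y :
      derived px py g X -> veq_near px py X Y -> derived px py g Y.

Definition solvable (px py : R) (g : vfield -> Prop) : Prop :=
  exists n : nat, forall X,
    Nat.iter n (derived px py) g X -> veq_near px py X vzero.

(** * Point symmetries *)

Definition in_box (px py eps x y : R) : Prop :=
  Rabs (x - px) < eps /\ Rabs (y - py) < eps.

(** [(F1 t x y, F2 t x y)] is the local flow of [X], for [|t| < eps] and starting
    points in the box of size [eps] around [(px, py)]. *)
Definition local_flow (X : vfield) (px py eps : R) (F1 F2 : R -> R -> R -> R) : Prop :=
  forall t x y, Rabs t < eps -> in_box px py eps x y ->
    (forall n, ex_diff3_n F1 n t x y) /\ (forall n, ex_diff3_n F2 n t x y) /\
    F1 0 x y = x /\ F2 0 x y = y /\
    is_derive (fun s => F1 s x y) t (v1 X (F1 t x y) (F2 t x y)) /\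
    is_derive (fun s => F2 s x y) t (v2 X (F1 t x y) (F2 t x y)).

Definition graph (f : R -> R) (a b : Rbar) (x y : R) : Prop :=
  Rbar_lt a x /\ Rbar_lt x b /\ y = f x.

(** The map [(T1, T2)] sends graphs of solutions lying in the box to graphs of
    solutions. The image of a graph may fail to be a graph over the [x]-axis;
    [Derive _ x <> 0] says that the image curve has no vertical tangent, in which
    case it is one. *)
Definition maps_solutions (E : ode) (px py eps : R) (T1 T2 : R -> R -> R) : Prop :=
  forall (f : R -> R) (a b : Rbar),
    Rbar_lt a b -> solution_on E f a b ->
    (forall x y, graph f a b x y -> in_box px py eps x y) ->
    (forall x, Rbar_lt a x -> Rbar_lt x b -> Derive (fun z => T1 z (f z)) x <> 0) ->
    exists (h : R -> R) (a' b' : Rbar),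
      Rbar_lt a' b' /\ solution_on E h a' b' /\
      forall u v, graph h a' b' u v <->
        exists x y, graph f a b x y /\ u = T1 x y /\ v = T2 x y.

(** The flow of a smooth vector field exists and is unique near the base point, so
    that quantifying existentially over [eps] and the flow is not a restriction. *)
Definition point_symmetry (E : ode) (px py : R) (X : vfield) : Prop :=
  smooth_near (v1 X) px py /\ smooth_near (v2 X) px py /\
  exists (eps : R) (F1 F2 : R -> R -> R -> R),
    0 < eps /\ local_flow X px py eps F1 F2 /\
    forall t, Rabs t < eps -> maps_solutions E px py eps (F1 t) (F2 t).

(* Main.v *)
Require Import Defs.
From Stdlib Require Import Reals Ranalysis5 Lra Lia Classical ClassicalEpsilon.
From Coquelicot Require Import Coquelicot.

(*
The covector [(A, B)] is parallel for the connection [Gamma], up to the weight [-phi], and the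
form [phi] is closed because [Omega = 0]. If [d psi = phi], then [exp psi * (A dx + B dy)] is
closed, say equal to [dU]; put [V = exp (-2 psi) * Theta] and [l = exp (-4 psi) * L]. The
curvature of [Gamma] is [Theta] times a product of copies of [(A, B)], and its Cotton tensor is
[(A, B)] itself: this gives [B * theta1 - A * theta2 = 1], so that [(U, V)] are coordinates, and
the Hessian of [V] for [Gamma] is [- (V^2 / 2 + l) dU dU] with [l] a function of [U] alone. Hence
in the coordinates [u = U], [v = V] the equation is [v'' = - (v^2 / 2 + b(u))], with [l = b(U)].

For this equation the determining equations of a symmetry [X] integrate completely: [X u = k u + m],
[X v = - 2 k v] and [4 k b + (k u + m) b' = 0] with constants [k], [m]. The algebra therefore
embeds in the pairs [(k, m)], and it is two-dimensional exactly when [b = 0], i.e. [L = 0]. The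
bracket of the fields of [(k1, m1)] and [(k2, m2)] is the field of [(0, k2 m1 - k1 m2)].
*)

Set Implicit Arguments.
Unset Strict Implicit.
Unset Printing Implicit Defensive.

Open Scope R_scope.

(** * Smooth functions of three variables *)

(** [point_symmetry] speaks of flows and of graphs of solutions, never of determining equations, and
    this shapes the proof. To get from a flow to the determining equations, solutions of [E] are
    needed through every point near the base, with all but at most one slope [p] in the canonical
    coordinates; a Picard theorem for the canonical equation, whose right-hand side is free of [v'],
    provides them. The flow maps them to solutions by definition, and differentiating this fact at
    [t = 0] gives the linearized condition. Conversely, the flow of [(k u + m) d/du - 2 k v d/dv] is
    explicit and preserves [v'' = - v^2 / 2], because both sides scale by [exp (-4 k t)]; the case
    [l = 0] suffices there, since two independent symmetries force [b = 0].

    Passing to canonical coordinates costs an inverse function theorem and a calculus of smooth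
    functions on open sets, in three variables because flows depend on time. Curves are handled
    parametrically, since a graph over [x] need not be a graph over [u]. *)

Lemma is_derive_cst (c x : R) : is_derive (fun _ => c) x 0.
Proof. apply (is_derive_const (K := R_AbsRing) (V := R_NormedModule)). Qed.

Lemma is_derive_var (x : R) : is_derive (fun z : R => z) x 1.
Proof. apply (is_derive_id (K := R_AbsRing)). Qed.

Definition cube (e t x y t' x' y' : R) : Prop :=
  Rabs (t' - t) < e /\ Rabs (x' - x) < e /\ Rabs (y' - y) < e.

Definition open3 (O : R -> R -> R -> Prop) : Prop :=
  forall t x y, O t x y ->
    exists e, 0 < e /\ forall t' x' y', cube e t x y t' x' y' -> O t' x' y'.

Definition cont3 (f : R -> R -> R -> R) (t x y : R) : Prop :=
  continuous (fun q : R * R * R => f (fst (fst q)) (snd (fst q)) (snd q)) (t, x, y).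

Definition d1 (f : R -> R -> R -> R) (t x y : R) : R := Derive (fun s => f s x y) t.
Definition d2 (f : R -> R -> R -> R) (t x y : R) : R := Derive (fun u => f t u y) x.
Definition d3 (f : R -> R -> R -> R) (t x y : R) : R := Derive (fun v => f t x v) y.

(** A derivative at a point depends on the values nearby, so pointwise [ex_diff3_n] does not pass
    through inductions. Asking for it on a set [O], usually open, lets a derivative be replaced by
    any function equal to it on [O]. *)
Definition C3 (n : nat) (O : R -> R -> R -> Prop) (f : R -> R -> R -> R) : Prop :=
  forall t x y, O t x y -> ex_diff3_n f n t x y.

Lemma cont3P f t x y :
  cont3 f t x y <->
  forall e, 0 < e -> exists d, 0 < d /\
    forall t' x' y', cube d t x y t' x' y' -> Rabs (f t' x' y' - f t x y) < e.
Proof.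
  unfold cont3, continuous. split.
  - intros H e He.
    destruct (proj1 (filterlim_locally _ _) H (mkposreal e He)) as [d Hd].
    exists d. split; [apply cond_pos|].
    intros t' x' y' [h1 [h2 h3]].
    apply (Hd (t', x', y')).
    repeat split; assumption.
  - intros H. apply filterlim_locally. intros e.
    destruct (H e (cond_pos e)) as [d [Hd H']].
    exists (mkposreal d Hd). intros [[t' x'] y'] [[h1 h2] h3].
    apply H'. repeat split; assumption.
Qed.

Lemma C3_S n O f :
  C3 (S n) O f <->
  C3 0 O f /\
  (forall t x y, O t x y ->
     ex_derive (fun s => f s x y) t /\ ex_derive (fun u => f t u y) x /\
     ex_derive (fun v => f t x v) y) /\
  C3 n O (d1 f) /\ C3 n O (d2 f) /\ C3 n O (d3 f).
Proof.
  split.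
  - intros H. split; [|split; [|split; [|split]]]; intros t x y Hx;
      destruct (H t x y Hx) as (h0 & h1 & h2 & h3 & h4 & h5 & h6).
    + now split.
    + now repeat split.
    + exact h4.
    + exact h5.
    + exact h6.
  - intros (h0 & h1 & h2 & h3 & h4) t x y Hx.
    destruct (h1 t x y Hx) as (k1 & k2 & k3).
    split; [apply (h0 t x y Hx)|].
    repeat split; trivial; [apply h2 | apply h3 | apply h4]; assumption.
Qed.

Lemma C3_0 O f : C3 0 O f <-> forall t x y, O t x y -> cont3 f t x y.
Proof.
  split; intros H t x y Hx.
  - apply (H t x y Hx).
  - split; [apply H; exact Hx | exact I].
Qed.

Lemma C3_le n m O f : (m <= n)%nat -> C3 n O f -> C3 m O f.
Proof.
  revert m f. induction n as [|n IH]; intros m f Hm H.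
  - replace m with 0%nat by lia. exact H.
  - destruct m as [|m].
    + now apply C3_S in H.
    + apply C3_S in H. destruct H as (h0 & h1 & h2 & h3 & h4).
      apply C3_S. split; [exact h0|]. split; [exact h1|].
      assert (m <= n)%nat by lia. auto.
Qed.

Lemma C3_sub n (O O' : R -> R -> R -> Prop) f :
  (forall t x y, O t x y -> O' t x y) -> C3 n O' f -> C3 n O f.
Proof. intros H h t x y Hx. apply h, H, Hx. Qed.

Lemma open3_1 O t x y : open3 O -> O t x y -> locally t (fun s => O s x y).
Proof.
  intros Ho Hx. destruct (Ho t x y Hx) as [e [He H]].
  exists (mkposreal e He). intros s Hs. apply H. split; [exact Hs|].
  rewrite !Rminus_diag, Rabs_R0. lra.
Qed.

Lemma open3_2 O t x y : open3 O -> O t x y -> locally x (fun s => O t s y).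
Proof.
  intros Ho Hx. destruct (Ho t x y Hx) as [e [He H]].
  exists (mkposreal e He). intros s Hs. apply H.
  split; [|split; [exact Hs|]]; rewrite !Rminus_diag, Rabs_R0; lra.
Qed.

Lemma open3_3 O t x y : open3 O -> O t x y -> locally y (fun s => O t x s).
Proof.
  intros Ho Hx. destruct (Ho t x y Hx) as [e [He H]].
  exists (mkposreal e He). intros s Hs. apply H.
  split; [|split; [|exact Hs]]; rewrite !Rminus_diag, Rabs_R0; lra.
Qed.

Lemma cont3_ext O f g t x y :
  open3 O -> O t x y -> (forall t x y, O t x y -> f t x y = g t x y) ->
  cont3 f t x y -> cont3 g t x y.
Proof.
  intros Ho Hx E Hc. apply cont3P. intros e He.
  destruct (proj1 (cont3P _ _ _ _) Hc e He) as [d [Hd H]].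
  destruct (Ho t x y Hx) as [d' [Hd' H']].
  exists (Rmin d d'). split; [now apply Rmin_glb_lt|].
  intros t' x' y' (h1 & h2 & h3).
  pose proof (Rmin_l d d'). pose proof (Rmin_r d d').
  rewrite <- !E; trivial.
  - apply H; repeat split; lra.
  - apply H'; repeat split; lra.
Qed.

Lemma C3_ext n O f g :
  open3 O -> (forall t x y, O t x y -> f t x y = g t x y) -> C3 n O f -> C3 n O g.
Proof.
  intros Ho. revert f g. induction n as [|n IH]; intros f g E Hf.
  - apply C3_0. intros t x y Hx. apply (cont3_ext Ho Hx E).
    now apply (proj1 (C3_0 _ _) Hf).
  - apply C3_S in Hf. destruct Hf as (h0 & h1 & h2 & h3 & h4).
    apply C3_S. split; [|split; [|split; [|split]]].
    + apply C3_0. intros t x y Hx. apply (cont3_ext Ho Hx E).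
      now apply (proj1 (C3_0 _ _) h0).
    + intros t x y Hx. destruct (h1 t x y Hx) as (k1 & k2 & k3). repeat split.
      * eapply ex_derive_ext_loc; [|exact k1].
        apply (filter_imp (fun s => O s x y)); [auto|now apply open3_1].
      * eapply ex_derive_ext_loc; [|exact k2].
        apply (filter_imp (fun s => O t s y)); [auto|now apply open3_2].
      * eapply ex_derive_ext_loc; [|exact k3].
        apply (filter_imp (fun s => O t x s)); [auto|now apply open3_3].
    + apply (IH (d1 f)); trivial. intros t x y Hx. apply Derive_ext_loc.
      apply (filter_imp (fun s => O s x y)); [auto|now apply open3_1].
    + apply (IH (d2 f)); trivial. intros t x y Hx. apply Derive_ext_loc.
      apply (filter_imp (fun s => O t s y)); [auto|now apply open3_2].
    + apply (IH (d3 f)); trivial. intros t x y Hx. apply Derive_ext_loc.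
      apply (filter_imp (fun s => O t x s)); [auto|now apply open3_3].
Qed.

(** Working form of [C3_S]: the partial derivatives are supplied in closed form and agree with
    [Derive] on [O]; openness then transfers their regularity. *)
Lemma C3_intro n O f f1 f2 f3 :
  open3 O -> C3 0 O f ->
  (forall t x y, O t x y ->
     is_derive (fun s => f s x y) t (f1 t x y) /\
     is_derive (fun u => f t u y) x (f2 t x y) /\
     is_derive (fun v => f t x v) y (f3 t x y)) ->
  C3 n O f1 -> C3 n O f2 -> C3 n O f3 -> C3 (S n) O f.
Proof.
  intros Ho H0 H H1 H2 H3. apply C3_S. split; [exact H0|]. split; [|split; [|split]].
  - intros t x y Hx. destruct (H t x y Hx) as (h1 & h2 & h3).
    repeat split; eexists; eassumption.
  - apply (C3_ext (f := f1)); trivial. intros t x y Hx.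
    symmetry. apply is_derive_unique. apply H, Hx.
  - apply (C3_ext (f := f2)); trivial. intros t x y Hx.
    symmetry. apply is_derive_unique. apply H, Hx.
  - apply (C3_ext (f := f3)); trivial. intros t x y Hx.
    symmetry. apply is_derive_unique. apply H, Hx.
Qed.

Lemma C3_d n O f :
  C3 (S n) O f ->
  C3 n O f /\
  (forall t x y, O t x y ->
     is_derive (fun s => f s x y) t (d1 f t x y) /\
     is_derive (fun u => f t u y) x (d2 f t x y) /\
     is_derive (fun v => f t x v) y (d3 f t x y)) /\
  C3 n O (d1 f) /\ C3 n O (d2 f) /\ C3 n O (d3 f).
Proof.
  intros H. split; [apply (C3_le (n := S n)); [lia|exact H]|].
  apply C3_S in H. destruct H as (h0 & h1 & h2 & h3 & h4).
  split; [|now split].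
  intros t x y Hx. destruct (h1 t x y Hx) as (k1 & k2 & k3).
  split; [|split]; now apply Derive_correct.
Qed.

Lemma C3_const n O c : open3 O -> C3 n O (fun _ _ _ => c).
Proof.
  intros Ho. revert c. induction n as [|n IH]; intros c.
  - apply C3_0. intros t x y _. apply continuous_const.
  - apply (C3_intro (f1 := fun _ _ _ => 0) (f2 := fun _ _ _ => 0) (f3 := fun _ _ _ => 0));
      try apply IH; trivial.
    + apply C3_0. intros t x y _. apply continuous_const.
    + intros t x y _. split; [|split]; apply is_derive_cst.
Qed.

Lemma C3_1 n O : open3 O -> C3 n O (fun t _ _ => t).
Proof.
  intros Ho.
  assert (H0 : C3 0 O (fun t _ _ => t)).
  { apply C3_0. intros t x y _. apply cont3P. intros e He. exists e.
    split; [exact He|]. intros t' x' y' (h & _). exact h. }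
  destruct n as [|n]; [exact H0|].
  apply (C3_intro (f1 := fun _ _ _ => 1) (f2 := fun _ _ _ => 0) (f3 := fun _ _ _ => 0));
    trivial; try now apply C3_const.
  intros t x y _. split; [|split];
    apply is_derive_cst || apply is_derive_var.
Qed.

Lemma C3_2 n O : open3 O -> C3 n O (fun _ x _ => x).
Proof.
  intros Ho.
  assert (H0 : C3 0 O (fun _ x _ => x)).
  { apply C3_0. intros t x y _. apply cont3P. intros e He. exists e.
    split; [exact He|]. intros t' x' y' (_ & h & _). exact h. }
  destruct n as [|n]; [exact H0|].
  apply (C3_intro (f1 := fun _ _ _ => 0) (f2 := fun _ _ _ => 1) (f3 := fun _ _ _ => 0));
    trivial; try now apply C3_const.
  intros t x y _. split; [|split];
    apply is_derive_cst || apply is_derive_var.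
Qed.

Lemma C3_3 n O : open3 O -> C3 n O (fun _ _ y => y).
Proof.
  intros Ho.
  assert (H0 : C3 0 O (fun _ _ y => y)).
  { apply C3_0. intros t x y _. apply cont3P. intros e He. exists e.
    split; [exact He|]. intros t' x' y' (_ & _ & h). exact h. }
  destruct n as [|n]; [exact H0|].
  apply (C3_intro (f1 := fun _ _ _ => 0) (f2 := fun _ _ _ => 0) (f3 := fun _ _ _ => 1));
    trivial; try now apply C3_const.
  intros t x y _. split; [|split];
    apply is_derive_cst || apply is_derive_var.
Qed.

Lemma C3_plus n O f g :
  open3 O -> C3 n O f -> C3 n O g -> C3 n O (fun t x y => f t x y + g t x y).
Proof.
  intros Ho. revert f g. induction n as [|n IH]; intros f g Hf Hg.
  - rewrite C3_0 in *. intros t x y Hx.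
    apply (continuous_plus (V := R_NormedModule)); [apply Hf|apply Hg]; trivial.
  - assert (H0 : C3 0 O (fun t x y => f t x y + g t x y)).
    { apply (C3_le (m := 0)) in Hf; [|lia]. apply (C3_le (m := 0)) in Hg; [|lia].
      rewrite C3_0 in *. intros t x y Hx.
      apply (continuous_plus (V := R_NormedModule)); [apply Hf|apply Hg]; trivial. }
    apply C3_d in Hf. apply C3_d in Hg.
    destruct Hf as (_ & hf & hf1 & hf2 & hf3). destruct Hg as (_ & hg & hg1 & hg2 & hg3).
    apply (C3_intro Ho H0 (f1 := fun t x y => d1 f t x y + d1 g t x y)
       (f2 := fun t x y => d2 f t x y + d2 g t x y)
       (f3 := fun t x y => d3 f t x y + d3 g t x y)); auto.
    intros t x y Hx. destruct (hf t x y Hx) as (k1 & k2 & k3).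
    destruct (hg t x y Hx) as (l1 & l2 & l3).
    split; [|split]; apply (is_derive_plus (V := R_NormedModule)); assumption.
Qed.

Lemma C3_mult n O f g :
  open3 O -> C3 n O f -> C3 n O g -> C3 n O (fun t x y => f t x y * g t x y).
Proof.
  intros Ho. revert f g. induction n as [|n IH]; intros f g Hf Hg.
  - rewrite C3_0 in *. intros t x y Hx.
    apply (continuous_mult (K := R_AbsRing)); [apply Hf|apply Hg]; trivial.
  - assert (H0 : C3 0 O (fun t x y => f t x y * g t x y)).
    { apply (C3_le (m := 0)) in Hf; [|lia]. apply (C3_le (m := 0)) in Hg; [|lia].
      rewrite C3_0 in *. intros t x y Hx.
      apply (continuous_mult (K := R_AbsRing)); [apply Hf|apply Hg]; trivial. }
    apply C3_d in Hf. apply C3_d in Hg.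
    destruct Hf as (nf & hf & hf1 & hf2 & hf3). destruct Hg as (ng & hg & hg1 & hg2 & hg3).
    apply (C3_intro Ho H0 (f1 := fun t x y => d1 f t x y * g t x y + f t x y * d1 g t x y)
       (f2 := fun t x y => d2 f t x y * g t x y + f t x y * d2 g t x y)
       (f3 := fun t x y => d3 f t x y * g t x y + f t x y * d3 g t x y));
      try (apply C3_plus; auto).
    intros t x y Hx. destruct (hf t x y Hx) as (k1 & k2 & k3).
    destruct (hg t x y Hx) as (l1 & l2 & l3).
    split; [|split];
      match goal with |- is_derive (fun s => @?F s * @?G s) ?t _ =>
        apply (is_derive_mult F G t); [assumption|assumption|apply Rmult_comm] end.
Qed.

(** * First-order expansions and the chain rule *)

Lemma is_deriveP f s l :
  is_derive f s l <->
  forall e, 0 < e -> exists d, 0 < d /\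
    forall s', Rabs (s' - s) < d -> Rabs (f s' - f s - l * (s' - s)) <= e * Rabs (s' - s).
Proof.
  rewrite is_derive_Reals. unfold derivable_pt_lim. split; intros H e He.
  - destruct (H e He) as [d Hd]. exists d. split; [apply cond_pos|]. intros s' Hs.
    destruct (Req_dec (s' - s) 0) as [E|E].
    + replace s' with s by lra. rewrite !Rminus_diag, Rmult_0_r, Rminus_0_r, Rabs_R0. lra.
    + specialize (Hd (s' - s) E Hs). replace (s + (s' - s)) with s' in Hd by ring.
      replace (f s' - f s - l * (s' - s)) with (((f s' - f s) / (s' - s) - l) * (s' - s))
        by (field; exact E).
      rewrite Rabs_mult. apply Rmult_le_compat_r; [apply Rabs_pos|lra].
  - destruct (H (e / 2)) as [d [Hd H']]; [lra|]. exists (mkposreal d Hd).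
    intros h Hh Hd'. specialize (H' (s + h)). replace (s + h - s) with h in H' by ring.
    specialize (H' Hd').
    replace ((f (s + h) - f s) / h - l) with ((f (s + h) - f s - l * h) / h)
      by (field; exact Hh).
    unfold Rdiv. rewrite Rabs_mult, Rabs_inv.
    assert (0 < Rabs h) by now apply Rabs_pos_lt.
    apply Rle_lt_trans with (e / 2 * Rabs h * / Rabs h).
    + apply Rmult_le_compat_r; [|exact H'].
      apply Rlt_le, Rinv_0_lt_compat; assumption.
    + field_simplify; lra.
Qed.

Lemma Rabs_between c a b : Rmin a b <= c <= Rmax a b -> Rabs (c - a) <= Rabs (b - a).
Proof.
  unfold Rmin, Rmax. destruct (Rle_dec a b); intros H; unfold Rabs;
    repeat destruct Rcase_abs; lra.
Qed.

Lemma MVT_is_derive f df a b :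
  (forall s, Rmin a b <= s <= Rmax a b -> is_derive f s (df s)) ->
  exists c, Rmin a b <= c <= Rmax a b /\ f b - f a = df c * (b - a).
Proof.
  intros H. apply MVT_gen.
  - intros s Hs. apply H. lra.
  - intros s Hs. apply continuity_pt_filterlim.
    apply (ex_derive_continuous (K := R_AbsRing) (V := R_NormedModule)).
    exists (df s). apply H, Hs.
Qed.

(** Continuous partial derivatives give total differentiability: the increment is split along three
    segments parallel to the axes, and the mean value theorem replaces each part by a partial
    derivative at a nearby point, within [e] of its value at the base. *)
Lemma C3_frechet O f t x y :
  open3 O -> C3 1 O f -> O t x y ->
  forall e, 0 < e -> exists d, 0 < d /\
    forall t' x' y', cube d t x y t' x' y' ->
      Rabs (f t' x' y' - f t x y
            - (d1 f t x y * (t' - t) + d2 f t x y * (x' - x) + d3 f t x y * (y' - y)))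
      <= e * (Rabs (t' - t) + Rabs (x' - x) + Rabs (y' - y)).
Proof.
  intros Ho Hf Hx e He. apply C3_d in Hf. destruct Hf as (_ & hf & h1 & h2 & h3).
  rewrite C3_0 in h1, h2, h3.
  destruct (proj1 (cont3P _ _ _ _) (h1 t x y Hx) e He) as [e1 [p1 H1]].
  destruct (proj1 (cont3P _ _ _ _) (h2 t x y Hx) e He) as [e2 [p2 H2]].
  destruct (proj1 (cont3P _ _ _ _) (h3 t x y Hx) e He) as [e3 [p3 H3]].
  destruct (Ho t x y Hx) as [e0 [p0 H0]].
  exists (Rmin (Rmin e0 e1) (Rmin e2 e3)).
  split; [repeat apply Rmin_glb_lt; assumption|].
  intros t' x' y' (k1 & k2 & k3).
  assert (B : forall a b c, Rabs (a - t) <= Rabs (t' - t) -> Rabs (b - x) <= Rabs (x' - x) ->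
     Rabs (c - y) <= Rabs (y' - y) ->
     cube e0 t x y a b c /\ cube e1 t x y a b c /\ cube e2 t x y a b c /\ cube e3 t x y a b c).
  { intros a b c Ha Hb Hc.
    pose proof (Rmin_l (Rmin e0 e1) (Rmin e2 e3)). pose proof (Rmin_r (Rmin e0 e1) (Rmin e2 e3)).
    pose proof (Rmin_l e0 e1). pose proof (Rmin_r e0 e1).
    pose proof (Rmin_l e2 e3). pose proof (Rmin_r e2 e3).
    repeat split; lra. }
  assert (z : forall a b, Rabs (a - a) <= Rabs b).
  { intros a b. rewrite Rminus_diag, Rabs_R0. apply Rabs_pos. }
  (* The path runs through [(t, x, y)], [(t, x, y')], [(t, x', y')] and [(t', x', y')], with one
     mean value theorem per leg. *)
  destruct (@MVT_is_derive (fun s => f s x' y') (fun s => d1 f s x' y') t t') as (c1 & m1 & E1).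
  { intros s Hs. apply hf. apply H0. apply B; try lra. now apply Rabs_between. }
  destruct (@MVT_is_derive (fun s => f t s y') (fun s => d2 f t s y') x x') as (c2 & m2 & E2).
  { intros s Hs. apply hf. apply H0. apply B; try lra; auto. now apply Rabs_between. }
  destruct (@MVT_is_derive (fun s => f t x s) (fun s => d3 f t x s) y y') as (c3 & m3 & E3).
  { intros s Hs. apply hf. apply H0. apply B; try lra; auto. now apply Rabs_between. }
  apply Rabs_between in m1, m2, m3.
  replace (f t' x' y' - f t x y
            - (d1 f t x y * (t' - t) + d2 f t x y * (x' - x) + d3 f t x y * (y' - y)))
    with ((d1 f c1 x' y' - d1 f t x y) * (t' - t) + (d2 f t c2 y' - d2 f t x y) * (x' - x)
          + (d3 f t x c3 - d3 f t x y) * (y' - y)) by lra.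
  eapply Rle_trans; [apply Rabs_triang|].
  eapply Rle_trans; [apply Rplus_le_compat_r; apply Rabs_triang|].
  rewrite !Rabs_mult, !Rmult_plus_distr_l.
  apply Rplus_le_compat; [apply Rplus_le_compat|];
    (apply Rmult_le_compat_r; [apply Rabs_pos|apply Rlt_le]).
  - apply H1. apply B; lra.
  - apply H2. apply B; auto; lra.
  - apply H3. apply B; auto; lra.
Qed.

Lemma is_derive_incr f s l :
  is_derive f s l -> exists d, 0 < d /\
    forall s', Rabs (s' - s) < d -> Rabs (f s' - f s) <= (Rabs l + 1) * Rabs (s' - s).
Proof.
  intros H. destruct (proj1 (is_deriveP _ _ _) H 1) as [d [Hd H']]; [lra|].
  exists d. split; [exact Hd|]. intros s' Hs. specialize (H' s' Hs).
  replace (f s' - f s) with ((f s' - f s - l * (s' - s)) + l * (s' - s)) by ring.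
  eapply Rle_trans; [apply Rabs_triang|]. rewrite Rabs_mult. lra.
Qed.

Lemma chain3 O f a b c s a' b' c' :
  open3 O -> C3 1 O f -> O (a s) (b s) (c s) ->
  is_derive a s a' -> is_derive b s b' -> is_derive c s c' ->
  is_derive (fun s => f (a s) (b s) (c s)) s
    (d1 f (a s) (b s) (c s) * a' + d2 f (a s) (b s) (c s) * b' + d3 f (a s) (b s) (c s) * c').
Proof.
  intros Ho Hf Hx Ha Hb Hc. apply is_deriveP. intros e He.
  set (D1 := d1 f (a s) (b s) (c s)). set (D2 := d2 f (a s) (b s) (c s)).
  set (D3 := d3 f (a s) (b s) (c s)).
  (* [K] bounds the speed of the inner curve and [M] the partial derivatives of [f]. Half of [e]
     pays for the remainder of [f] (through [K]), half for the remainders of [a], [b], [c] (through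
     [M]). *)
  set (K := (Rabs a' + 1) + (Rabs b' + 1) + (Rabs c' + 1)).
  set (M := Rabs D1 + Rabs D2 + Rabs D3 + 1).
  assert (HK : 0 < K).
  { unfold K. pose proof (Rabs_pos a'). pose proof (Rabs_pos b'). pose proof (Rabs_pos c'). lra. }
  assert (HM : 0 < M).
  { unfold M. pose proof (Rabs_pos D1). pose proof (Rabs_pos D2). pose proof (Rabs_pos D3). lra. }
  assert (He1 : 0 < e / 2 / K) by (repeat apply Rdiv_lt_0_compat; lra).
  assert (He2 : 0 < e / 2 / M) by (repeat apply Rdiv_lt_0_compat; lra).
  destruct (C3_frechet Ho Hf Hx He1) as [d0 [p0 H0]].
  destruct (is_derive_incr Ha) as [da [pa Ia]]. destruct (is_derive_incr Hb) as [db [pb Ib]].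
  destruct (is_derive_incr Hc) as [dc [pc Ic]].
  destruct (proj1 (is_deriveP _ _ _) Ha _ He2) as [ea [qa Ja]].
  destruct (proj1 (is_deriveP _ _ _) Hb _ He2) as [eb [qb Jb]].
  destruct (proj1 (is_deriveP _ _ _) Hc _ He2) as [ec [qc Jc]].
  exists (Rmin (d0 / K) (Rmin (Rmin da (Rmin db dc)) (Rmin ea (Rmin eb ec)))).
  split.
  { repeat apply Rmin_glb_lt; trivial. apply Rdiv_lt_0_compat; assumption. }
  intros s' Hs.
  apply Rmin_Rgt_l in Hs. destruct Hs as [Hs0 Hs].
  apply Rmin_Rgt_l in Hs. destruct Hs as [Hs1 Hs2].
  apply Rmin_Rgt_l in Hs1. destruct Hs1 as [Hsa Hs1].
  apply Rmin_Rgt_l in Hs1. destruct Hs1 as [Hsb Hsc].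
  apply Rmin_Rgt_l in Hs2. destruct Hs2 as [Hta Hs2].
  apply Rmin_Rgt_l in Hs2. destruct Hs2 as [Htb Htc].
  specialize (Ia s' ltac:(lra)). specialize (Ib s' ltac:(lra)). specialize (Ic s' ltac:(lra)).
  specialize (Ja s' ltac:(lra)). specialize (Jb s' ltac:(lra)). specialize (Jc s' ltac:(lra)).
  set (h := Rabs (s' - s)) in *.
  assert (hpos : 0 <= h) by apply Rabs_pos.
  assert (Hh : K * h < d0).
  { apply Rlt_le_trans with (K * (d0 / K)); [apply Rmult_lt_compat_l; lra|].
    right. field. lra. }
  assert (Sum : Rabs (a s' - a s) + Rabs (b s' - b s) + Rabs (c s' - c s) <= K * h)
    by (unfold K; lra).
  pose proof (Rabs_pos (a s' - a s)). pose proof (Rabs_pos (b s' - b s)).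
  pose proof (Rabs_pos (c s' - c s)).
  assert (F := H0 (a s') (b s') (c s') ltac:(repeat split; lra)). fold D1 D2 D3 in F.
  replace (f (a s') (b s') (c s') - f (a s) (b s) (c s) - (D1 * a' + D2 * b' + D3 * c') * (s' - s))
    with ((f (a s') (b s') (c s') - f (a s) (b s) (c s)
            - (D1 * (a s' - a s) + D2 * (b s' - b s) + D3 * (c s' - c s)))
      + (D1 * (a s' - a s - a' * (s' - s)) + D2 * (b s' - b s - b' * (s' - s))
         + D3 * (c s' - c s - c' * (s' - s)))) by ring.
  eapply Rle_trans; [apply Rabs_triang|].
  replace (e * h) with (e / 2 / K * (K * h) + e / 2 / M * h * M) by (field; lra).
  apply Rplus_le_compat.
  - eapply Rle_trans; [exact F|]. apply Rmult_le_compat_l; lra.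
  - eapply Rle_trans; [apply Rabs_triang|].
    eapply Rle_trans; [apply Rplus_le_compat_r; apply Rabs_triang|].
    rewrite !Rabs_mult. unfold M at 2.
    pose proof (Rmult_le_compat_l (Rabs D1) _ _ (Rabs_pos _) Ja).
    pose proof (Rmult_le_compat_l (Rabs D2) _ _ (Rabs_pos _) Jb).
    pose proof (Rmult_le_compat_l (Rabs D3) _ _ (Rabs_pos _) Jc).
    assert (0 <= e / 2 / M * h) by (apply Rmult_le_pos; lra).
    lra.
Qed.

(** By the chain rule each partial derivative is a sum of products in which the partial derivatives
    of [f] are composed with the same inner functions, so an induction on [n], for all [f], closes.
    The case of order 0 is kept apart because the step needs it again for continuity. *)
Lemma C3_comp n O O' f a b c :
  open3 O -> open3 O' -> C3 n O' f -> C3 n O a -> C3 n O b -> C3 n O c ->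
  (forall t x y, O t x y -> O' (a t x y) (b t x y) (c t x y)) ->
  C3 n O (fun t x y => f (a t x y) (b t x y) (c t x y)).
Proof.
  intros Ho Ho' Hf Ha Hb Hc Hm. revert f Hf a b c Ha Hb Hc Hm.
  assert (Base : forall f, C3 0 O' f -> forall a b c, C3 0 O a -> C3 0 O b -> C3 0 O c ->
    (forall t x y, O t x y -> O' (a t x y) (b t x y) (c t x y)) ->
    C3 0 O (fun t x y => f (a t x y) (b t x y) (c t x y))).
  { intros f Hf a b c Ha Hb Hc Hm. rewrite C3_0 in *. intros t x y Hx. apply cont3P.
    intros e He.
    destruct (proj1 (cont3P _ _ _ _) (Hf _ _ _ (Hm t x y Hx)) e He) as [d [Hd H]].
    destruct (proj1 (cont3P _ _ _ _) (Ha t x y Hx) d Hd) as [e1 [p1 H1]].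
    destruct (proj1 (cont3P _ _ _ _) (Hb t x y Hx) d Hd) as [e2 [p2 H2]].
    destruct (proj1 (cont3P _ _ _ _) (Hc t x y Hx) d Hd) as [e3 [p3 H3]].
    exists (Rmin e1 (Rmin e2 e3)). split; [repeat apply Rmin_glb_lt; assumption|].
    intros t' x' y' (k1 & k2 & k3).
    pose proof (Rmin_l e1 (Rmin e2 e3)). pose proof (Rmin_r e1 (Rmin e2 e3)).
    pose proof (Rmin_l e2 e3). pose proof (Rmin_r e2 e3).
    apply H. split; [|split]; [apply H1|apply H2|apply H3]; repeat split; lra. }
  induction n as [|n IH]; intros f Hf a b c Ha Hb Hc Hm; [now apply Base|].
  assert (H1 : C3 1 O' f) by (apply (C3_le (n := S n)); [lia|exact Hf]).
  assert (H0 : C3 0 O (fun t x y => f (a t x y) (b t x y) (c t x y))).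
  { apply Base; trivial; (eapply C3_le; [|eassumption]; lia). }
  apply C3_d in Hf. destruct Hf as (nf & hf & hf1 & hf2 & hf3).
  apply C3_d in Ha. destruct Ha as (na & ha & ha1 & ha2 & ha3).
  apply C3_d in Hb. destruct Hb as (nb & hb & hb1 & hb2 & hb3).
  apply C3_d in Hc. destruct Hc as (nc & hc & hc1 & hc2 & hc3).
  pose (comp := fun (g : R -> R -> R -> R) t x y => g (a t x y) (b t x y) (c t x y)).
  assert (Pm : forall g h, C3 n O' g -> C3 n O h -> C3 n O (fun t x y => comp g t x y * h t x y)).
  { intros g h Hg Hh. apply C3_mult; [exact Ho| |exact Hh]. exact (IH g Hg a b c na nb nc Hm). }
  apply (C3_intro Ho H0
    (f1 := fun t x y => comp (d1 f) t x y * d1 a t x y + comp (d2 f) t x y * d1 b t x y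
                        + comp (d3 f) t x y * d1 c t x y)
    (f2 := fun t x y => comp (d1 f) t x y * d2 a t x y + comp (d2 f) t x y * d2 b t x y
                        + comp (d3 f) t x y * d2 c t x y)
    (f3 := fun t x y => comp (d1 f) t x y * d3 a t x y + comp (d2 f) t x y * d3 b t x y
                        + comp (d3 f) t x y * d3 c t x y)).
  - intros t x y Hx. destruct (ha t x y Hx) as (ka1 & ka2 & ka3).
    destruct (hb t x y Hx) as (kb1 & kb2 & kb3). destruct (hc t x y Hx) as (kc1 & kc2 & kc3).
    split; [|split].
    + apply (@chain3 O' f (fun s => a s x y) (fun s => b s x y) (fun s => c s x y)); auto.
    + apply (@chain3 O' f (fun s => a t s y) (fun s => b t s y) (fun s => c t s y)); auto.
    + apply (@chain3 O' f (fun s => a t x s) (fun s => b t x s) (fun s => c t x s)); auto.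
  - apply C3_plus; [exact Ho|apply C3_plus; [exact Ho| |]|]; apply Pm; assumption.
  - apply C3_plus; [exact Ho|apply C3_plus; [exact Ho| |]|]; apply Pm; assumption.
  - apply C3_plus; [exact Ho|apply C3_plus; [exact Ho| |]|]; apply Pm; assumption.
Qed.

(** * The exponential and the reciprocal *)

Lemma open3_T : open3 (fun _ _ _ => True).
Proof. intros t x y _. exists 1. split; [lra|trivial]. Qed.

Lemma nonzero_open z : z <> 0 -> exists e, 0 < e /\ forall z', Rabs (z' - z) < e -> z' <> 0.
Proof.
  intros Hz. exists (Rabs z). split; [now apply Rabs_pos_lt|].
  intros z' H E. subst z'. rewrite Rminus_0_l, Rabs_Ropp in H. lra.
Qed.

Lemma C3_exp1 n : C3 n (fun _ _ _ => True) (fun t _ _ => exp t).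
Proof.
  assert (H0 : C3 0 (fun _ _ _ => True) (fun t _ _ => exp t)).
  { apply C3_0. intros t x y _. unfold cont3.
    apply (continuous_comp (fun q : R * R * R => fst (fst q)) exp).
    - apply (proj1 (C3_0 _ _) (C3_1 0 open3_T)). exact I.
    - apply (ex_derive_continuous (K := R_AbsRing) (V := R_NormedModule)).
      exists (exp t). exact (is_derive_exp t). }
  induction n as [|n IH]; [exact H0|].
  apply (C3_intro open3_T H0 (f1 := fun t _ _ => exp t) (f2 := fun _ _ _ => 0)
    (f3 := fun _ _ _ => 0)); trivial; try apply C3_const, open3_T.
  intros t x y _. split; [apply is_derive_exp|].
  split; apply is_derive_cst.
Qed.

Lemma open3_nz : open3 (fun t _ _ => t <> 0).
Proof.
  intros t x y H. destruct (nonzero_open H) as [e [He H']].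
  exists e. split; [exact He|]. intros t' x' y' (h & _). now apply H'.
Qed.

(** The derivative of [/ t] is minus its own square, so the induction closes through [C3_mult]. *)
Lemma C3_inv1 n : C3 n (fun t _ _ => t <> 0) (fun t _ _ => / t).
Proof.
  assert (H0 : C3 0 (fun t _ _ => t <> 0) (fun t _ _ => / t)).
  { apply C3_0. intros t x y Ht. unfold cont3.
    apply (continuous_comp (fun q : R * R * R => fst (fst q)) Rinv).
    - apply (proj1 (C3_0 _ _) (C3_1 0 open3_T)). exact I.
    - apply (ex_derive_continuous (K := R_AbsRing) (V := R_NormedModule)). exists (- 1 / t ^ 2).
      apply (is_derive_inv (fun t => t)); trivial. apply is_derive_var. }
  pose proof open3_nz.
  induction n as [|n IH]; [exact H0|].
  apply (C3_intro open3_nz H0 (f1 := fun t _ _ => (-1) * (/ t * / t)) (f2 := fun _ _ _ => 0)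
    (f3 := fun _ _ _ => 0)); trivial; try (apply C3_const, open3_nz).
  - intros t x y Ht. split; [|split; apply is_derive_cst].
    replace ((-1) * (/ t * / t)) with (- 1 / t ^ 2) by (field; exact Ht).
    apply (is_derive_inv (fun t => t)); trivial. apply is_derive_var.
  - repeat apply C3_mult; trivial. now apply C3_const.
Qed.

Lemma C3_exp n O f : open3 O -> C3 n O f -> C3 n O (fun t x y => exp (f t x y)).
Proof.
  intros Ho Hf.
  apply (@C3_comp n O _ (fun t _ _ => exp t) f (fun _ _ _ => 0) (fun _ _ _ => 0) Ho open3_T);
    trivial; [apply C3_exp1|now apply C3_const|now apply C3_const].
Qed.

Lemma C3_inv n O f :
  open3 O -> C3 n O f -> (forall t x y, O t x y -> f t x y <> 0) ->
  C3 n O (fun t x y => / f t x y).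
Proof.
  intros Ho Hf Hz.
  apply (@C3_comp n O _ (fun t _ _ => / t) f (fun _ _ _ => 0) (fun _ _ _ => 0) Ho open3_nz);
    trivial; [apply C3_inv1|now apply C3_const|now apply C3_const].
Qed.

(** * Symmetry of second derivatives *)

Lemma cont3_slice12 f t x y :
  cont3 f t x y -> continuity_2d_pt (fun u v => f u v y) t x.
Proof.
  intros H e. destruct (proj1 (cont3P _ _ _ _) H e (cond_pos e)) as [d [Hd H']].
  exists (mkposreal d Hd). intros u v hu hv. apply H'.
  split; [exact hu|split; [exact hv|]]. rewrite Rminus_diag, Rabs_R0. exact Hd.
Qed.

Lemma cont3_slice13 f t x y :
  cont3 f t x y -> continuity_2d_pt (fun u v => f u x v) t y.
Proof.
  intros H e. destruct (proj1 (cont3P _ _ _ _) H e (cond_pos e)) as [d [Hd H']].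
  exists (mkposreal d Hd). intros u v hu hv. apply H'.
  split; [exact hu|split; [|exact hv]]. rewrite Rminus_diag, Rabs_R0. exact Hd.
Qed.

Lemma cont3_slice23 f t x y :
  cont3 f t x y -> continuity_2d_pt (fun u v => f t u v) x y.
Proof.
  intros H e. destruct (proj1 (cont3P _ _ _ _) H e (cond_pos e)) as [d [Hd H']].
  exists (mkposreal d Hd). intros u v hu hv. apply H'.
  split; [|split; [exact hu|exact hv]]. rewrite Rminus_diag, Rabs_R0. exact Hd.
Qed.

Lemma schwarz12 O f t x y :
  open3 O -> C3 2 O f -> O t x y -> d1 (d2 f) t x y = d2 (d1 f) t x y.
Proof.
  intros Ho Hf Hx. apply C3_d in Hf. destruct Hf as (_ & hf & h1 & h2 & _).
  apply C3_d in h1, h2. destruct h1 as (_ & h1 & _ & h12 & _).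
  destruct h2 as (_ & h2 & h21 & _ & _).
  destruct (Ho _ _ _ Hx) as [e [He HO]].
  apply (Schwarz (fun a b => f a b y)).
  - exists (mkposreal e He). intros u v hu hv.
    assert (Hu : O u v y).
    { apply HO. split; [exact hu|split; [exact hv|]]. rewrite Rminus_diag, Rabs_R0. exact He. }
    destruct (hf _ _ _ Hu) as (k1 & k2 & _). destruct (h1 _ _ _ Hu) as (_ & l1 & _).
    destruct (h2 _ _ _ Hu) as (l2 & _).
    split; [eexists; exact k1|split; [eexists; exact k2|split; eexists; [exact l2|exact l1]]].
  - apply (@cont3_slice12 (d1 (d2 f))). now apply (proj1 (C3_0 _ _) h21).
  - apply (@cont3_slice12 (d2 (d1 f))). now apply (proj1 (C3_0 _ _) h12).
Qed.

Lemma schwarz13 O f t x y :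
  open3 O -> C3 2 O f -> O t x y -> d1 (d3 f) t x y = d3 (d1 f) t x y.
Proof.
  intros Ho Hf Hx. apply C3_d in Hf. destruct Hf as (_ & hf & h1 & _ & h2).
  apply C3_d in h1, h2. destruct h1 as (_ & h1 & _ & _ & h12).
  destruct h2 as (_ & h2 & h21 & _ & _).
  destruct (Ho _ _ _ Hx) as [e [He HO]].
  apply (Schwarz (fun a b => f a x b)).
  - exists (mkposreal e He). intros u v hu hv.
    assert (Hu : O u x v).
    { apply HO. split; [exact hu|split; [|exact hv]]. rewrite Rminus_diag, Rabs_R0. exact He. }
    destruct (hf _ _ _ Hu) as (k1 & _ & k2). destruct (h1 _ _ _ Hu) as (_ & _ & l1).
    destruct (h2 _ _ _ Hu) as (l2 & _).
    split; [eexists; exact k1|split; [eexists; exact k2|split; eexists; [exact l2|exact l1]]].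
  - apply (@cont3_slice13 (d1 (d3 f))). now apply (proj1 (C3_0 _ _) h21).
  - apply (@cont3_slice13 (d3 (d1 f))). now apply (proj1 (C3_0 _ _) h12).
Qed.

Lemma schwarz23 O f t x y :
  open3 O -> C3 2 O f -> O t x y -> d2 (d3 f) t x y = d3 (d2 f) t x y.
Proof.
  intros Ho Hf Hx. apply C3_d in Hf. destruct Hf as (_ & hf & _ & h1 & h2).
  apply C3_d in h1, h2. destruct h1 as (_ & h1 & _ & _ & h12).
  destruct h2 as (_ & h2 & _ & h21 & _).
  destruct (Ho _ _ _ Hx) as [e [He HO]].
  apply (Schwarz (fun a b => f t a b)).
  - exists (mkposreal e He). intros u v hu hv.
    assert (Hu : O t u v).
    { apply HO. split; [|split; [exact hu|exact hv]]. rewrite Rminus_diag, Rabs_R0. exact He. }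
    destruct (hf _ _ _ Hu) as (_ & k1 & k2). destruct (h1 _ _ _ Hu) as (_ & _ & l1).
    destruct (h2 _ _ _ Hu) as (_ & l2 & _).
    split; [eexists; exact k1|split; [eexists; exact k2|split; eexists; [exact l2|exact l1]]].
  - apply (@cont3_slice23 (d2 (d3 f))). now apply (proj1 (C3_0 _ _) h21).
  - apply (@cont3_slice23 (d3 (d2 f))). now apply (proj1 (C3_0 _ _) h12).
Qed.

Definition smooth3 (O : R -> R -> R -> Prop) (f : R -> R -> R -> R) : Prop :=
  forall n, C3 n O f.

Lemma smooth3_d1 O f : smooth3 O f -> smooth3 O (d1 f).
Proof. intros H n. now apply (C3_d (H (S n))). Qed.
Lemma smooth3_d2 O f : smooth3 O f -> smooth3 O (d2 f).
Proof. intros H n. now apply (C3_d (H (S n))). Qed.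
Lemma smooth3_d3 O f : smooth3 O f -> smooth3 O (d3 f).
Proof. intros H n. now apply (C3_d (H (S n))). Qed.

(** * Smooth functions of two variables *)

(** Two variables are treated as three with the first one ignored, so the calculus above applies
    unchanged. *)
Definition open2 (O : R -> R -> Prop) : Prop := open3 (fun _ => O).

Definition smooth2 (O : R -> R -> Prop) (f : R -> R -> R) : Prop :=
  smooth3 (fun _ => O) (fun _ => f).

Lemma open2P O :
  open2 O <-> forall x y, O x y -> exists e, 0 < e /\
    forall x' y', Rabs (x' - x) < e -> Rabs (y' - y) < e -> O x' y'.
Proof.
  split.
  - intros H x y Hx. destruct (H 0 x y Hx) as [e [He H']]. exists e. split; [exact He|].
    intros x' y' h h'. apply (H' 0). repeat split; trivial.
    rewrite Rminus_diag, Rabs_R0. exact He.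
  - intros H t x y Hx. destruct (H x y Hx) as [e [He H']]. exists e. split; [exact He|].
    intros t' x' y' (_ & h & h'). now apply H'.
Qed.

Section Smooth2.
Variable O : R -> R -> Prop.
Hypothesis Ho : open2 O.

Lemma smooth2_ext f g : (forall x y, O x y -> f x y = g x y) -> smooth2 O f -> smooth2 O g.
Proof. intros E H n. apply (C3_ext (f := fun _ => f)); auto. Qed.

Lemma smooth2_const c : smooth2 O (fun _ _ => c).
Proof. intros n. apply (C3_const n c Ho). Qed.

Lemma smooth2_fst : smooth2 O (fun x _ => x).
Proof. intros n. apply (C3_2 n Ho). Qed.

Lemma smooth2_snd : smooth2 O (fun _ y => y).
Proof. intros n. apply (C3_3 n Ho). Qed.

Lemma smooth2_plus f g : smooth2 O f -> smooth2 O g -> smooth2 O (fun x y => f x y + g x y).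
Proof. intros Hf Hg n. exact (C3_plus Ho (Hf n) (Hg n)). Qed.

Lemma smooth2_mult f g : smooth2 O f -> smooth2 O g -> smooth2 O (fun x y => f x y * g x y).
Proof. intros Hf Hg n. exact (C3_mult Ho (Hf n) (Hg n)). Qed.

Lemma smooth2_opp f : smooth2 O f -> smooth2 O (fun x y => - f x y).
Proof.
  intros Hf. apply (smooth2_ext (f := fun x y => (-1) * f x y)).
  - intros. ring.
  - apply smooth2_mult; [apply smooth2_const|exact Hf].
Qed.

Lemma smooth2_minus f g : smooth2 O f -> smooth2 O g -> smooth2 O (fun x y => f x y - g x y).
Proof. intros Hf Hg. apply smooth2_plus; [exact Hf|now apply smooth2_opp]. Qed.

Lemma smooth2_pow f k : smooth2 O f -> smooth2 O (fun x y => f x y ^ k).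
Proof.
  intros Hf. induction k as [|k IH]; simpl.
  - apply smooth2_const.
  - now apply smooth2_mult.
Qed.

Lemma smooth2_exp f : smooth2 O f -> smooth2 O (fun x y => exp (f x y)).
Proof. intros Hf n. exact (C3_exp Ho (Hf n)). Qed.

Lemma smooth2_inv f :
  smooth2 O f -> (forall x y, O x y -> f x y <> 0) -> smooth2 O (fun x y => / f x y).
Proof. intros Hf Hz n. apply (C3_inv Ho (Hf n)). intros _. exact Hz. Qed.

Lemma smooth2_div f g :
  smooth2 O f -> smooth2 O g -> (forall x y, O x y -> g x y <> 0) ->
  smooth2 O (fun x y => f x y / g x y).
Proof. intros Hf Hg Hz. apply smooth2_mult; [exact Hf|now apply smooth2_inv]. Qed.

Lemma smooth2_dx f : smooth2 O f -> smooth2 O (dx f).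
Proof. exact (@smooth3_d2 _ (fun _ => f)). Qed.

Lemma smooth2_dy f : smooth2 O f -> smooth2 O (dy f).
Proof. exact (@smooth3_d3 _ (fun _ => f)). Qed.

Lemma is_dx f x y : smooth2 O f -> O x y -> is_derive (fun u => f u y) x (dx f x y).
Proof.
  intros Hf Hx. destruct (C3_d (Hf 1%nat)) as (_ & H & _). destruct (H 0 x y Hx) as (_ & h & _).
  exact h.
Qed.

Lemma is_dy f x y : smooth2 O f -> O x y -> is_derive (fun v => f x v) y (dy f x y).
Proof.
  intros Hf Hx. destruct (C3_d (Hf 1%nat)) as (_ & H & _). destruct (H 0 x y Hx) as (_ & _ & h).
  exact h.
Qed.

Lemma dx_ext f g x y : (forall x y, O x y -> f x y = g x y) -> O x y -> dx f x y = dx g x y.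
Proof.
  intros E Hx. apply Derive_ext_loc. apply (filter_imp (fun s => O s y)); [auto|].
  exact (open3_2 (t := 0) Ho Hx).
Qed.

Lemma dy_ext f g x y : (forall x y, O x y -> f x y = g x y) -> O x y -> dy f x y = dy g x y.
Proof.
  intros E Hx. apply Derive_ext_loc. apply (filter_imp (fun s => O x s)); [auto|].
  exact (open3_3 (t := 0) Ho Hx).
Qed.

Lemma dydx f x y : smooth2 O f -> O x y -> dy (dx f) x y = dx (dy f) x y.
Proof. intros Hf Hx. symmetry. exact (@schwarz23 _ (fun _ => f) 0 x y Ho (Hf 2%nat) Hx). Qed.

Lemma dx_plus f g x y : smooth2 O f -> smooth2 O g -> O x y ->
  dx (fun x y => f x y + g x y) x y = dx f x y + dx g x y.
Proof.
  intros Hf Hg Hx. apply is_derive_unique.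
  apply (is_derive_plus (V := R_NormedModule)); now apply is_dx.
Qed.

Lemma dy_plus f g x y : smooth2 O f -> smooth2 O g -> O x y ->
  dy (fun x y => f x y + g x y) x y = dy f x y + dy g x y.
Proof.
  intros Hf Hg Hx. apply is_derive_unique.
  apply (is_derive_plus (V := R_NormedModule)); now apply is_dy.
Qed.

Lemma dx_mult f g x y : smooth2 O f -> smooth2 O g -> O x y ->
  dx (fun x y => f x y * g x y) x y = dx f x y * g x y + f x y * dx g x y.
Proof.
  intros Hf Hg Hx. apply is_derive_unique.
  apply (is_derive_mult (fun u => f u y) (fun u => g u y) x);
    [now apply is_dx|now apply is_dx|apply Rmult_comm].
Qed.

Lemma dy_mult f g x y : smooth2 O f -> smooth2 O g -> O x y ->
  dy (fun x y => f x y * g x y) x y = dy f x y * g x y + f x y * dy g x y.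
Proof.
  intros Hf Hg Hx. apply is_derive_unique.
  apply (is_derive_mult (fun u => f x u) (fun u => g x u) y);
    [now apply is_dy|now apply is_dy|apply Rmult_comm].
Qed.

Lemma dx_opp f x y : smooth2 O f -> O x y -> dx (fun x y => - f x y) x y = - dx f x y.
Proof. intros Hf Hx. apply Derive_opp. Qed.

Lemma dy_opp f x y : smooth2 O f -> O x y -> dy (fun x y => - f x y) x y = - dy f x y.
Proof. intros Hf Hx. apply Derive_opp. Qed.

Lemma dx_minus f g x y : smooth2 O f -> smooth2 O g -> O x y ->
  dx (fun x y => f x y - g x y) x y = dx f x y - dx g x y.
Proof.
  intros Hf Hg Hx. apply is_derive_unique.
  apply (is_derive_minus (V := R_NormedModule)); now apply is_dx.
Qed.

Lemma dy_minus f g x y : smooth2 O f -> smooth2 O g -> O x y ->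
  dy (fun x y => f x y - g x y) x y = dy f x y - dy g x y.
Proof.
  intros Hf Hg Hx. apply is_derive_unique.
  apply (is_derive_minus (V := R_NormedModule)); now apply is_dy.
Qed.

Lemma dx_exp f x y : smooth2 O f -> O x y ->
  dx (fun x y => exp (f x y)) x y = dx f x y * exp (f x y).
Proof.
  intros Hf Hx. apply is_derive_unique.
  apply (is_derive_comp exp (fun u => f u y)); [apply is_derive_exp|now apply is_dx].
Qed.

Lemma dy_exp f x y : smooth2 O f -> O x y ->
  dy (fun x y => exp (f x y)) x y = dy f x y * exp (f x y).
Proof.
  intros Hf Hx. apply is_derive_unique.
  apply (is_derive_comp exp (fun u => f x u)); [apply is_derive_exp|now apply is_dy].
Qed.

End Smooth2.

Lemma dx_const c x y : dx (fun _ _ => c) x y = 0.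
Proof. exact (Derive_const c _). Qed.

Lemma dy_const c x y : dy (fun _ _ => c) x y = 0.
Proof. exact (Derive_const c _). Qed.

Lemma chain2 O f a b s a' b' :
  open2 O -> smooth2 O f -> O (a s) (b s) -> is_derive a s a' -> is_derive b s b' ->
  is_derive (fun s => f (a s) (b s)) s (dx f (a s) (b s) * a' + dy f (a s) (b s) * b').
Proof.
  intros Ho Hf Hx Ha Hb.
  assert (H := @chain3 _ (fun _ => f) (fun _ => 0) a b s 0 a' b' Ho (Hf 1%nat) Hx
    (is_derive_cst 0 s) Ha Hb).
  rewrite Rmult_0_r, Rplus_0_l in H. exact H.
Qed.

Lemma smooth2_sub (O O' : R -> R -> Prop) f :
  (forall x y, O x y -> O' x y) -> smooth2 O' f -> smooth2 O f.
Proof. intros H Hf n. apply (C3_sub (O' := fun _ => O')); auto. Qed.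

Lemma smooth3_comp2 O O' f a b :
  open3 O -> open2 O' -> smooth2 O' f -> smooth3 O a -> smooth3 O b ->
  (forall t x y, O t x y -> O' (a t x y) (b t x y)) ->
  smooth3 O (fun t x y => f (a t x y) (b t x y)).
Proof.
  intros Ho Ho' Hf Ha Hb H n.
  exact (@C3_comp n O _ (fun _ => f) (fun _ _ _ => 0) a b Ho Ho' (Hf n) (C3_const n 0 Ho)
    (Ha n) (Hb n) H).
Qed.

Lemma smooth2_comp O O' f a b :
  open2 O -> open2 O' -> smooth2 O' f -> smooth2 O a -> smooth2 O b ->
  (forall x y, O x y -> O' (a x y) (b x y)) ->
  smooth2 O (fun x y => f (a x y) (b x y)).
Proof.
  intros Ho Ho' Hf Ha Hb H.
  apply (@smooth3_comp2 _ _ f (fun _ => a) (fun _ => b) Ho Ho' Hf Ha Hb). intros _. exact H.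
Qed.

Lemma smooth2_cont O f x y : smooth2 O f -> O x y -> continuity_2d_pt f x y.
Proof.
  intros Hf Hx. apply (@cont3_slice23 (fun _ => f) 0). exact (proj1 (C3_0 _ _) (Hf 0%nat) 0 x y Hx).
Qed.

Lemma cont3_lift f t x y : continuity_2d_pt f x y <-> cont3 (fun _ => f) t x y.
Proof.
  split; [|apply cont3_slice23]. intros H. apply cont3P. intros e He.
  destruct (H (mkposreal e He)) as [d Hd]. exists d. split; [apply cond_pos|].
  intros _ x' y' (_ & h & h'). now apply Hd.
Qed.

(** The link with Coquelicot's [ex_diff_n]: the two notions differ by the derivative in the dummy
    variable, which is the constant 0. *)
Lemma smooth2P O f :
  open2 O -> smooth2 O f <-> forall x y, O x y -> forall n, ex_diff_n f n x y.
Proof.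
  intros Ho.
  assert (H : forall n f, C3 n (fun _ => O) (fun _ => f) <->
                          forall x y, O x y -> ex_diff_n f n x y).
  { clear f. induction n as [|n IH]; intros f.
    - rewrite C3_0. split.
      + intros H x y Hx. split; [|exact I]. apply (cont3_lift _ 0). now apply H.
      + intros H t x y Hx. apply cont3_lift. apply (H x y Hx).
    - split.
      + intros H x y Hx. apply C3_d in H. destruct H as (h0 & h & _ & h2 & h3).
        destruct (h 0 x y Hx) as (_ & k2 & k3).
        split; [apply (cont3_lift _ 0)|].
        { apply (C3_le (m := 0)) in h0; [|lia]. now apply (proj1 (C3_0 _ _) h0). }
        split; [eexists; exact k2|]. split; [eexists; exact k3|].
        split; [exact (proj1 (IH (dx f)) h2 x y Hx)|exact (proj1 (IH (dy f)) h3 x y Hx)].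
      + intros H. apply (C3_intro (f1 := fun _ _ _ => 0) (f2 := fun _ => dx f) (f3 := fun _ => dy f)).
        * exact Ho.
        * apply C3_0. intros t x y Hx. apply cont3_lift. apply (H x y Hx).
        * intros t x y Hx. destruct (H x y Hx) as (_ & k2 & k3 & _).
          split; [apply is_derive_cst|].
          split; now apply Derive_correct.
        * now apply C3_const.
        * apply (IH (dx f)). intros x y Hx. apply (H x y Hx).
        * apply (IH (dy f)). intros x y Hx. apply (H x y Hx). }
  split.
  - intros Hf x y Hx n. now apply (proj1 (H n f) (Hf n)).
  - intros Hf n. apply H. intros x y Hx. now apply Hf.
Qed.

(** * The structure equations *)

(** Smoothness by recursion on the expression; the nonvanishing of a denominator is left as a goal
    when no hypothesis states it. *)
Ltac sm Ho :=
  cbv beta zeta;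
  lazymatch goal with
  | |- smooth2 _ (fun _ _ => ?c) => exact (smooth2_const Ho c)
  | |- smooth2 _ (fun x y => @?f x y + @?g x y) => apply (@smooth2_plus _ Ho f g); sm Ho
  | |- smooth2 _ (fun x y => @?f x y - @?g x y) => apply (@smooth2_minus _ Ho f g); sm Ho
  | |- smooth2 _ (fun x y => @?f x y * @?g x y) => apply (@smooth2_mult _ Ho f g); sm Ho
  | |- smooth2 _ (fun x y => - @?f x y) => apply (@smooth2_opp _ Ho f); sm Ho
  | |- smooth2 _ (fun x y => @?f x y ^ ?k) => apply (@smooth2_pow _ Ho f k); sm Ho
  | |- smooth2 _ (fun x y => exp (@?f x y)) => apply (@smooth2_exp _ Ho f); sm Ho
  | |- smooth2 _ (fun x y => @?f x y / @?g x y) =>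
      apply (@smooth2_div _ Ho f g); [sm Ho|sm Ho|try assumption]
  | |- smooth2 _ (fun x y => / @?f x y) =>
      apply (@smooth2_inv _ Ho f); [sm Ho|try assumption]
  | |- smooth2 _ (dx ?f) => apply (@smooth2_dx _ f); sm Ho
  | |- smooth2 _ (fun x y => dx ?f x y) => apply (@smooth2_dx _ f); sm Ho
  | |- smooth2 _ (dy ?f) => apply (@smooth2_dy _ f); sm Ho
  | |- smooth2 _ (fun x y => dy ?f x y) => apply (@smooth2_dy _ f); sm Ho
  | |- smooth2 _ _ => solve [assumption | auto]
  end.

(** One step of symbolic differentiation. The domain is found through a hypothesis [O u v] on the
    point. Quotients and powers under a derivative are written as products beforehand. *)
Ltac dstep Ho :=
  let go l := (let H := fresh in assert (H := l); cbv beta in H; rewrite H; clear H) in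
  match goal with
  | |- context [dx (fun x y => ?f x y)] => progress change (dx (fun x y => f x y)) with (dx f)
  | |- context [dy (fun x y => ?f x y)] => progress change (dy (fun x y => f x y)) with (dy f)
  | |- context [dx (fun _ _ => ?c) ?u ?v] => rewrite (dx_const c u v)
  | |- context [dy (fun _ _ => ?c) ?u ?v] => rewrite (dy_const c u v)
  | Hx : ?O ?u ?v |- context [dx (fun x y => @?f x y + @?g x y) ?u ?v] =>
      go (@dx_plus O f g u v ltac:(sm Ho) ltac:(sm Ho) Hx)
  | Hx : ?O ?u ?v |- context [dy (fun x y => @?f x y + @?g x y) ?u ?v] =>
      go (@dy_plus O f g u v ltac:(sm Ho) ltac:(sm Ho) Hx)
  | Hx : ?O ?u ?v |- context [dx (fun x y => @?f x y - @?g x y) ?u ?v] =>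
      go (@dx_minus O f g u v ltac:(sm Ho) ltac:(sm Ho) Hx)
  | Hx : ?O ?u ?v |- context [dy (fun x y => @?f x y - @?g x y) ?u ?v] =>
      go (@dy_minus O f g u v ltac:(sm Ho) ltac:(sm Ho) Hx)
  | Hx : ?O ?u ?v |- context [dx (fun x y => @?f x y * @?g x y) ?u ?v] =>
      go (@dx_mult O f g u v ltac:(sm Ho) ltac:(sm Ho) Hx)
  | Hx : ?O ?u ?v |- context [dy (fun x y => @?f x y * @?g x y) ?u ?v] =>
      go (@dy_mult O f g u v ltac:(sm Ho) ltac:(sm Ho) Hx)
  | Hx : ?O ?u ?v |- context [dx (fun x y => - @?f x y) ?u ?v] =>
      go (@dx_opp O f u v ltac:(sm Ho) Hx)
  | Hx : ?O ?u ?v |- context [dy (fun x y => - @?f x y) ?u ?v] =>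
      go (@dy_opp O f u v ltac:(sm Ho) Hx)
  | Hx : ?O ?u ?v |- context [dx (fun x y => exp (@?f x y)) ?u ?v] =>
      go (@dx_exp O f u v ltac:(sm Ho) Hx)
  | Hx : ?O ?u ?v |- context [dy (fun x y => exp (@?f x y)) ?u ?v] =>
      go (@dy_exp O f u v ltac:(sm Ho) Hx)
  end.

Ltac dsimp Ho := cbv beta zeta; repeat dstep Ho.

Section Structure.
Variables (E : ode) (c : chart) (O : R -> R -> Prop).
Hypothesis Ho : open2 O.
Hypothesis sP : smooth2 O (cP E).
Hypothesis sQ : smooth2 O (cQ E).
Hypothesis sR : smooth2 O (cR E).
Hypothesis sS : smooth2 O (cS E).
Hypothesis Happ : forall x y, O x y -> applicable E c x y.
Hypothesis HF : forall x y, O x y -> invF E x y = 0.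
Hypothesis HN : forall x y, O x y -> invN c E x y = 0.
Hypothesis HOm : forall x y, O x y -> Omega c E x y = 0.

Notation P := (cP E).
Notation Q := (cQ E).
Notation R_ := (cR E).
Notation S_ := (cS E).
Notation a := (invA E).
Notation b := (invB E).
Notation f1 := (phi1 c E).
Notation f2 := (phi2 c E).
Notation T := (Theta c E).
Notation t1 := (theta1 c E).
Notation t2 := (theta2 c E).

Lemma smooth_invA : smooth2 O a.
Proof. unfold invA. sm Ho. Qed.

Lemma smooth_invB : smooth2 O b.
Proof. unfold invB. sm Ho. Qed.

Local Hint Resolve smooth_invA : core.
Local Hint Resolve smooth_invB : core.

Lemma smooth_phi1 : smooth2 O f1.
Proof.
  clear HN HOm. unfold phi1. destruct c; cbv beta zeta; sm Ho; intros x y Hx; specialize (Happ Hx);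
    simpl in Happ; try apply Rmult_integral_contrapositive_currified;
    try apply pow_nonzero; trivial; lra.
Qed.

Lemma smooth_phi2 : smooth2 O f2.
Proof.
  clear HN HOm. unfold phi2. destruct c; cbv beta zeta; sm Ho; intros x y Hx; specialize (Happ Hx);
    simpl in Happ; try apply Rmult_integral_contrapositive_currified;
    try apply pow_nonzero; trivial; lra.
Qed.

Local Hint Resolve smooth_phi1 : core.
Local Hint Resolve smooth_phi2 : core.

Lemma smooth_Gamma k i j : smooth2 O (Gamma c E k i j).
Proof. unfold Gamma. destruct k, i, j; sm Ho. Qed.

Local Hint Resolve smooth_Gamma : core.

Lemma smooth_rho k q : smooth2 O (rho c E k q).
Proof. unfold rho, sum_idx, partial. sm Ho. Qed.

Local Hint Resolve smooth_rho : core.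

Lemma smooth_Theta : smooth2 O T.
Proof.
  pose proof smooth_rho. clear HN HOm. unfold Theta, omega.
  destruct c; cbv beta zeta; sm Ho; intros x y Hx; exact (Happ Hx).
Qed.

Local Hint Resolve smooth_Theta : core.

Lemma smooth_theta1 : smooth2 O t1.
Proof. unfold theta1. sm Ho. Qed.

Lemma smooth_theta2 : smooth2 O t2.
Proof. unfold theta2. sm Ho. Qed.

Local Hint Resolve smooth_theta1 : core.
Local Hint Resolve smooth_theta2 : core.

Lemma smooth_invZ : smooth2 O (invZ c E).
Proof. unfold invZ, invC, invD. sm Ho. Qed.

Lemma smooth_invL : smooth2 O (invL c E).
Proof. pose proof smooth_invZ. unfold invL. sm Ho. Qed.

Lemma phi_closed x y : O x y -> dy f1 x y = dx f2 x y.
Proof. intros Hx. generalize (HOm Hx). unfold Omega. lra. Qed.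

(** The vanishing of [F] enters through its fifth power, which is polynomial in the jets of the
    coefficients. *)
Lemma invF_pow x y : O x y ->
  a x y * b x y * dy a x y + a x y * b x y * dx b x y
  - a x y ^ 2 * dy b x y - b x y ^ 2 * dx a x y
  - P x y * b x y ^ 3 + 3 * Q x y * a x y * b x y ^ 2
  - 3 * R_ x y * a x y ^ 2 * b x y + S_ x y * a x y ^ 3 = 0.
Proof.
  intros Hx. generalize (HF Hx). unfold invF. intros H.
  rewrite <- (fifth_root_pow (_ + S_ x y * a x y ^ 3)), H. ring.
Qed.

(* [(A, B)] is parallel for [Gamma] up to the weight [-phi]. *)
Lemma grad_AB x y : O x y ->
  dx a x y = (Q x y - 2 / 3 * f1 x y) * a x y - P x y * b x y - f1 x y * a x y /\
  dx b x y = (R_ x y - 1 / 3 * f2 x y) * a x y + (- Q x y - 1 / 3 * f1 x y) * b x y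
             - f1 x y * b x y /\
  dy a x y = (R_ x y - 1 / 3 * f2 x y) * a x y + (- Q x y - 1 / 3 * f1 x y) * b x y
             - f2 x y * a x y /\
  dy b x y = S_ x y * a x y + (- R_ x y - 2 / 3 * f2 x y) * b x y - f2 x y * b x y.
Proof.
  clear HOm. intros Hx. pose proof (invF_pow Hx) as H5. pose proof (HN Hx) as HNx.
  assert (H0 : match c with chartA => a x y <> 0 | chartB => b x y <> 0 end)
    by exact (Happ Hx).
  assert (H1 : f1 x y = phi1 c E x y) by reflexivity.
  assert (H2 : f2 x y = phi2 c E x y) by reflexivity.
  revert H5 HNx H0 H1 H2. unfold invN, invG, invH, phi1 at 2, phi2 at 2. cbv zeta.
  generalize (f1 x y) (f2 x y) (dx a x y) (dx b x y) (dy a x y) (dy b x y)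
    (a x y) (b x y) (P x y) (Q x y) (R_ x y) (S_ x y).
  intros u v ax bx ay by_ A B p q r s H5 HNx H0 H1 H2.
  destruct c.
  (* The four first derivatives of [A] and [B] solve a linear system. In this chart the definition
     of [phi1] gives A_x, that of [phi2] together with [N = 0] gives A_y and B_x, and [F = 0] gives
     B_y. In the other chart [phi2] gives B_y, [phi1] and [N = 0] give A_y and B_x, and [F = 0]
     gives A_x. *)
  - assert (N' : - A * ay - 3 * B * ax + 4 * A * bx - 3 * p * B ^ 2 + 6 * q * A * B
                 - 3 * r * A ^ 2 = 0).
    { apply Ropp_eq_reg. apply Rmult_eq_reg_r with (/ (3 * A));
        [rewrite Ropp_0, Rmult_0_l; exact HNx|].
      apply Rinv_neq_0_compat, Rmult_integral_contrapositive_currified; [lra|exact H0]. }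
    assert (Ax : ax = q * A - p * B - 5 / 3 * A * u) by (rewrite H1; field; exact H0).
    subst ax. clear H1 HNx.
    assert (S1 : 5 * A * v = 6 * r * A - 5 * B * u - 3 * (ay + bx) - 6 * q * B)
      by (rewrite H2; field; exact H0).
    assert (S2 : 4 * bx - ay = 3 * A * r - 5 * B * u - 3 * q * B).
    { apply Rmult_eq_reg_l with A; [lra|exact H0]. }
    assert (Ay : ay = A * r - 4 / 3 * A * v - q * B - 1 / 3 * B * u) by lra.
    assert (Bx : bx = A * r - 1 / 3 * A * v - q * B - 4 / 3 * B * u) by lra.
    clear S1 S2 H2 N'. subst ay bx.
    assert (By : by_ = s * A - r * B - 5 / 3 * v * B).
    { apply Rmult_eq_reg_l with (A ^ 2); [lra|now apply pow_nonzero]. }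
    lra.
  - assert (N' : - B * bx - 3 * A * by_ + 4 * B * ay + 3 * s * A ^ 2 - 6 * r * A * B
                 + 3 * q * B ^ 2 = 0).
    { apply Rmult_eq_reg_r with (/ (3 * B)); [rewrite Rmult_0_l; exact HNx|].
      apply Rinv_neq_0_compat, Rmult_integral_contrapositive_currified; [lra|exact H0]. }
    assert (By : by_ = s * A - r * B - 5 / 3 * B * v) by (rewrite H2; field; exact H0).
    subst by_. clear H2 HNx.
    assert (S1 : 5 * B * u = 6 * A * r - 5 * A * v - 3 * (ay + bx) - 6 * q * B)
      by (rewrite H1; field; exact H0).
    assert (S2 : 4 * ay - bx = 3 * A * r - 5 * A * v - 3 * q * B).
    { apply Rmult_eq_reg_l with B; [lra|exact H0]. }
    assert (Ay : ay = A * r - 4 / 3 * A * v - q * B - 1 / 3 * B * u) by lra.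
    assert (Bx : bx = A * r - 1 / 3 * A * v - q * B - 4 / 3 * B * u) by lra.
    clear S1 S2 H1 N'. subst ay bx.
    assert (Ax : ax = q * A - 5 / 3 * u * A - p * B).
    { apply Rmult_eq_reg_l with (B ^ 2); [lra|now apply pow_nonzero]. }
    lra.
Qed.

(** A symmetric form that kills the vector [(B, -A)] is a multiple of the square of the covector
    [(A, B)]. Evaluating at [(v, -u)], where this covector takes the value -1, identifies the factor
    as [- Z]. *)
Lemma rank_one A B u v m11 m12 m22 Z :
  B * m11 = A * m12 -> B * m12 = A * m22 -> B * u - A * v = 1 ->
  Z = - (v ^ 2 * m11 - 2 * u * v * m12 + u ^ 2 * m22) ->
  m11 = - (Z * A * A) /\ m12 = - (Z * A * B) /\ m22 = - (Z * B * B).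
Proof.
  intros M1 M2 Hp ->.
  split; [|split]; match goal with |- ?m = _ =>
    transitivity (m * (B * u - A * v) ^ 2); [rewrite Hp; ring|] end.
  - transitivity (v ^ 2 * A ^ 2 * m11 - 2 * u * v * A * (A * m12) + u ^ 2 * (A * (A * m22)));
      [|ring].
    rewrite <- M2. replace (A * (B * m12)) with (B * (A * m12)) by ring.
    rewrite <- M1. ring.
  - transitivity (v ^ 2 * A * (B * m11) - 2 * u * v * A * B * m12 + u ^ 2 * B * (A * m22));
      [|ring].
    rewrite M1, <- M2. ring.
  - transitivity (v ^ 2 * (B * (B * m11)) - 2 * u * v * B * (B * m12) + u ^ 2 * B ^ 2 * m22);
      [|ring].
    rewrite M1. replace (B * (A * m12)) with (A * (B * m12)) by ring.
    rewrite M2. ring.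
Qed.

Lemma rho_jets x y : O x y ->
  rho c E i1 i1 x y = dx R_ x y - 1 / 3 * dx f2 x y - dy Q x y + 2 / 3 * dy f1 x y
    + (R_ x y - 1 / 3 * f2 x y) * (- Q x y - 1 / 3 * f1 x y) + S_ x y * P x y /\
  rho c E i1 i2 x y = dx S_ x y - dy R_ x y + 1 / 3 * dy f2 x y
    + (Q x y - 2 / 3 * f1 x y) * S_ x y + (R_ x y - 1 / 3 * f2 x y) * (- R_ x y - 2 / 3 * f2 x y)
    - (R_ x y - 1 / 3 * f2 x y) * (R_ x y - 1 / 3 * f2 x y)
    - S_ x y * (- Q x y - 1 / 3 * f1 x y) /\
  rho c E i2 i1 x y = - dx Q x y - 1 / 3 * dx f1 x y + dy P x y
    - P x y * (R_ x y - 1 / 3 * f2 x y)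
    + (- Q x y - 1 / 3 * f1 x y) * (- Q x y - 1 / 3 * f1 x y)
    - (- Q x y - 1 / 3 * f1 x y) * (Q x y - 2 / 3 * f1 x y)
    + (- R_ x y - 2 / 3 * f2 x y) * P x y /\
  rho c E i2 i2 x y = - dx R_ x y - 2 / 3 * dx f2 x y + dy Q x y + 1 / 3 * dy f1 x y
    - P x y * S_ x y - (- Q x y - 1 / 3 * f1 x y) * (R_ x y - 1 / 3 * f2 x y).
Proof.
  intros Hx. unfold rho, sum_idx, partial, Gamma. dsimp Ho. repeat split; field.
Qed.

(** Contracting [Gamma] gives [- phi], so up to sign the trace of the curvature is the exterior
    derivative of [phi], which is zero. *)
Lemma rho_trace x y : O x y -> rho c E i1 i1 x y + rho c E i2 i2 x y = 0.
Proof.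
  intros Hx. pose proof (phi_closed Hx) as H.
  destruct (rho_jets Hx) as (-> & _ & _ & ->). rewrite H. field.
Qed.

(** Ricci identity: by [grad_AB] the covector [(A, B)] is parallel up to a closed weight, so the
    equality of its mixed derivatives says that the curvature annihilates it. *)
Lemma rho_kernel x y : O x y ->
  rho c E i1 i1 x y * a x y + rho c E i2 i1 x y * b x y = 0 /\
  rho c E i1 i2 x y * a x y + rho c E i2 i2 x y * b x y = 0.
Proof.
  intros Hx. pose proof (phi_closed Hx) as Hc.
  destruct (grad_AB Hx) as (g1 & g2 & g3 & g4).
  assert (Ea : dy (dx a) x y = dx (dy a) x y) by exact (dydx Ho smooth_invA Hx).
  assert (Eb : dy (dx b) x y = dx (dy b) x y) by exact (dydx Ho smooth_invB Hx).
  rewrite (dy_ext Ho (fun x y Hx => proj1 (grad_AB Hx)) Hx) in Ea.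
  rewrite (dx_ext Ho (fun x y Hx => proj1 (proj2 (proj2 (grad_AB Hx)))) Hx) in Ea.
  rewrite (dy_ext Ho (fun x y Hx => proj1 (proj2 (grad_AB Hx))) Hx) in Eb.
  rewrite (dx_ext Ho (fun x y Hx => proj2 (proj2 (proj2 (grad_AB Hx)))) Hx) in Eb.
  revert Ea Eb. destruct (rho_jets Hx) as (-> & -> & -> & ->). dsimp Ho.
  rewrite Hc, g1, g2, g3, g4. intros Ea Eb. split; lra.
Qed.

(** Annihilating [(A, B)] puts the upper index of the curvature along [(B, -A)], and vanishing trace
    puts the lower index along [(A, B)]. The one component that defines [Theta] in the given chart
    fixes the factor. *)
Lemma rho_Theta x y : O x y ->
  rho c E i1 i1 x y = T x y * a x y * b x y /\
  rho c E i1 i2 x y = T x y * b x y * b x y /\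
  rho c E i2 i1 x y = - (T x y * a x y * a x y) /\
  rho c E i2 i2 x y = - (T x y * a x y * b x y).
Proof.
  intros Hx. pose proof (rho_trace Hx) as Ht. destruct (rho_kernel Hx) as [K1 K2].
  assert (H0 : match c with chartA => a x y <> 0 | chartB => b x y <> 0 end)
    by exact (Happ Hx).
  assert (HT : T x y = Theta c E x y) by reflexivity.
  revert Ht K1 K2 H0 HT. unfold Theta at 2, omega.
  generalize (T x y) (a x y) (b x y). intros t A B.
  destruct c;
    generalize (rho chartA E i1 i1 x y) (rho chartA E i1 i2 x y)
      (rho chartA E i2 i1 x y) (rho chartA E i2 i2 x y)
      (rho chartB E i1 i1 x y) (rho chartB E i1 i2 x y)
      (rho chartB E i2 i1 x y) (rho chartB E i2 i2 x y);
    intros r1 r2 r3 r4 q1 q2 q3 q4 Ht K1 K2 H0 HT.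
  - assert (E3 : r3 = - (t * A * A)) by (rewrite HT; field; exact H0).
    assert (E1 : r1 = t * A * B).
    { apply Rmult_eq_reg_r with A; [|exact H0]. rewrite E3 in K1. lra. }
    assert (E4 : r4 = - (t * A * B)) by lra.
    repeat split; trivial. apply Rmult_eq_reg_r with A; [|exact H0]. rewrite E4 in K2. lra.
  - assert (E2 : q2 = t * B * B) by (rewrite HT; field; exact H0).
    assert (E4 : q4 = - (t * A * B)).
    { apply Rmult_eq_reg_r with B; [|exact H0]. rewrite E2 in K2. lra. }
    assert (E1 : q1 = t * A * B) by lra.
    repeat split; trivial. apply Rmult_eq_reg_r with B; [|exact H0]. rewrite E1 in K1. lra.
Qed.

(* The left-hand side is the Cotton tensor of [Gamma], whose Ricci tensor has
   components [Ric_1q = - rho^2_q], [Ric_2q = rho^1_q]. *)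
Lemma cotton x y : O x y ->
  (dx (rho c E i1 i1) x y + dy (rho c E i2 i1) x y
   - (Gamma c E i1 i1 i1 x y * rho c E i1 i1 x y + Gamma c E i2 i1 i1 x y * rho c E i1 i2 x y
      + Gamma c E i1 i2 i1 x y * rho c E i2 i1 x y + Gamma c E i2 i2 i1 x y * rho c E i2 i2 x y)
   = a x y) /\
  (dx (rho c E i1 i2) x y + dy (rho c E i2 i2) x y
   - (Gamma c E i1 i1 i2 x y * rho c E i1 i1 x y + Gamma c E i2 i1 i2 x y * rho c E i1 i2 x y
      + Gamma c E i1 i2 i2 x y * rho c E i2 i1 x y + Gamma c E i2 i2 i2 x y * rho c E i2 i2 x y)
   = b x y).
Proof.
  intros Hx.
  assert (C0 := phi_closed Hx).
  (* Here [phi] acts as an arbitrary closed form: closedness, its two first derivatives and the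
     symmetry of second derivatives reduce the claim to an identity between jets, with [A] and [B]
     expanded from [P], [Q], [R], [S]. *)
  assert (C1 : dx (dy f1) x y = dx (dx f2) x y) by exact (dx_ext Ho phi_closed Hx).
  assert (C2 : dy (dy f1) x y = dx (dy f2) x y).
  { rewrite (dy_ext Ho phi_closed Hx). now apply (dydx Ho). }
  assert (X1 := dydx Ho sP Hx). assert (X2 := dydx Ho sQ Hx).
  assert (X3 := dydx Ho sR Hx). assert (X4 := dydx Ho sS Hx).
  assert (X5 := dydx Ho smooth_phi1 Hx). assert (X6 := dydx Ho smooth_phi2 Hx).
  rewrite (dx_ext Ho (fun x y Hx => proj1 (rho_jets Hx)) Hx).
  rewrite (dx_ext Ho (fun x y Hx => proj1 (proj2 (rho_jets Hx))) Hx).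
  rewrite (dy_ext Ho (fun x y Hx => proj1 (proj2 (proj2 (rho_jets Hx)))) Hx).
  rewrite (dy_ext Ho (fun x y Hx => proj2 (proj2 (proj2 (rho_jets Hx)))) Hx).
  destruct (rho_jets Hx) as (-> & -> & -> & ->). unfold Gamma. dsimp Ho.
  split.
  - unfold invA. rewrite ?X1, ?X2, ?X3, ?X4, ?X5, ?X6, ?C1, ?C2, ?C0. field.
  - unfold invB. rewrite ?X1, ?X2, ?X3, ?X4, ?X5, ?X6, ?C1, ?C2, ?C0. field.
Qed.

(** Insert the rank-one form of the curvature into the Cotton identity and differentiate [A] and [B]
    by [grad_AB]. The left-hand side becomes the pairing times [(A, B)], the right-hand side is
    [(A, B)], and the nonzero component cancels. *)
Lemma theta_pairing x y : O x y -> b x y * t1 x y - a x y * t2 x y = 1.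
Proof.
  intros Hx. destruct (grad_AB Hx) as (g1 & g2 & g3 & g4). destruct (cotton Hx) as [K1 K2].
  rewrite (dx_ext Ho (fun x y Hx => proj1 (rho_Theta Hx)) Hx) in K1.
  rewrite (dy_ext Ho (fun x y Hx => proj1 (proj2 (proj2 (rho_Theta Hx)))) Hx) in K1.
  rewrite (dx_ext Ho (fun x y Hx => proj1 (proj2 (rho_Theta Hx))) Hx) in K2.
  rewrite (dy_ext Ho (fun x y Hx => proj2 (proj2 (proj2 (rho_Theta Hx)))) Hx) in K2.
  destruct (rho_Theta Hx) as (R1 & R2 & R3 & R4).
  rewrite R1, R2, R3, R4 in K1, K2. revert K1 K2. unfold Gamma. dsimp Ho.
  rewrite g1, g2, g3, g4. unfold theta1, theta2. intros K1 K2.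
  pose proof (Happ Hx) as H0. unfold applicable in H0.
  revert H0 K1 K2. generalize (a x y) (b x y). intros A B H0 K1 K2.
  destruct c.
  - apply Rmult_eq_reg_r with A; [lra|exact H0].
  - apply Rmult_eq_reg_r with B; [lra|exact H0].
Qed.

Lemma theta_curl x y : O x y ->
  dx t2 x y - dy t1 x y = 2 * (f1 x y * t2 x y - f2 x y * t1 x y).
Proof.
  intros Hx. assert (C0 := phi_closed Hx). assert (X := dydx Ho smooth_Theta Hx).
  unfold theta1, theta2. dsimp Ho. rewrite C0, X. ring.
Qed.

(** Differentiating the constant pairing [B t1 - A t2] shows that the weighted Hessian of [Theta]
    kills [(B, -A)], so [rank_one] applies. The long formula for [Z] is minus the value of this
    Hessian on the vector [(C, D) = (t2, - t1)]. *)
Lemma hess_Theta x y : O x y ->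
  dx t1 x y = (Q x y - 2 / 3 * f1 x y) * t1 x y - P x y * t2 x y + 2 * f1 x y * t1 x y
              - invZ c E x y * a x y * a x y /\
  dx t2 x y = (R_ x y - 1 / 3 * f2 x y) * t1 x y + (- Q x y - 1 / 3 * f1 x y) * t2 x y
              + 2 * f1 x y * t2 x y - invZ c E x y * a x y * b x y /\
  dy t1 x y = (R_ x y - 1 / 3 * f2 x y) * t1 x y + (- Q x y - 1 / 3 * f1 x y) * t2 x y
              + 2 * f2 x y * t1 x y - invZ c E x y * a x y * b x y /\
  dy t2 x y = S_ x y * t1 x y + (- R_ x y - 2 / 3 * f2 x y) * t2 x y + 2 * f2 x y * t2 x y
              - invZ c E x y * b x y * b x y.
Proof.
  intros Hx. destruct (grad_AB Hx) as (g1 & g2 & g3 & g4).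
  pose proof (theta_curl Hx) as Hc. pose proof (theta_pairing Hx) as Hp.
  assert (Px : dx (fun x y => b x y * t1 x y - a x y * t2 x y) x y = 0).
  { rewrite (dx_ext Ho theta_pairing Hx). apply dx_const. }
  assert (Py : dy (fun x y => b x y * t1 x y - a x y * t2 x y) x y = 0).
  { rewrite (dy_ext Ho theta_pairing Hx). apply dy_const. }
  revert Px Py. dsimp Ho. rewrite g1, g2, g3, g4. intros Px Py.
  set (m11 := dx t1 x y - ((Q x y - 2 / 3 * f1 x y) * t1 x y - P x y * t2 x y
              + 2 * f1 x y * t1 x y)).
  set (m12 := dx t2 x y - ((R_ x y - 1 / 3 * f2 x y) * t1 x y
              + (- Q x y - 1 / 3 * f1 x y) * t2 x y + 2 * f1 x y * t2 x y)).
  set (m22 := dy t2 x y - (S_ x y * t1 x y + (- R_ x y - 2 / 3 * f2 x y) * t2 x y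
              + 2 * f2 x y * t2 x y)).
  assert (M1 : b x y * m11 = a x y * m12) by (unfold m11, m12; lra).
  assert (M2 : b x y * m12 = a x y * m22) by (unfold m12, m22; nra).
  assert (HZ : invZ c E x y = - (t2 x y ^ 2 * m11 - 2 * t1 x y * t2 x y * m12
                                 + t1 x y ^ 2 * m22)).
  { unfold invZ, invC, invD. dsimp Ho. unfold m11, m12, m22.
    replace (dy t1 x y) with (dx t2 x y - 2 * (f1 x y * t2 x y - f2 x y * t1 x y)) by lra.
    field. }
  destruct (rank_one M1 M2 Hp HZ) as (Q11 & Q12 & Q22).
  unfold m11 in Q11; unfold m12 in Q12; unfold m22 in Q22. clear HZ M1 M2 Px Py Hp.
  split; [lra|split; [lra|split; lra]].
Qed.

(** Compatibility of the equations in [hess_Theta] gives [(Z_x - 4 phi1 Z) B - (Z_y - 4 phi2 Z) A =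
    Theta], with the right-hand side coming from the curvature. By [theta_pairing], [Theta^2 / 2]
    satisfies the same equation; their difference [L] therefore satisfies the homogeneous one. This
    is the origin of the term [- Theta^2 / 2] in [L]. *)
Lemma grad_invL x y : O x y ->
  (dx (invL c E) x y - 4 * f1 x y * invL c E x y) * b x y
  - (dy (invL c E) x y - 4 * f2 x y * invL c E x y) * a x y = 0.
Proof.
  intros Hx. pose proof smooth_invZ as sZ.
  destruct (grad_AB Hx) as (g1 & g2 & g3 & g4).
  pose proof (theta_pairing Hx) as Hp. pose proof (phi_closed Hx) as Hc.
  destruct (hess_Theta Hx) as (h1 & h2 & h3 & h4).
  assert (E1 : dy (dx t1) x y = dx (dy t1) x y) by exact (dydx Ho smooth_theta1 Hx).
  assert (E2 : dy (dx t2) x y = dx (dy t2) x y) by exact (dydx Ho smooth_theta2 Hx).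
  rewrite (dy_ext Ho (fun x y Hx => proj1 (hess_Theta Hx)) Hx) in E1.
  rewrite (dx_ext Ho (fun x y Hx => proj1 (proj2 (proj2 (hess_Theta Hx)))) Hx) in E1.
  rewrite (dy_ext Ho (fun x y Hx => proj1 (proj2 (hess_Theta Hx))) Hx) in E2.
  rewrite (dx_ext Ho (fun x y Hx => proj2 (proj2 (proj2 (hess_Theta Hx)))) Hx) in E2.
  destruct (rho_jets Hx) as (r1 & r2 & r3 & r4).
  destruct (rho_Theta Hx) as (R1 & R2 & R3 & R4).
  rewrite R1 in r1; rewrite R2 in r2; rewrite R3 in r3; rewrite R4 in r4.
  clear R1 R2 R3 R4.
  assert (HL : forall x y, O x y -> invL c E x y = invZ c E x y - 1 / 2 * (T x y * T x y)).
  { intros. unfold invL. ring. }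
  rewrite (dx_ext Ho HL Hx), (dy_ext Ho HL Hx), (HL _ _ Hx). clear HL.
  pose proof (Happ Hx) as H0. unfold applicable in H0.
  assert (U1 : dx T x y = t1 x y + 2 * f1 x y * T x y) by (unfold theta1; ring).
  assert (U2 : dy T x y = t2 x y + 2 * f2 x y * T x y) by (unfold theta2; ring).
  revert E1 E2. dsimp Ho. rewrite U1, U2, g1, g2, g3, g4, h1, h2, h3, h4.
  rewrite Hc in r1, r4 |- *.
  intros E1 E2. clear g1 g2 g3 g4 h1 h2 h3 h4 U1 U2 Hc.
  set (Zx := dx (invZ c E) x y) in *. set (Zy := dy (invZ c E) x y) in *.
  set (Z := invZ c E x y) in *.
  set (X := (Zx - 4 * f1 x y * Z) * b x y - (Zy - 4 * f2 x y * Z) * a x y - T x y).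
  (* [lra] takes monomials as atoms, so the curvature relations and the pairing are supplied already
     multiplied by the coefficients with which they enter. *)
  assert (G1 : X * a x y = 0).
  { assert (K1 := f_equal (fun z => z * t1 x y) r1).
    assert (K3 := f_equal (fun z => z * t2 x y) r3).
    assert (Y := f_equal (fun z => z * (T x y * a x y)) Hp).
    cbv beta in K1, K3, Y. unfold X. clear - E1 K1 K3 Y. lra. }
  assert (G2 : X * b x y = 0).
  { assert (K1 := f_equal (fun z => z * t1 x y) r2).
    assert (K3 := f_equal (fun z => z * t2 x y) r4).
    assert (Y := f_equal (fun z => z * (T x y * b x y)) Hp).
    cbv beta in K1, K3, Y. unfold X. clear - E2 K1 K3 Y. lra. }
  assert (HX : X = 0).
  { destruct c.
    - apply Rmult_integral in G1. tauto.
    - apply Rmult_integral in G2. tauto. }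
  unfold X in HX. assert (Y := f_equal (fun z => z * T x y) Hp). cbv beta in Y.
  clear - HX Y. lra.
Qed.

End Structure.

(** * The Poincare lemma on a box *)

Lemma open2_box px py r : open2 (in_box px py r).
Proof.
  apply open2P. intros x y [h h'].
  exists (Rmin (r - Rabs (x - px)) (r - Rabs (y - py))).
  split; [apply Rmin_glb_lt; lra|]. intros x' y' k k'.
  pose proof (Rmin_l (r - Rabs (x - px)) (r - Rabs (y - py))).
  pose proof (Rmin_r (r - Rabs (x - px)) (r - Rabs (y - py))).
  split.
  - replace (x' - px) with ((x' - x) + (x - px)) by ring.
    eapply Rle_lt_trans; [apply Rabs_triang|]. lra.
  - replace (y' - py) with ((y' - y) + (y - py)) by ring.
    eapply Rle_lt_trans; [apply Rabs_triang|]. lra.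
Qed.

Lemma between_interval p r a b s :
  Rabs (a - p) < r -> Rabs (b - p) < r -> Rmin a b <= s <= Rmax a b -> Rabs (s - p) < r.
Proof.
  intros Ha Hb [H1 H2]. apply Rabs_def2 in Ha, Hb. apply Rabs_def1.
  - unfold Rmax in H2. destruct (Rle_dec a b); lra.
  - unfold Rmin in H1. destruct (Rle_dec a b); lra.
Qed.

Lemma smooth2_continuous_x O f x y :
  smooth2 O f -> O x y -> continuous (fun s => f s y) x.
Proof.
  intros Hf Hx. apply (ex_derive_continuous (K := R_AbsRing) (V := R_NormedModule)).
  eexists. exact (is_dx Hf Hx).
Qed.

Lemma smooth2_continuous_y O f x y :
  smooth2 O f -> O x y -> continuous (fun s => f x s) y.
Proof.
  intros Hf Hx. apply (ex_derive_continuous (K := R_AbsRing) (V := R_NormedModule)).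
  eexists. exact (is_dy Hf Hx).
Qed.

(** Partial derivatives that exist and are smooth make [f] totally differentiable, hence continuous,
    which is the clause of order 0 in [C3]. *)
Lemma smooth2_intro O f g h :
  open2 O -> (forall x y, O x y -> is_derive (fun s => f s y) x (g x y)) ->
  (forall x y, O x y -> is_derive (fun s => f x s) y (h x y)) ->
  smooth2 O g -> smooth2 O h ->
  smooth2 O f /\ (forall x y, O x y -> dx f x y = g x y) /\
  (forall x y, O x y -> dy f x y = h x y).
Proof.
  intros Ho Hg Hh sg sh.
  assert (C0 : C3 0 (fun _ => O) (fun _ => f)).
  { apply C3_0. intros t x y Hx. apply cont3_lift.
    apply continuity_2d_pt_filterlim.
    apply (filterdiff_continuous (K := R_AbsRing)
      (fun u : R * R => f (fst u) (snd u)) (x, y)).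
    eexists. apply (is_derive_filterdiff f x y g (h x y)).
    - destruct (proj1 (open2P O) Ho x y Hx) as [e [He H]]. exists (mkposreal e He).
      intros [u v] [hu hv]. apply Hg. apply H; assumption.
    - now apply Hh.
    - apply continuity_2d_pt_filterlim. exact (smooth2_cont sg Hx). }
  split; [|split].
  - intros n. destruct n as [|n]; [exact C0|].
    apply (C3_intro (f1 := fun _ _ _ => 0) (f2 := fun _ => g) (f3 := fun _ => h) Ho C0).
    + intros t x y Hx. split; [apply is_derive_cst|].
      split; [now apply Hg|now apply Hh].
    + now apply C3_const.
    + apply sg.
    + apply sh.
  - intros x y Hx. apply is_derive_unique. now apply Hg.
  - intros x y Hx. apply is_derive_unique. now apply Hh.
Qed.

(** The primitive integrates along the horizontal line through the base point and then vertically;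
    the box contains this path. Its y-derivative is the fundamental theorem of calculus. Its
    x-derivative comes from differentiating under the integral, where closedness turns the
    x-derivative of [g] into the y-derivative of [f]. *)
Lemma poincare px py r f g :
  let O := in_box px py r in
  smooth2 O f -> smooth2 O g -> (forall x y, O x y -> dy f x y = dx g x y) ->
  exists psi, smooth2 O psi /\ (forall x y, O x y -> dx psi x y = f x y) /\
    (forall x y, O x y -> dy psi x y = g x y).
Proof.
  intros O sf sg Hc. pose proof (@open2_box px py r) as Ho. fold O in Ho.
  exists (fun x y => RInt (fun s => f s py) px x + RInt (fun t => g x t) py y).
  assert (Bx : forall x y s, O x y -> Rmin px x <= s <= Rmax px x -> O s py).
  { intros x y s [h h'] Hs. pose proof (Rabs_pos (x - px)).
    split; [apply (@between_interval px r px x s); trivial|];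
      rewrite Rminus_diag, Rabs_R0; lra. }
  assert (By : forall x y s, O x y -> Rmin py y <= s <= Rmax py y -> O x s).
  { intros x y s [h h'] Hs. pose proof (Rabs_pos (x - px)).
    split; trivial. apply (@between_interval py r py y s); trivial.
    rewrite Rminus_diag, Rabs_R0; lra. }
  assert (If : forall x y, O x y -> ex_RInt (fun s => f s py) px x).
  { intros x y Hx. apply (ex_RInt_continuous (V := R_CompleteNormedModule)).
    intros z Hz. apply (smooth2_continuous_x sf). now apply (Bx x y). }
  assert (Ig : forall x y, O x y -> ex_RInt (fun t => g x t) py y).
  { intros x y Hx. apply (ex_RInt_continuous (V := R_CompleteNormedModule)).
    intros z Hz. apply (smooth2_continuous_y sg). now apply (By x y). }
  apply smooth2_intro; trivial.
  - intros x y Hx.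
    replace (f x y) with (f x py + RInt (fun t => dx g x t) py y).
    + apply (is_derive_plus (V := R_NormedModule) (fun x => RInt (fun s => f s py) px x)
        (fun x => RInt (fun t => g x t) py y)).
      * apply (is_derive_RInt (V := R_NormedModule) (fun s => f s py) _ px).
        -- apply (filter_imp (fun s => O s y)).
           ++ intros s Hs. apply (RInt_correct (V := R_CompleteNormedModule)). now apply (If s y).
           ++ exact (open3_2 (t := 0) Ho Hx).
        -- apply (smooth2_continuous_x sf). apply (Bx x y); trivial.
           split; [apply Rmin_r|apply Rmax_r].
      * apply (is_derive_RInt_param (fun u t => g u t) py y x).
        -- apply (filter_imp (fun s => O s y)).
           ++ intros s Hs t Ht. eexists. apply (is_dx sg). now apply (By s y).
           ++ exact (open3_2 (t := 0) Ho Hx).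
        -- intros t Ht. apply (smooth2_cont (smooth2_dx sg)). now apply (By x y).
        -- apply (filter_imp (fun s => O s y)).
           ++ intros s Hs. now apply Ig.
           ++ exact (open3_2 (t := 0) Ho Hx).
    + assert (H : is_RInt (fun t => dx g x t) py y (minus (f x y) (f x py))).
      { apply (is_RInt_derive (V := R_CompleteNormedModule) (fun t => f x t) (fun t => dx g x t)).
        - intros t Ht. assert (Ht' : O x t) by now apply (By x y).
          rewrite <- Hc by trivial. exact (is_dy sf Ht').
        - intros t Ht. assert (Ht' : O x t) by now apply (By x y).
          exact (smooth2_continuous_y (smooth2_dx sg) Ht'). }
      apply (is_RInt_unique (V := R_CompleteNormedModule)) in H. rewrite H.
      unfold minus, plus, opp. simpl. ring.
  - intros x y Hx. rewrite <- (Rplus_0_l (g x y)).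
    apply (is_derive_plus (V := R_NormedModule) (fun _ => RInt (fun s => f s py) px x)
        (fun y => RInt (fun t => g x t) py y)).
    + apply is_derive_cst.
    + apply (is_derive_RInt (V := R_NormedModule) (fun t => g x t) _ py).
      * apply (filter_imp (fun s => O x s)).
        -- intros s Hs. apply (RInt_correct (V := R_CompleteNormedModule)). now apply Ig.
        -- exact (open3_3 (t := 0) Ho Hx).
      * exact (smooth2_continuous_y sg Hx).
Qed.

(** * Rectifying coordinates *)

Definition jac (U V : R -> R -> R) (x y : R) : R := dx U x y * dy V x y - dy U x y * dx V x y.

(* In the coordinates [u = U], [v = V] the equation reads [v'' = - (v^2 / 2 + l)]. *)
Definition rectifies (E : ode) (U V l : R -> R -> R) (x y : R) : Prop :=
  jac U V x y <> 0 /\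
  dx l x y * dy U x y = dy l x y * dx U x y /\
  forall p,
    (dx (dx V) x y + 2 * dx (dy V) x y * p + dy (dy V) x y * p ^ 2)
      * (dx U x y + dy U x y * p)
    - (dx V x y + dy V x y * p)
      * (dx (dx U) x y + 2 * dx (dy U) x y * p + dy (dy U) x y * p ^ 2)
    + (V x y ^ 2 / 2 + l x y) * (dx U x y + dy U x y * p) ^ 3
    = - jac U V x y * ode_rhs E x y p.

Lemma rectification (E : ode) (c : chart) px py r :
  let O := in_box px py r in
  smooth2 O (cP E) -> smooth2 O (cQ E) -> smooth2 O (cR E) -> smooth2 O (cS E) ->
  (forall x y, O x y -> applicable E c x y) ->
  (forall x y, O x y -> invF E x y = 0) ->
  (forall x y, O x y -> invN c E x y = 0) ->
  (forall x y, O x y -> Omega c E x y = 0) ->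
  exists U V l, smooth2 O U /\ smooth2 O V /\ smooth2 O l /\
    forall x y, O x y -> rectifies E U V l x y /\ (l x y = 0 <-> invL c E x y = 0).
Proof.
  intros O sP sQ sR sS Happ HF HN HOm.
  assert (Ho : open2 O) by apply open2_box.
  assert (sa := smooth_invA Ho sP sQ sR sS). assert (sb := smooth_invB Ho sP sQ sR sS).
  assert (s1 := smooth_phi1 Ho sP sQ sR sS Happ). assert (s2 := smooth_phi2 Ho sP sQ sR sS Happ).
  assert (sT := smooth_Theta Ho sP sQ sR sS Happ).
  assert (sL := smooth_invL Ho sP sQ sR sS Happ).
  destruct (poincare s1 s2 (phi_closed HOm)) as (psi & spsi & p1 & p2). fold O in spsi, p1, p2.
  destruct (@poincare px py r (fun x y => exp (psi x y) * invA E x y)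
             (fun x y => exp (psi x y) * invB E x y)) as (U & sU & u1 & u2); fold O.
  - sm Ho.
  - sm Ho.
  (* The connection terms of A_y and B_x in [grad_AB] agree because [Gamma] is symmetric; the
     weights left over are absorbed by the derivatives of [exp psi]. *)
  - intros x y Hx. dsimp Ho. rewrite (p1 _ _ Hx), (p2 _ _ Hx).
    destruct (grad_AB Happ HF HN Hx) as (_ & -> & -> & _). ring.
  - fold O in sU, u1, u2.
    set (w := fun x y => exp (- (2 * psi x y))).
    assert (sw : smooth2 O w) by (unfold w; sm Ho).
    assert (w1 : forall x y, O x y -> dx w x y = - (2 * phi1 c E x y) * w x y).
    { intros x y Hx. unfold w. dsimp Ho. rewrite (p1 _ _ Hx). ring. }
    assert (w2 : forall x y, O x y -> dy w x y = - (2 * phi2 c E x y) * w x y).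
    { intros x y Hx. unfold w. dsimp Ho. rewrite (p2 _ _ Hx). ring. }
    set (V := fun x y => w x y * Theta c E x y).
    set (l := fun x y => w x y * w x y * invL c E x y).
    assert (sV : smooth2 O V) by (unfold V; sm Ho).
    assert (sl : smooth2 O l) by (unfold l; sm Ho).
    exists U, V, l. split; [exact sU|]. split; [exact sV|]. split; [exact sl|].
    assert (v1 : forall x y, O x y -> dx V x y = w x y * theta1 c E x y).
    { intros x y Hx. unfold V, theta1. dsimp Ho. rewrite (w1 _ _ Hx). ring. }
    assert (v2 : forall x y, O x y -> dy V x y = w x y * theta2 c E x y).
    { intros x y Hx. unfold V, theta2. dsimp Ho. rewrite (w2 _ _ Hx). ring. }
    assert (st1 := smooth_theta1 Ho sP sQ sR sS Happ).
    assert (st2 := smooth_theta2 Ho sP sQ sR sS Happ).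
    intros x y Hx.
    assert (HW : exp (psi x y) * exp (psi x y) * w x y = 1).
    { unfold w. rewrite <- !exp_plus. rewrite <- exp_0. f_equal. ring. }
    assert (He := exp_pos (psi x y)).
    assert (Hw : 0 < w x y) by apply exp_pos.
    assert (Hp := theta_pairing Ho sP sQ sR sS Happ HF HN HOm Hx).
    destruct (grad_AB Happ HF HN Hx) as (g1 & g2 & g3 & g4).
    destruct (hess_Theta Ho sP sQ sR sS Happ HF HN HOm Hx) as (h1 & h2 & h3 & h4).
    assert (Hl := grad_invL Ho sP sQ sR sS Happ HF HN HOm Hx).
    assert (J : jac U V x y = - exp (psi x y) * w x y).
    { unfold jac. rewrite (u1 _ _ Hx), (u2 _ _ Hx), (v1 _ _ Hx), (v2 _ _ Hx).
      assert (Y := f_equal (fun z => z * (exp (psi x y) * w x y)) Hp). cbv beta in Y. lra. }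
    split; [split; [|split]|].
    + rewrite J. intros H. assert (0 < exp (psi x y) * w x y) by now apply Rmult_lt_0_compat.
      lra.
    + rewrite (u1 _ _ Hx), (u2 _ _ Hx). unfold l. dsimp Ho. rewrite (w1 _ _ Hx), (w2 _ _ Hx).
      assert (Y := f_equal (fun z => z * (exp (psi x y) * w x y * w x y)) Hl). cbv beta in Y.
      lra.
    + intros p. rewrite J. unfold ode_rhs, l.
      rewrite (dx_ext Ho v1 Hx), (dx_ext Ho v2 Hx), (dy_ext Ho v2 Hx).
      rewrite (dx_ext Ho u1 Hx), (dx_ext Ho u2 Hx), (dy_ext Ho u2 Hx).
      rewrite (u1 _ _ Hx), (u2 _ _ Hx), (v1 _ _ Hx), (v2 _ _ Hx).
      dsimp Ho. rewrite (w1 _ _ Hx), (w2 _ _ Hx), (p1 _ _ Hx), (p2 _ _ Hx).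
      rewrite g1, g2, g4, h1, h2, h4. unfold V, invL. clear - HW Hp.
      revert HW Hp. generalize (exp (psi x y)) (w x y) (Theta c E x y) (invZ c E x y)
        (theta1 c E x y) (theta2 c E x y) (invA E x y) (invB E x y) (phi1 c E x y)
        (phi2 c E x y) (cP E x y) (cQ E x y) (cR E x y) (cS E x y).
      intros e w0 T Z t1 t2 A B f1 f2 P Q R_ S_ HW Hp.
      apply Rminus_diag_uniq.
      (* The [Theta^2] parts of [V^2 / 2 + l] cancel, leaving [w^2 Z], while the Hessian of [V]
         contributes [- e w Z (A + B p)^3]. The two sides then differ by multiples of the relations
         [e^2 w = 1] and [B t1 - A t2 = 1]. *)
      transitivity ((e * e * w0 - 1) * (e * w0 * Z * (A + B * p) ^ 3)
        + e * w0 * (P + 3 * Q * p + 3 * R_ * p ^ 2 + S_ * p ^ 3) * (B * t1 - A * t2 - 1));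
        [field|].
      rewrite HW, Hp. ring.
    + unfold l. split; intros H.
      * apply Rmult_integral in H. destruct H as [H|H]; [|exact H].
        exfalso. assert (0 < w x y * w x y) by now apply Rmult_lt_0_compat. lra.
      * rewrite H. ring.
Qed.

(** * The inverse function theorem in the plane *)

(** The equation [f x y = u] is solved for [x]: existence by the intermediate value theorem on the
    segment from [x0 - e / 2] to [x0 + e / 2], uniqueness and a Lipschitz bound from the lower bound
    on the x-derivative, differentiability from the first-order expansion of [f], and smoothness by
    a bootstrap on the order. *)
Lemma implicit_function O f x0 y0 :
  open2 O -> smooth2 O f -> O x0 y0 -> dx f x0 y0 <> 0 ->
  exists e s g, 0 < e /\ 0 < s /\
    (forall x y, in_box x0 y0 e x y -> O x y /\ dx f x y <> 0) /\
    smooth2 (in_box (f x0 y0) y0 s) g /\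
    (forall u y, in_box (f x0 y0) y0 s u y -> in_box x0 y0 e (g u y) y /\ f (g u y) y = u) /\
    (forall x y, in_box x0 y0 e x y -> in_box (f x0 y0) y0 s (f x y) y -> g (f x y) y = x).
Proof.
  intros Ho sf H0 HD. set (D := dx f x0 y0) in *. set (u0 := f x0 y0).
  (* [sg] is the sign of the derivative at the base, so that [sg * f] increases in [x]; on a small
     box its slope stays above half the value at the base. *)
  set (m := Rabs D / 2). set (sg := D / Rabs D).
  assert (HDp : 0 < Rabs D) by now apply Rabs_pos_lt.
  assert (Hm : 0 < m) by (unfold m; lra).
  assert (Hsg : sg * sg = 1).
  { unfold sg. replace (D / Rabs D * (D / Rabs D)) with (D * D / (Rabs D * Rabs D))
      by (field; lra).
    rewrite <- Rabs_mult, (Rabs_pos_eq (D * D)); [field; exact HD|]. nra. }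
  assert (Hsa : Rabs sg = 1).
  { unfold sg. unfold Rdiv. rewrite Rabs_mult, Rabs_inv, Rabs_Rabsolu. field. lra. }
  assert (sfx := smooth2_dx sf). assert (sfy := smooth2_dy sf).
  destruct (proj1 (open2P O) Ho _ _ H0) as [e0 [p0 K0]].
  destruct (smooth2_cont sfx H0 (mkposreal m Hm)) as [e1 K1].
  destruct (smooth2_cont sfy H0 (mkposreal 1 Rlt_0_1)) as [e2 K2].
  set (e := Rmin e0 (Rmin e1 e2)).
  assert (He : 0 < e) by (repeat apply Rmin_glb_lt; try assumption; apply cond_pos).
  assert (ee : e <= e0 /\ e <= e1 /\ e <= e2).
  { unfold e. pose proof (Rmin_l e0 (Rmin e1 e2)). pose proof (Rmin_r e0 (Rmin e1 e2)).
    pose proof (Rmin_l e1 e2). pose proof (Rmin_r e1 e2). lra. }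
  set (M := Rabs (dy f x0 y0) + 1).
  assert (BO : forall x y, in_box x0 y0 e x y -> O x y).
  { intros x y [h h']. apply K0; lra. }
  assert (Bx : forall x y, in_box x0 y0 e x y -> m <= sg * dx f x y).
  { intros x y [h h']. assert (K := K1 x y ltac:(lra) ltac:(lra)). simpl in K. fold D in K.
    replace (sg * dx f x y) with (sg * (dx f x y - D) + Rabs D).
    - assert (Rabs (sg * (dx f x y - D)) < m) by (rewrite Rabs_mult, Hsa; lra).
      apply Rabs_def2 in H. unfold m in *. lra.
    - unfold sg. replace (Rabs D) with (D / Rabs D * D) at 2; [ring|].
      apply Rmult_eq_reg_r with (D / Rabs D).
      + replace (D / Rabs D * D * (D / Rabs D)) with (D * (sg * sg)) by (unfold sg; ring).
        rewrite Hsg. field. lra.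
      + fold sg. intros E. rewrite E in Hsg. lra. }
  assert (Bx' : forall x y, in_box x0 y0 e x y -> m <= Rabs (dx f x y)).
  { intros x y Hx. apply Bx in Hx. eapply Rle_trans; [exact Hx|].
    eapply Rle_trans; [apply Rle_abs|]. rewrite Rabs_mult, Hsa. lra. }
  assert (By : forall x y, in_box x0 y0 e x y -> Rabs (dy f x y) <= M).
  { intros x y [h h']. assert (K := K2 x y ltac:(lra) ltac:(lra)). simpl in K. unfold M.
    replace (dy f x y) with ((dy f x y - dy f x0 y0) + dy f x0 y0) by ring.
    eapply Rle_trans; [apply Rabs_triang|]. lra. }
  (* This estimate gives both the uniqueness of the root and the Lipschitz bound on [g]. *)
  assert (Lip : forall x y x' y', in_box x0 y0 e x y -> in_box x0 y0 e x' y' ->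
    m * Rabs (x' - x) <= Rabs (f x' y' - f x y) + M * Rabs (y' - y)).
  { intros x y x' y' [h1 h2] [h3 h4].
    destruct (@MVT_is_derive (fun s => f s y') (fun s => dx f s y') x x') as (c1 & m1 & E1).
    { intros s Hs. apply (is_dx sf). apply BO. split; [|exact h4].
      now apply (@between_interval x0 e x x' s). }
    destruct (@MVT_is_derive (fun s => f x s) (fun s => dy f x s) y y') as (c2 & m2 & E2).
    { intros s Hs. apply (is_dy sf). apply BO. split; [exact h1|].
      now apply (@between_interval y0 e y y' s). }
    assert (B1 : in_box x0 y0 e c1 y') by (split; [now apply (@between_interval x0 e x x' c1)|exact h4]).
    assert (B2 : in_box x0 y0 e x c2) by (split; [exact h1|now apply (@between_interval y0 e y y' c2)]).
    apply Bx' in B1. apply By in B2.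
    assert (X1 : m * Rabs (x' - x) <= Rabs (f x' y' - f x y')).
    { rewrite E1, Rabs_mult. apply Rmult_le_compat_r; [apply Rabs_pos|exact B1]. }
    assert (X2 : Rabs (f x y' - f x y) <= M * Rabs (y' - y)).
    { rewrite E2, Rabs_mult. apply Rmult_le_compat_r; [apply Rabs_pos|exact B2]. }
    replace (f x' y' - f x y') with ((f x' y' - f x y) + - (f x y' - f x y)) in X1 by ring.
    eapply Rle_trans; [exact X1|]. eapply Rle_trans; [apply Rabs_triang|].
    rewrite Rabs_Ropp. lra. }
  set (r := e / 2). assert (Hr : 0 < r) by (unfold r; lra).
  assert (Hmr : 0 < m * r / 2) by (apply Rdiv_lt_0_compat; [now apply Rmult_lt_0_compat|lra]).
  assert (Bp : in_box x0 y0 e (x0 + r) y0).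
  { split; [replace (x0 + r - x0) with r by ring; rewrite Rabs_pos_eq; unfold r; lra|].
    rewrite Rminus_diag, Rabs_R0. lra. }
  assert (Bm : in_box x0 y0 e (x0 - r) y0).
  { split; [replace (x0 - r - x0) with (- r) by ring; rewrite Rabs_Ropp, Rabs_pos_eq; unfold r; lra|].
    rewrite Rminus_diag, Rabs_R0. lra. }
  destruct (smooth2_cont sf (BO _ _ Bp) (mkposreal _ Hmr)) as [e3 K3].
  destruct (smooth2_cont sf (BO _ _ Bm) (mkposreal _ Hmr)) as [e4 K4].
  (* Between [x0] and [x0 + r] or [x0 - r] the value of [f] moves by at least [m * r]. Changing [y]
     costs less than half of this by the choice of [e3] and [e4], and changing [u] less than the
     other half, so [f - u] has opposite signs at the two ends. *)
  set (s := Rmin (Rmin e (m * r / 2)) (Rmin e3 e4)).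
  assert (Hs : 0 < s) by (repeat apply Rmin_glb_lt; try assumption; apply cond_pos).
  assert (ss : s <= e /\ s <= m * r / 2 /\ s <= e3 /\ s <= e4).
  { unfold s. pose proof (Rmin_l (Rmin e (m * r / 2)) (Rmin e3 e4)).
    pose proof (Rmin_r (Rmin e (m * r / 2)) (Rmin e3 e4)).
    pose proof (Rmin_l e (m * r / 2)). pose proof (Rmin_r e (m * r / 2)).
    pose proof (Rmin_l e3 e4). pose proof (Rmin_r e3 e4). lra. }
  assert (mono : forall x x', Rabs (x - x0) < e -> Rabs (x' - x0) < e -> x <= x' ->
    m * (x' - x) <= sg * (f x' y0 - f x y0)).
  { intros x x' h h' Hle.
    destruct (@MVT_is_derive (fun s => f s y0) (fun s => dx f s y0) x x') as (c1 & m1 & E1).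
    { intros z Hz. apply (is_dx sf). apply BO. split; [now apply (@between_interval x0 e x x' z)|].
      rewrite Rminus_diag, Rabs_R0. lra. }
    assert (B1 : in_box x0 y0 e c1 y0).
    { split; [now apply (@between_interval x0 e x x' c1)|]. rewrite Rminus_diag, Rabs_R0. lra. }
    apply Bx in B1. rewrite E1, <- Rmult_assoc. apply Rmult_le_compat_r; lra. }
  assert (Ex : forall u y, in_box u0 y0 s u y -> exists x, in_box x0 y0 e x y /\ f x y = u).
  { intros u y [h h'].
    assert (A3 := K3 (x0 + r) y ltac:(rewrite Rminus_diag, Rabs_R0; apply cond_pos) ltac:(lra)).
    assert (A4 := K4 (x0 - r) y ltac:(rewrite Rminus_diag, Rabs_R0; apply cond_pos) ltac:(lra)).
    simpl in A3, A4. destruct Bp as [Bp _]. destruct Bm as [Bm _].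
    assert (B0 : Rabs (x0 - x0) < e) by (rewrite Rminus_diag, Rabs_R0; lra).
    assert (M1 := mono x0 (x0 + r) B0 Bp ltac:(lra)).
    assert (M2 := mono (x0 - r) x0 Bm B0 ltac:(lra)).
    assert (T : forall z w, Rabs z < w -> - w < sg * z < w).
    { intros z w Hz. assert (Rabs (sg * z) < w) by (rewrite Rabs_mult, Hsa; lra).
      apply Rabs_def2 in H. lra. }
    apply T in A3, A4. assert (A5 := T _ _ h). fold u0 in M1, M2.
    destruct (IVT_interv (fun x => sg * (f x y - u)) (x0 - r) (x0 + r)) as (x & hx & Ex).
    - intros x Hx. apply continuity_pt_filterlim.
      apply (continuous_mult (K := R_AbsRing) (fun _ => sg) (fun x => f x y - u) x);
        [apply continuous_const|].
      apply (continuous_minus (V := R_NormedModule) (fun x => f x y) (fun _ => u));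
        [|apply continuous_const].
      apply (smooth2_continuous_x sf). apply BO. split; [|lra].
      apply Rabs_def1; unfold r in Hx; lra.
    - lra.
    - lra.
    - lra.
    - exists x. split; [split; [apply Rabs_def1; unfold r in hx; lra|lra]|].
      apply Rmult_eq_reg_l with sg; [lra|]. intros E. rewrite E in Hsg. lra. }
  (* Outside the box [epsilon] returns an unspecified value; inside, it picks the root, which [Lip]
     makes unique. *)
  set (g := fun u y => epsilon (inhabits 0) (fun x => in_box x0 y0 e x y /\ f x y = u)).
  assert (Hg : forall u y, in_box u0 y0 s u y -> in_box x0 y0 e (g u y) y /\ f (g u y) y = u).
  { intros u y Hu. exact (epsilon_spec (inhabits 0) _ (Ex u y Hu)). }
  exists e, s, g. split; [exact He|]. split; [exact Hs|].
  assert (nz : forall x y, in_box x0 y0 e x y -> dx f x y <> 0).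
  { intros x y Hx E. apply Bx' in Hx. rewrite E, Rabs_R0 in Hx. lra. }
  split; [now auto|].
  split; [|split; [exact Hg|]].
  2:{ intros x y Hx Hu. destruct (Hg _ _ Hu) as [G1 G2].
      assert (L := Lip _ _ _ _ Hx G1). rewrite G2, !Rminus_diag, Rabs_R0, Rmult_0_r, Rplus_0_l in L.
      assert (Rabs (g (f x y) y - x) = 0).
      { pose proof (Rabs_pos (g (f x y) y - x)). nra. }
      apply Rminus_diag_uniq. destruct (Req_dec (g (f x y) y - x) 0); trivial.
      exfalso. now apply (Rabs_no_R0 _ H1). }
  set (O' := in_box u0 y0 s) in *. assert (Ho' : open2 O') by apply open2_box.
  set (K := (M + 1) / m).
  assert (HM : 0 < M) by (unfold M; pose proof (Rabs_pos (dy f x0 y0)); lra).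
  assert (HK : 0 < K) by (apply Rdiv_lt_0_compat; lra).
  assert (Lg : forall u y u' y', O' u y -> O' u' y' ->
    Rabs (g u' y' - g u y) <= K * (Rabs (u' - u) + Rabs (y' - y))).
  { intros u y u' y' Hu Hu'. destruct (Hg _ _ Hu) as [G1 G2]. destruct (Hg _ _ Hu') as [G3 G4].
    assert (L := Lip _ _ _ _ G1 G3). rewrite G2, G4 in L.
    apply Rmult_le_reg_l with m; [exact Hm|]. eapply Rle_trans; [exact L|].
    unfold K. replace (m * ((M + 1) / m * (Rabs (u' - u) + Rabs (y' - y))))
      with ((M + 1) * (Rabs (u' - u) + Rabs (y' - y))) by (field; lra).
    pose proof (Rabs_pos (u' - u)). pose proof (Rabs_pos (y' - y)). nra. }
  (* The expansion of [f] at [(g u y, y)] is solved for the increment of [g]; the bound [Lg]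
     converts an error relative to that increment into one relative to the increments of [u] and
     [y]. *)
  assert (Dg : forall u y, O' u y -> forall ep, 0 < ep -> exists d, 0 < d /\
    forall u' y', Rabs (u' - u) < d -> Rabs (y' - y) < d ->
    Rabs (g u' y' - g u y - (u' - u - dy f (g u y) y * (y' - y)) / dx f (g u y) y)
      <= ep * (Rabs (u' - u) + Rabs (y' - y))).
  { intros u y Hu ep Hep. destruct (Hg _ _ Hu) as [G1 G2].
    set (D1 := dx f (g u y) y). set (D2 := dy f (g u y) y).
    assert (HD1 : 0 < Rabs D1) by (apply Rabs_pos_lt; now apply nz).
    assert (He' : 0 < ep * Rabs D1 / (K + 1)).
    { apply Rdiv_lt_0_compat; [now apply Rmult_lt_0_compat|lra]. }
    destruct (@C3_frechet _ (fun _ => f) 0 (g u y) y Ho (sf 1%nat) (BO _ _ G1) _ He')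
      as [d [Hd F]].
    destruct (proj1 (open2P O') Ho' _ _ Hu) as [d' [Hd' Ho1]].
    exists (Rmin d' (Rmin d (d / (2 * K)))).
    split; [repeat apply Rmin_glb_lt; trivial; apply Rdiv_lt_0_compat; lra|].
    intros u' y' h1 h2.
    apply Rmin_Rgt_l in h1. destruct h1 as [h11 h1]. apply Rmin_Rgt_l in h1. destruct h1 as [h12 h13].
    apply Rmin_Rgt_l in h2. destruct h2 as [h21 h2]. apply Rmin_Rgt_l in h2. destruct h2 as [h22 h23].
    assert (Hu' := Ho1 u' y' h11 h21). destruct (Hg _ _ Hu') as [G3 G4].
    assert (Lgu := Lg _ _ _ _ Hu Hu').
    assert (Lgd : Rabs (g u' y' - g u y) < d).
    { eapply Rle_lt_trans; [exact Lgu|].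
      apply Rlt_le_trans with (K * (d / (2 * K) + d / (2 * K))).
      - apply Rmult_lt_compat_l; lra.
      - right. field. lra. }
    assert (F' := F 0 (g u' y') y').
    assert (C : cube d 0 (g u y) y 0 (g u' y') y').
    { split; [rewrite Rminus_diag, Rabs_R0; exact Hd|]. split; [exact Lgd|lra]. }
    specialize (F' C). rewrite G2, G4 in F'.
    change (d2 (fun _ => f) 0 (g u y) y) with D1 in F'.
    change (d3 (fun _ => f) 0 (g u y) y) with D2 in F'.
    rewrite Rminus_diag, Rmult_0_r, Rabs_R0, !Rplus_0_l in F'.
    replace (g u' y' - g u y - (u' - u - D2 * (y' - y)) / D1) with
      (- (u' - u - (D1 * (g u' y' - g u y) + D2 * (y' - y))) / D1)
      by (field; intros E; rewrite E, Rabs_R0 in HD1; lra).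
    unfold Rdiv. rewrite Rabs_mult, Rabs_Ropp, Rabs_inv.
    apply Rmult_le_reg_r with (Rabs D1); [exact HD1|].
    rewrite Rmult_assoc, Rinv_l, Rmult_1_r by lra.
    eapply Rle_trans; [exact F'|].
    replace (ep * (Rabs (u' - u) + Rabs (y' - y)) * Rabs D1) with
      (ep * Rabs D1 / (K + 1) * ((K + 1) * (Rabs (u' - u) + Rabs (y' - y)))) by (field; lra).
    apply Rmult_le_compat_l; [lra|].
    pose proof (Rabs_pos (u' - u)). pose proof (Rabs_pos (y' - y)). lra. }
  assert (C0 : C3 0 (fun _ => O') (fun _ => g)).
  { apply C3_0. intros t u y Hu. apply cont3_lift. intros ep.
    destruct (proj1 (open2P O') Ho' _ _ Hu) as [d [Hd Ho1]].
    assert (Hp : 0 < Rmin d (ep / (2 * K))).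
    { apply Rmin_glb_lt; trivial. apply Rdiv_lt_0_compat; [apply cond_pos|lra]. }
    exists (mkposreal _ Hp). simpl. intros u' y' h1 h2.
    apply Rmin_Rgt_l in h1. destruct h1 as [h11 h12].
    apply Rmin_Rgt_l in h2. destruct h2 as [h21 h22].
    eapply Rle_lt_trans; [apply (Lg _ _ _ _ Hu (Ho1 u' y' h11 h21))|].
    apply Rlt_le_trans with (K * (ep / (2 * K) + ep / (2 * K))).
    - apply Rmult_lt_compat_l; lra.
    - right. field. lra. }
  (* The derivatives of [g] are [1 / f_x] and [- f_y / f_x] composed with [g], so regularity of
     order [n] for [g] yields order [n + 1]. *)
  intros n. induction n as [|n IH]; [exact C0|].
  assert (HB := @open2_box x0 y0 e).
  assert (sfx' : smooth2 (in_box x0 y0 e) (dx f)) by now apply (smooth2_sub (O' := O)).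
  assert (sfy' : smooth2 (in_box x0 y0 e) (dy f)) by now apply (smooth2_sub (O' := O)).
  assert (comp : forall h, smooth2 (in_box x0 y0 e) h ->
    C3 n (fun _ => O') (fun _ u y => h (g u y) y)).
  { intros h sh. apply (@C3_comp n (fun _ => O') _ (fun _ => h) (fun _ _ _ => 0) (fun _ => g)
      (fun _ _ y => y) Ho' HB (sh n)); trivial.
    - now apply C3_const.
    - now apply C3_3.
    - intros _ u y Hu. now apply Hg. }
  apply (C3_intro (f1 := fun _ _ _ => 0) (f2 := fun _ u y => / dx f (g u y) y)
     (f3 := fun _ u y => - dy f (g u y) y / dx f (g u y) y) Ho' C0).
  - intros t u y Hu.
    split; [apply is_derive_cst|].
    split; apply is_deriveP; intros ep Hep; destruct (Dg u y Hu ep Hep) as [d [Hd H]];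
      exists d; (split; [exact Hd|]).
    + intros u' Hu'. specialize (H u' y Hu').
      rewrite Rminus_diag, Rabs_R0, Rmult_0_r, Rminus_0_r, Rplus_0_r in H.
      replace (/ dx f (g u y) y * (u' - u)) with ((u' - u) / dx f (g u y) y)
        by (unfold Rdiv; ring). auto.
    + intros y' Hy'. specialize (H u y').
      rewrite Rminus_diag, Rabs_R0, Rminus_0_l, Rplus_0_l in H.
      replace (- dy f (g u y) y / dx f (g u y) y * (y' - y)) with
        (- (dy f (g u y) y * (y' - y)) / dx f (g u y) y) by (unfold Rdiv; ring). auto.
  - now apply C3_const.
  - apply (comp (fun x y => / dx f x y)). apply smooth2_inv; trivial.
  - apply (comp (fun x y => - dy f x y / dx f x y)).
    apply smooth2_div; trivial. now apply smooth2_opp.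
Qed.

(** The two boxes need not be mapped onto each other: [(X, Y)] is a right inverse on the whole
    target box, and a left inverse at those points of the source box whose image falls into the
    target box. *)
Definition local_inverse (O : R -> R -> Prop) (U V : R -> R -> R) (x0 y0 r s : R)
    (X Y : R -> R -> R) : Prop :=
  0 < r /\ 0 < s /\ (forall x y, in_box x0 y0 r x y -> O x y) /\
  smooth2 (in_box (U x0 y0) (V x0 y0) s) X /\ smooth2 (in_box (U x0 y0) (V x0 y0) s) Y /\
  (forall u v, in_box (U x0 y0) (V x0 y0) s u v ->
     in_box x0 y0 r (X u v) (Y u v) /\ U (X u v) (Y u v) = u /\ V (X u v) (Y u v) = v) /\
  (forall x y, in_box x0 y0 r x y -> in_box (U x0 y0) (V x0 y0) s (U x y) (V x y) ->
     X (U x y) (V x y) = x /\ Y (U x y) (V x y) = y).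

Lemma smooth2_box_near O f x0 y0 e :
  smooth2 O f -> O x0 y0 -> open2 O -> 0 < e ->
  exists d, 0 < d /\ forall x y, in_box x0 y0 d x y -> O x y /\ Rabs (f x y - f x0 y0) < e.
Proof.
  intros sf H0 Ho He. destruct (proj1 (open2P O) Ho _ _ H0) as [d [Hd K]].
  destruct (smooth2_cont sf H0 (mkposreal e He)) as [d' K']. simpl in K'.
  exists (Rmin d d'). split; [apply Rmin_glb_lt; [exact Hd|apply cond_pos]|].
  intros x y [h h']. apply Rmin_Rgt_l in h, h'. destruct h, h'. split; [now apply K|now apply K'].
Qed.

Lemma in_box_center x y r : 0 < r -> in_box x y r x y.
Proof. intros. unfold in_box. rewrite !Rminus_diag, Rabs_R0. lra. Qed.

Lemma smooth2_swap O f : open2 O -> smooth2 O f -> smooth2 (fun x y => O y x) (fun x y => f y x).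
Proof.
  intros Ho Hf.
  assert (Ho' : open2 (fun x y => O y x)).
  { apply open2P. intros x y Hx. destruct (proj1 (open2P O) Ho _ _ Hx) as [e [He H]].
    exists e. auto. }
  apply (smooth2_comp (O' := O)); trivial; [now apply smooth2_snd|now apply smooth2_fst].
Qed.

Lemma in_box_swap x0 y0 r x y : in_box x0 y0 r x y <-> in_box y0 x0 r y x.
Proof. unfold in_box. tauto. Qed.

Lemma in_box_le x0 y0 r r' x y : r <= r' -> in_box x0 y0 r x y -> in_box x0 y0 r' x y.
Proof. unfold in_box. lra. Qed.

Lemma is_derive_eq (f : R -> R) x l l' : is_derive f x l -> l = l' -> is_derive f x l'.
Proof. now intros H <-. Qed.

(** Two scalar inversions: [U = u] is solved as [x = g u y], and then [V (g u y) y = v] is solved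
    for [y]. The second is possible because the y-derivative of [V (g u y) y] times [U_x] is the
    Jacobian. *)
Lemma local_inverse_dx O U V x0 y0 :
  open2 O -> smooth2 O U -> smooth2 O V -> O x0 y0 -> jac U V x0 y0 <> 0 ->
  dx U x0 y0 <> 0 -> exists r s X Y, local_inverse O U V x0 y0 r s X Y.
Proof.
  intros Ho sU sV H0 HJ HU.
  destruct (implicit_function Ho sU H0 HU) as (e1 & s1 & g & pe1 & ps1 & B1 & sg & G1 & G2).
  set (u0 := U x0 y0) in *. set (v0 := V x0 y0).
  assert (c0 : in_box u0 y0 s1 u0 y0) by now apply in_box_center.
  assert (g0 : g u0 y0 = x0) by (apply G2; [now apply in_box_center|exact c0]).
  set (O1 := in_box u0 y0 s1) in *. assert (Ho1 : open2 O1) by apply open2_box.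
  set (W := fun u y => V (g u y) y).
  assert (sW : smooth2 O1 W).
  { apply (@smooth2_comp O1 O V g (fun _ y => y)); trivial.
    - now apply smooth2_snd.
    - intros u y Hu. apply B1, G1, Hu. }
  (* [implicit_function] solves for the first argument, hence the exchange of the variables of
     [W]. *)
  set (W' := fun y u => W u y). set (O1' := fun y u => O1 u y).
  assert (Ho1' : open2 O1').
  { apply open2P. intros x y Hx. destruct (proj1 (open2P O1) Ho1 _ _ Hx) as [e [He H]].
    exists e. unfold O1'. auto. }
  assert (sW' : smooth2 O1' W') by exact (smooth2_swap Ho1 sW).
  assert (HW : dx W' y0 u0 <> 0).
  { change (dy W u0 y0 <> 0). intros E. apply HJ.
    assert (D1 := is_dy sg c0).
    assert (Ou : O (g u0 y0) y0) by (apply B1, G1, c0).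
    assert (D2 := chain2 (a := fun y => g u0 y) (b := fun y => y) Ho sU Ou D1
       (is_derive_var y0)).
    assert (D3 := chain2 (a := fun y => g u0 y) (b := fun y => y) Ho sV Ou D1
       (is_derive_var y0)).
    assert (E1 : dx U (g u0 y0) y0 * dy g u0 y0 + dy U (g u0 y0) y0 * 1 = 0).
    { transitivity (Derive (fun y => U (g u0 y) y) y0); [symmetry; exact (is_derive_unique _ _ _ D2)|].
      rewrite (Derive_ext_loc _ (fun _ => u0)); [apply Derive_const|].
      apply (filter_imp (fun y => O1 u0 y)); [intros y Hy; now apply G1|].
      exact (open3_3 (t := 0) Ho1 c0). }
    assert (E2 : dx V (g u0 y0) y0 * dy g u0 y0 + dy V (g u0 y0) y0 * 1 = 0).
    { rewrite <- E. symmetry. exact (is_derive_unique _ _ _ D3). }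
    rewrite g0 in E1, E2. unfold jac.
    apply Rmult_eq_reg_l with 1; [|lra].
    transitivity (dx U x0 y0 * (dx V x0 y0 * dy g u0 y0 + dy V x0 y0 * 1)
      - dx V x0 y0 * (dx U x0 y0 * dy g u0 y0 + dy U x0 y0 * 1)); [ring|].
    rewrite E1, E2. ring. }
  destruct (implicit_function Ho1' sW' c0 HW) as (e2 & s2 & k & pe2 & ps2 & B2 & sk & K1 & K2).
  assert (W0 : W' y0 u0 = v0) by (unfold W', W; now rewrite g0). rewrite W0 in *.
  (* Shrinking the box around [(x0, y0)] makes every point of it determined by its image. *)
  destruct (smooth2_box_near sU H0 Ho (e := Rmin s1 e2)) as (r & pr & Hr);
    [now apply Rmin_glb_lt|].
  set (r' := Rmin (Rmin r e1) (Rmin s1 e2)).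
  assert (pr' : 0 < r') by (repeat apply Rmin_glb_lt; trivial).
  assert (rr : r' <= r /\ r' <= e1 /\ r' <= s1 /\ r' <= e2).
  { unfold r'. pose proof (Rmin_l (Rmin r e1) (Rmin s1 e2)).
    pose proof (Rmin_r (Rmin r e1) (Rmin s1 e2)).
    pose proof (Rmin_l r e1). pose proof (Rmin_r r e1).
    pose proof (Rmin_l s1 e2). pose proof (Rmin_r s1 e2). lra. }
  set (B := in_box u0 v0 s2).
  assert (HB : open2 B) by apply open2_box.
  set (Y := fun u v => k v u). set (X := fun u v => g u (Y u v)).
  assert (sY : smooth2 B Y).
  { apply (smooth2_sub (O' := fun x y => in_box v0 u0 s2 y x)).
    - intros u v h. now apply in_box_swap.
    - apply smooth2_swap; [apply open2_box|exact sk]. }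
  assert (YB : forall u v, B u v -> in_box u0 y0 e2 u (Y u v) /\ O1 u (Y u v) /\ W u (Y u v) = v).
  { intros u v Hu. apply in_box_swap in Hu. destruct (K1 _ _ Hu) as [h1 h2].
    split; [now apply in_box_swap|]. split; [|exact h2]. exact (proj1 (B2 _ _ h1)). }
  assert (sX : smooth2 B X).
  { apply (@smooth2_comp B O1 g (fun u _ => u) Y); trivial; [now apply smooth2_fst|].
    intros u v Hu. now apply YB. }
  assert (cB : B u0 v0) by (now apply in_box_center).
  assert (Y0 : Y u0 v0 = y0).
  { unfold Y. rewrite <- W0. apply K2; [now apply in_box_center|].
    rewrite W0. now apply in_box_center. }
  assert (X0 : X u0 v0 = x0) by (unfold X; now rewrite Y0).
  destruct (smooth2_box_near sX cB HB pr') as (q1 & pq1 & Q1).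
  destruct (smooth2_box_near sY cB HB pr') as (q2 & pq2 & Q2).
  rewrite X0 in Q1. rewrite Y0 in Q2.
  exists r', (Rmin s2 (Rmin q1 q2)), X, Y. fold u0 v0.
  assert (sub : forall u v, in_box u0 v0 (Rmin s2 (Rmin q1 q2)) u v ->
     B u v /\ in_box u0 v0 q1 u v /\ in_box u0 v0 q2 u v).
  { pose proof (Rmin_l s2 (Rmin q1 q2)). pose proof (Rmin_r s2 (Rmin q1 q2)).
    pose proof (Rmin_l q1 q2). pose proof (Rmin_r q1 q2).
    intros u v h. repeat split; eapply Rlt_le_trans; (apply h || lra). }
  split; [exact pr'|]. split; [repeat apply Rmin_glb_lt; trivial|].
  split; [|split; [|split; [|split]]].
  - intros x y h. apply Hr. now apply (@in_box_le _ _ r').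
  - apply (smooth2_sub (O' := B)); trivial. intros u v h. now apply sub.
  - apply (smooth2_sub (O' := B)); trivial. intros u v h. now apply sub.
  - intros u v h. apply sub in h. destruct h as (h1 & h2 & h3).
    destruct (YB _ _ h1) as (y1 & y2 & y3).
    split; [split; [now apply Q1|now apply Q2]|].
    split; [exact (proj2 (G1 _ _ y2))|exact y3].
  - intros x y h h'. apply sub in h'. destruct h' as (h1 & h2 & h3).
    destruct (Hr x y) as [Or Ur]; [now apply (@in_box_le _ _ r')|].
    fold u0 in Ur. apply Rmin_Rgt_l in Ur. destruct Ur as [Ur1 Ur2].
    assert (b1 : in_box x0 y0 e1 x y) by (apply (@in_box_le _ _ r'); [apply rr|exact h]).
    assert (o1 : O1 (U x y) y) by (split; [exact Ur1|destruct h; lra]).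
    assert (gx : g (U x y) y = x) by (now apply G2).
    assert (Wv : W' y (U x y) = V x y) by (unfold W', W; now rewrite gx).
    assert (Yy : Y (U x y) (V x y) = y).
    { unfold Y. rewrite <- Wv. apply K2.
      - split; [destruct h; lra|exact Ur2].
      - rewrite Wv. apply in_box_swap. exact h1. }
    split; [|exact Yy]. unfold X. rewrite Yy. exact gx.
Qed.

(** If [U_x] vanishes at the base, [U_y] does not, since the Jacobian is nonzero, and exchanging [x]
    and [y] reduces to the previous case. *)
Theorem inverse_function O U V x0 y0 :
  open2 O -> smooth2 O U -> smooth2 O V -> O x0 y0 -> jac U V x0 y0 <> 0 ->
  exists r s X Y, local_inverse O U V x0 y0 r s X Y.
Proof.
  intros Ho sU sV H0 HJ.
  destruct (Req_dec (dx U x0 y0) 0) as [E|E]; [|now apply local_inverse_dx].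
  assert (Ho' : open2 (fun x y => O y x)).
  { apply open2P. intros x y Hx. destruct (proj1 (open2P O) Ho _ _ Hx) as [e [He H]].
    exists e. auto. }
  destruct (@local_inverse_dx (fun x y => O y x) (fun x y => U y x) (fun x y => V y x) y0 x0 Ho'
    (smooth2_swap Ho sU) (smooth2_swap Ho sV) H0)
    as (r & s & Y & X & pr & ps & h1 & h2 & h3 & h4 & h5).
  - intros J. apply HJ. unfold jac in *.
    change (dx (fun x y => U y x) y0 x0) with (dy U x0 y0) in J.
    change (dx (fun x y => V y x) y0 x0) with (dy V x0 y0) in J.
    change (dy (fun x y => U y x) y0 x0) with (dx U x0 y0) in J.
    change (dy (fun x y => V y x) y0 x0) with (dx V x0 y0) in J. lra.
  - change (dx (fun x y => U y x) y0 x0) with (dy U x0 y0).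
    intros E'. apply HJ. unfold jac. rewrite E, E'. ring.
  - exists r, s, X, Y. split; [exact pr|]. split; [exact ps|].
    split; [|split; [|split; [|split]]]; trivial.
    + intros x y h. apply h1. now apply in_box_swap.
    + intros u v h. destruct (h4 u v h) as (k1 & k2 & k3).
      split; [now apply in_box_swap|]. now split.
    + intros x y h h'. destruct (h5 y x) as [k1 k2]; trivial.
      * now apply in_box_swap.
      * now split.
Qed.

(** * Local solvability of [v'' = g(s, v)] *)

(** Truncation to an interval. It turns functions controlled only locally into globally defined ones
    with global Lipschitz bounds. *)
Definition clamp (a b x : R) : R := Rmax a (Rmin b x).

Lemma clamp_bounds a b x : a <= b -> a <= clamp a b x <= b.
Proof.
  intros H. unfold clamp. split; [apply Rmax_l|]. apply Rmax_lub; [exact H|apply Rmin_l].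
Qed.

Lemma clamp_id a b x : a <= x <= b -> clamp a b x = x.
Proof. intros H. unfold clamp. rewrite Rmin_right, Rmax_right; lra. Qed.

Lemma clamp_lip a b x y : Rabs (clamp a b x - clamp a b y) <= Rabs (x - y).
Proof.
  unfold clamp, Rmax, Rmin. repeat destruct Rle_dec; unfold Rabs; repeat destruct Rcase_abs; lra.
Qed.

Lemma continuousP (f : R -> R) x :
  continuous f x <->
  forall e, 0 < e -> exists d, 0 < d /\ forall y, Rabs (y - x) < d -> Rabs (f y - f x) < e.
Proof.
  split.
  - intros H e He. destruct (proj1 (filterlim_locally _ _) H (mkposreal e He)) as [d Hd].
    exists d. split; [apply cond_pos|exact Hd].
  - intros H. apply filterlim_locally. intros e. destruct (H e (cond_pos e)) as [d [Hd H']].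
    exists (mkposreal d Hd). exact H'.
Qed.

Lemma clamp_continuous a b x : continuous (clamp a b) x.
Proof.
  apply continuousP. intros e He. exists e. split; [exact He|].
  intros y Hy. eapply Rle_lt_trans; [apply clamp_lip|exact Hy].
Qed.

Lemma ex_RInt_cont (f : R -> R) a b : (forall x, continuous f x) -> ex_RInt f a b.
Proof. intros H. apply (ex_RInt_continuous (V := R_CompleteNormedModule)). auto. Qed.

Lemma is_derive_RInt_cont (f : R -> R) a x :
  (forall x, continuous f x) -> is_derive (fun b => RInt f a b) x (f x).
Proof.
  intros H. apply (is_derive_RInt (V := R_NormedModule) f _ a); [|apply H].
  apply filter_forall. intros b. apply (RInt_correct (V := R_CompleteNormedModule)).
  now apply ex_RInt_cont.
Qed.

Lemma RInt_dist (f g : R -> R) a b c :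
  (forall x, continuous f x) -> (forall x, continuous g x) ->
  (forall x, Rmin a b <= x <= Rmax a b -> Rabs (f x - g x) <= c) ->
  Rabs (RInt f a b - RInt g a b) <= Rabs (b - a) * c.
Proof.
  intros Hf Hg H.
  apply (norm_RInt_le_const_abs (V := R_NormedModule) (fun x => f x - g x) a b); [exact H|].
  apply (is_RInt_minus (V := R_NormedModule));
    apply (RInt_correct (V := R_CompleteNormedModule)); now apply ex_RInt_cont.
Qed.

Lemma is_derive_continuous (f : R -> R) x l : is_derive f x l -> continuous f x.
Proof.
  intros H. apply (ex_derive_continuous (K := R_AbsRing) (V := R_NormedModule)). now exists l.
Qed.

(** Since [g] is free of [v'], the problem is a fixed point of a double integral operator [T] on
    continuous functions of one real variable, and iteration converges uniformly at the rate
    [2 ^ -n]. *)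
Lemma picard_global (g : R -> R -> R) K s0 v0 p :
  0 <= K -> (forall s a b, Rabs (g s a - g s b) <= K * Rabs (a - b)) ->
  (forall v : R -> R, (forall s, continuous v s) -> forall s, continuous (fun s => g s (v s)) s) ->
  exists d v w, 0 < d /\ v s0 = v0 /\ w s0 = p /\
    forall s, Rabs (s - s0) < d -> is_derive v s (w s) /\ is_derive w s (g s (v s)).
Proof.
  intros HK Hlip Hcont.
  (* This choice gives [d * d * K <= 1 / 2]; two integrations over length [d] then make [T] halve
     distances. *)
  set (d := / (1 + K)). assert (Hd : 0 < d) by (apply Rinv_0_lt_compat; lra).
  assert (HKd : d * (d * K) <= / 2).
  { apply Rmult_le_reg_r with ((1 + K) * (1 + K)); [nra|].
    unfold d. replace (/ (1 + K) * (/ (1 + K) * K) * ((1 + K) * (1 + K))) with K by (field; lra).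
    nra. }
  (* With the time clamped, [T v] is defined and estimated on the whole line, so uniform bounds hold
     for all [s] at once. *)
  set (k := clamp (s0 - d) (s0 + d)).
  assert (Hk : forall s, Rabs (k s - s0) <= d).
  { intros s. destruct (@clamp_bounds (s0 - d) (s0 + d) s ltac:(lra)). fold k in H, H0.
    apply Rabs_le. lra. }
  set (G := fun (v : R -> R) r => p + RInt (fun t => g t (v t)) s0 r).
  set (T := fun (v : R -> R) s => v0 + RInt (G v) s0 (k s)).
  assert (dG : forall v, (forall s, continuous v s) -> forall r, is_derive (G v) r (g r (v r))).
  { intros v Hv r. unfold G. rewrite <- (Rplus_0_l (g r (v r))).
    apply (is_derive_plus (V := R_NormedModule) (fun _ => p)
      (fun r => RInt (fun t => g t (v t)) s0 r)).
    - apply is_derive_cst.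
    - apply (is_derive_RInt_cont s0 (f := fun t => g t (v t))). now apply Hcont. }
  assert (cG : forall v, (forall s, continuous v s) -> forall r, continuous (G v) r).
  { intros v Hv r. eapply is_derive_continuous. now apply dG. }
  assert (cT0 : forall v, (forall s, continuous v s) -> forall s,
     is_derive (fun s => v0 + RInt (G v) s0 s) s (G v s)).
  { intros v Hv s. rewrite <- (Rplus_0_l (G v s)).
    apply (is_derive_plus (V := R_NormedModule) (fun _ => v0) (fun r => RInt (G v) s0 r)).
    - apply is_derive_cst.
    - apply is_derive_RInt_cont. now apply cG. }
  assert (cT : forall v, (forall s, continuous v s) -> forall s, continuous (T v) s).
  { intros v Hv s. apply (continuous_comp k (fun s => v0 + RInt (G v) s0 s)).
    - apply clamp_continuous.
    - eapply is_derive_continuous. now apply cT0. }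
  assert (contr : forall v w c, (forall s, continuous v s) -> (forall s, continuous w s) ->
    (forall s, Rabs (v s - w s) <= c) -> forall s, Rabs (T v s - T w s) <= c / 2).
  { intros v w c Hv Hw H s.
    assert (Hc : 0 <= c) by (eapply Rle_trans; [apply Rabs_pos|apply (H s0)]).
    unfold T. replace (v0 + RInt (G v) s0 (k s) - (v0 + RInt (G w) s0 (k s)))
      with (RInt (G v) s0 (k s) - RInt (G w) s0 (k s)) by ring.
    eapply Rle_trans; [apply (RInt_dist (c := d * (K * c)))|].
    - now apply cG.
    - now apply cG.
    - intros r Hr. assert (Hr' : Rabs (r - s0) <= d).
      { eapply Rle_trans; [apply Rabs_between; exact Hr|apply Hk]. }
      unfold G. replace (p + RInt (fun t => g t (v t)) s0 r - (p + RInt (fun t => g t (w t)) s0 r))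
        with (RInt (fun t => g t (v t)) s0 r - RInt (fun t => g t (w t)) s0 r) by ring.
      eapply Rle_trans; [apply (RInt_dist (c := K * c))|].
      + now apply Hcont.
      + now apply Hcont.
      + intros t _. eapply Rle_trans; [apply Hlip|]. now apply Rmult_le_compat_l.
      + apply Rmult_le_compat_r; [now apply Rmult_le_pos|exact Hr'].
    - apply Rle_trans with (d * (d * (K * c))).
      + apply Rmult_le_compat_r; [|apply Hk]. apply Rmult_le_pos; [lra|now apply Rmult_le_pos].
      + replace (d * (d * (K * c))) with ((d * (d * K)) * c) by ring.
        replace (c / 2) with (/ 2 * c) by field. now apply Rmult_le_compat_r. }
  set (u := fun n => Nat.iter n T (fun _ => v0)).
  assert (cu : forall n s, continuous (u n) s).
  { induction n as [|n IH]; [intros s; apply continuous_const|]. now apply cT. }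
  (* The first two iterates depend on [s] only through the clamped time, so their distance is a
     continuous function on a compact interval. *)
  assert (HM : exists M, forall s, Rabs (u 1%nat s - u 0%nat s) <= M).
  { destruct (continuity_ab_maj (fun s => Rabs (v0 + RInt (G (u 0%nat)) s0 s - v0))
      (s0 - d) (s0 + d)) as [mx [Hmx _]]; [lra| |].
    - intros s _. apply continuity_pt_filterlim.
      apply (continuous_comp (fun s => v0 + RInt (G (u 0%nat)) s0 s - v0) Rabs).
      + apply (continuous_minus (V := R_NormedModule)
          (fun s => v0 + RInt (G (u 0%nat)) s0 s) (fun _ => v0)); [|apply continuous_const].
        eapply is_derive_continuous. apply cT0. apply (cu 0%nat).
      + apply continuous_Rabs.
    - eexists. intros s. apply (Hmx (k s)). apply clamp_bounds. lra. }
  destruct HM as [M HM].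
  assert (step : forall n s, Rabs (u (S n) s - u n s) <= M / 2 ^ n).
  { induction n as [|n IH]; intros s.
    - rewrite pow_O, Rdiv_1_r. apply HM.
    - replace (M / 2 ^ S n) with (M / 2 ^ n / 2)
        by (simpl; field; apply pow_nonzero; lra).
      apply (contr (u (S n)) (u n)); auto. }
  assert (M0 : 0 <= M) by (eapply Rle_trans; [apply Rabs_pos|apply (HM s0)]).
  assert (p2 : forall n, 0 < 2 ^ n) by (intros; apply pow_lt; lra).
  (* The geometric series is summed exactly; keeping the subtracted tail is what makes the induction
     on [m] go through. *)
  assert (far : forall n m s, Rabs (u (n + m)%nat s - u n s) <= 2 * M / 2 ^ n - 2 * M / 2 ^ (n + m)).
  { intros n m s. induction m as [|m IH].
    - rewrite Nat.add_0_r, !Rminus_diag, Rabs_R0. lra.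
    - rewrite Nat.add_succ_r.
      replace (u (S (n + m)) s - u n s) with
        ((u (S (n + m)) s - u (n + m)%nat s) + (u (n + m)%nat s - u n s)) by ring.
      eapply Rle_trans; [apply Rabs_triang|].
      assert (A := step (n + m)%nat s).
      replace (2 * M / 2 ^ S (n + m)) with (M / 2 ^ (n + m))
        by (simpl; field; apply pow_nonzero; lra).
      replace (2 * M / 2 ^ (n + m)) with (2 * (M / 2 ^ (n + m))) in IH
        by (field; apply pow_nonzero; lra). lra. }
  assert (small : forall e, 0 < e -> exists n, 2 * M / 2 ^ n < e).
  { intros e He. destruct (pow_lt_1_zero (/ 2)) with (y := e / (2 * M + 1)) as [n Hn].
    - rewrite Rabs_pos_eq; lra.
    - apply Rdiv_lt_0_compat; lra.
    - exists n. specialize (Hn n ltac:(lia)). rewrite pow_inv in Hn.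
      rewrite Rabs_pos_eq in Hn by (apply Rlt_le, Rinv_0_lt_compat; auto).
      apply Rle_lt_trans with (2 * M * (e / (2 * M + 1))).
      + unfold Rdiv at 1. apply Rmult_le_compat_l; lra.
      + apply Rmult_lt_reg_r with (2 * M + 1); [lra|].
        replace (2 * M * (e / (2 * M + 1)) * (2 * M + 1)) with (2 * M * e) by (field; lra). nra. }
  assert (lim : forall s, ex_finite_lim_seq (fun n => u n s)).
  { intros s. apply ex_lim_seq_cauchy_corr. intros e.
    destruct (small (e / 2)) as [n0 Hn0]; [apply is_pos_div_2|].
    exists n0. intros n m Hn Hm.
    assert (A := far n0 (n - n0)%nat s). assert (B := far n0 (m - n0)%nat s).
    replace (n0 + (n - n0))%nat with n in A by lia.
    replace (n0 + (m - n0))%nat with m in B by lia.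
    assert (0 <= 2 * M / 2 ^ n) by (apply Rdiv_le_0_compat; [lra|apply p2]).
    assert (0 <= 2 * M / 2 ^ m) by (apply Rdiv_le_0_compat; [lra|apply p2]).
    replace (u n s - u m s) with ((u n s - u n0 s) + - (u m s - u n0 s)) by ring.
    eapply Rle_lt_trans; [apply Rabs_triang|]. rewrite Rabs_Ropp. lra. }
  set (v := fun s => real (Lim_seq (fun n => u n s))).
  assert (Hv : forall s, is_lim_seq (fun n => u n s) (v s)).
  { intros s. apply Lim_seq_correct'. apply lim. }
  assert (dist : forall n s, Rabs (v s - u n s) <= 2 * M / 2 ^ n).
  { intros n s.
    assert (L : is_lim_seq (fun m => Rabs (u (m + n)%nat s - u n s)) (Rabs (v s - u n s))).
    { apply (is_lim_seq_abs _ (v s - u n s)).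
      apply is_lim_seq_minus'; [|apply is_lim_seq_const].
      apply (is_lim_seq_incr_n (fun m => u m s)). apply Hv. }
    change (Rbar_le (Rabs (v s - u n s)) (2 * M / 2 ^ n)).
    apply (is_lim_seq_le (fun m => Rabs (u (m + n)%nat s - u n s)) (fun _ => 2 * M / 2 ^ n));
      [|exact L|apply is_lim_seq_const].
    intros m. rewrite Nat.add_comm. eapply Rle_trans; [apply far|].
    assert (0 <= 2 * M / 2 ^ (n + m)) by (apply Rdiv_le_0_compat; [lra|apply p2]). lra. }
  assert (cv : forall s, continuous v s).
  { intros s. apply continuousP. intros e He.
    destruct (small (e / 3)) as [n Hn]; [lra|].
    destruct (proj1 (continuousP _ _) (cu n s) (e / 3)) as [d' [Hd' H]]; [lra|].
    exists d'. split; [exact Hd'|]. intros s' Hs'. specialize (H s' Hs').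
    assert (A := dist n s). assert (B := dist n s').
    replace (v s' - v s) with ((v s' - u n s') + (u n s' - u n s) + - (v s - u n s)) by ring.
    eapply Rle_lt_trans; [apply Rabs_triang|]. rewrite Rabs_Ropp.
    eapply Rle_lt_trans; [apply Rplus_le_compat_r; apply Rabs_triang|]. lra. }
  assert (fixv : forall s, v s = T v s).
  { intros s. apply Rminus_diag_uniq. destruct (Req_dec (v s - T v s) 0) as [|N]; trivial.
    exfalso. destruct (small (Rabs (v s - T v s))) as [n Hn]; [now apply Rabs_pos_lt|].
    assert (A := dist (S n) s). assert (B := contr _ _ _ cv (cu n) (dist n) s).
    change (T (u n) s) with (u (S n) s) in B.
    replace (2 * M / 2 ^ S n) with (2 * M / 2 ^ n / 2) in A
      by (simpl; field; apply pow_nonzero; lra).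
    replace (v s - T v s) with ((v s - u (S n) s) + - (T v s - u (S n) s)) in Hn by ring.
    assert (C := Rabs_triang (v s - u (S n) s) (- (T v s - u (S n) s))).
    rewrite Rabs_Ropp in C. lra. }
  exists d, v, (G v). split; [exact Hd|]. split; [|split].
  - rewrite fixv. unfold T. unfold k. rewrite clamp_id by lra.
    rewrite (RInt_point (V := R_CompleteNormedModule)). apply Rplus_0_r.
  - unfold G. rewrite (RInt_point (V := R_CompleteNormedModule)). apply Rplus_0_r.
  - intros s Hs. split; [|now apply dG].
    apply (is_derive_ext_loc (fun s => v0 + RInt (G v) s0 s)); [|now apply cT0].
    exists (mkposreal (d - Rabs (s - s0)) ltac:(lra)). intros s' Hs'.
    rewrite fixv. unfold T, k. rewrite clamp_id; trivial.
    assert (Hb : Rabs (s' - s0) < d).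
    { replace (s' - s0) with ((s' - s) + (s - s0)) by ring.
      eapply Rle_lt_trans; [apply Rabs_triang|]. unfold ball in Hs'. simpl in Hs'.
      unfold AbsRing_ball, abs, minus, plus, opp in Hs'. simpl in Hs'.
      replace (s' + - s) with (s' - s) in Hs' by ring. lra. }
    apply Rabs_def2 in Hb. lra.
Qed.

(** The right-hand side is not Lipschitz in [v] on the whole line, and [b] is controlled only near
    [s0]; clamping [v] to distance 1 from [v0] and the time to distance [r / 2] repairs both, with
    Lipschitz constant [Rabs v0 + 1]. By continuity the solution stays for a short time where the
    clamps act as the identity. *)
Lemma picard_quadratic (b : R -> R) s0 r v0 p :
  0 < r -> (forall s, Rabs (s - s0) < r -> continuous b s) ->
  exists d v w, 0 < d /\ v s0 = v0 /\ w s0 = p /\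
    forall s, Rabs (s - s0) < d -> is_derive v s (w s) /\ is_derive w s (- (v s ^ 2 / 2 + b s)).
Proof.
  intros Hr Hb.
  set (k := clamp (s0 - r / 2) (s0 + r / 2)). set (q := clamp (v0 - 1) (v0 + 1)).
  set (g := fun s a => - (q a ^ 2 / 2 + b (k s))).
  assert (Hq : forall a, Rabs (q a) <= Rabs v0 + 1).
  { intros a. destruct (@clamp_bounds (v0 - 1) (v0 + 1) a ltac:(lra)) as [h1 h2].
    fold q in h1, h2. unfold Rabs. repeat destruct Rcase_abs; lra. }
  destruct (@picard_global g (Rabs v0 + 1) s0 v0 p) as (d & v & w & pd & E1 & E2 & H).
  - pose proof (Rabs_pos v0). lra.
  - intros s a1 a2. unfold g.
    replace (- (q a1 ^ 2 / 2 + b (k s)) - - (q a2 ^ 2 / 2 + b (k s)))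
      with (- ((q a1 + q a2) / 2) * (q a1 - q a2)) by field.
    rewrite Rabs_mult, Rabs_Ropp. apply Rmult_le_compat; try apply Rabs_pos.
    + unfold Rdiv. rewrite Rabs_mult, (Rabs_pos_eq (/ 2)) by lra.
      pose proof (Rabs_triang (q a1) (q a2)). pose proof (Hq a1). pose proof (Hq a2). lra.
    + apply clamp_lip.
  - intros v Hv s. unfold g.
    apply (continuous_opp (V := R_NormedModule) (fun s => q (v s) ^ 2 / 2 + b (k s))).
    apply (continuous_plus (V := R_NormedModule) (fun s => q (v s) ^ 2 / 2) (fun s => b (k s))).
    + apply (continuous_comp (fun s => q (v s)) (fun z => z ^ 2 / 2)).
      * apply (continuous_comp v q); [apply Hv|apply clamp_continuous].
      * apply (is_derive_continuous (l := q (v s))). auto_derive; trivial. field.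
    + apply (continuous_comp k b); [apply clamp_continuous|]. apply Hb.
      destruct (@clamp_bounds (s0 - r / 2) (s0 + r / 2) s ltac:(lra)) as [h1 h2].
      apply Rabs_def1; unfold k; lra.
  - assert (Hc : continuous v s0).
    { apply (is_derive_continuous (l := w s0)). apply H. rewrite Rminus_diag, Rabs_R0. exact pd. }
    destruct (proj1 (continuousP _ _) Hc 1 Rlt_0_1) as [d' [pd' Hd']].
    exists (Rmin (Rmin d d') (r / 2)), v, w.
    split; [repeat apply Rmin_glb_lt; lra|]. split; [exact E1|]. split; [exact E2|].
    intros s Hs. apply Rmin_Rgt_l in Hs. destruct Hs as [Hs Hs3].
    apply Rmin_Rgt_l in Hs. destruct Hs as [Hs1 Hs2].
    destruct (H s Hs1) as [D1 D2]. split; [exact D1|].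
    unfold g, q, k in D2. rewrite !clamp_id in D2; trivial.
    + apply Rgt_lt, Rabs_def2 in Hs3. lra.
    + specialize (Hd' s Hs2). rewrite E1 in Hd'. apply Rabs_def2 in Hd'. lra.
Qed.

(** * Parametrized curves *)

(** [jet1] and [jet2] are the first and second derivatives of [U] along a curve at [(x, y)] with
    velocity [(x1, y1)] and acceleration [(x2, y2)]. *)
Definition jet1 (U : R -> R -> R) (x y x1 y1 : R) : R := dx U x y * x1 + dy U x y * y1.

Definition jet2 (U : R -> R -> R) (x y x1 y1 x2 y2 : R) : R :=
  dx (dx U) x y * x1 ^ 2 + 2 * dx (dy U) x y * x1 * y1 + dy (dy U) x y * y1 ^ 2
  + jet1 U x y x2 y2.

Section Jets.
Variables (O : R -> R -> Prop) (U : R -> R -> R) (X Y X1 Y1 : R -> R) (s : R).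
Hypotheses (Ho : open2 O) (sU : smooth2 O U) (Hs : O (X s) (Y s)).
Hypotheses (HX : is_derive X s (X1 s)) (HY : is_derive Y s (Y1 s)).

Lemma is_derive_jet1 :
  is_derive (fun s => U (X s) (Y s)) s (jet1 U (X s) (Y s) (X1 s) (Y1 s)).
Proof. exact (chain2 Ho sU Hs HX HY). Qed.

Lemma is_derive_jet2 X2 Y2 :
  is_derive X1 s X2 -> is_derive Y1 s Y2 ->
  is_derive (fun s => jet1 U (X s) (Y s) (X1 s) (Y1 s)) s
    (jet2 U (X s) (Y s) (X1 s) (Y1 s) X2 Y2).
Proof.
  intros HX1 HY1. unfold jet1 at 1.
  assert (A := chain2 Ho (smooth2_dx sU) Hs HX HY).
  assert (B := chain2 Ho (smooth2_dy sU) Hs HX HY).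
  eapply is_derive_eq.
  - apply (is_derive_plus (V := R_NormedModule) (fun s => dx U (X s) (Y s) * X1 s)
      (fun s => dy U (X s) (Y s) * Y1 s)).
    + exact (is_derive_mult (fun s => dx U (X s) (Y s)) X1 s _ _ A HX1 Rmult_comm).
    + exact (is_derive_mult (fun s => dy U (X s) (Y s)) Y1 s _ _ B HY1 Rmult_comm).
  - unfold jet2, jet1, plus, mult. simpl. rewrite (dydx Ho sU Hs). ring.
Qed.
End Jets.

(** The identity of [rectifies] at [p = y1 / x1], multiplied by [x1 ^ 3]. For a curve in any
    parametrization, the defect in the canonical equation is the Jacobian times the defect in [E],
    so the two vanish together. *)
Lemma rectifies_jet E U V l x y x1 y1 x2 y2 :
  rectifies E U V l x y -> x1 <> 0 ->
  jet2 V x y x1 y1 x2 y2 * jet1 U x y x1 y1 - jet1 V x y x1 y1 * jet2 U x y x1 y1 x2 y2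
    + (V x y ^ 2 / 2 + l x y) * jet1 U x y x1 y1 ^ 3
  = jac U V x y * (y2 * x1 - y1 * x2 - x1 ^ 3 * ode_rhs E x y (y1 / x1)).
Proof.
  intros (_ & _ & H) Hx. specialize (H (y1 / x1)).
  apply (f_equal (fun z => x1 ^ 3 * z)) in H. cbv beta in H.
  replace (jac U V x y * (y2 * x1 - y1 * x2 - x1 ^ 3 * ode_rhs E x y (y1 / x1)))
    with (jac U V x y * (y2 * x1 - y1 * x2) + x1 ^ 3 * (- jac U V x y * ode_rhs E x y (y1 / x1)))
    by ring.
  rewrite <- H. unfold jet2, jet1, jac. field. exact Hx.
Qed.

Lemma Rbar_open_interval (a b : Rbar) (s : R) :
  Rbar_lt a s -> Rbar_lt s b ->
  exists e, 0 < e /\ forall s', Rabs (s' - s) < e -> Rbar_lt a s' /\ Rbar_lt s' b.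
Proof.
  intros Ha Hb.
  assert (A : exists e, 0 < e /\ forall s', Rabs (s' - s) < e -> Rbar_lt a s').
  { destruct a as [a| |]; simpl in *; try contradiction.
    - exists (s - a). split; [lra|]. intros s' H. apply Rabs_def2 in H. lra.
    - exists 1. split; [lra|trivial]. }
  assert (B : exists e, 0 < e /\ forall s', Rabs (s' - s) < e -> Rbar_lt s' b).
  { destruct b as [b| |]; simpl in *; try contradiction.
    - exists (b - s). split; [lra|]. intros s' H. apply Rabs_def2 in H. lra.
    - exists 1. split; [lra|trivial]. }
  destruct A as [e [He A]]. destruct B as [e' [He' B]].
  exists (Rmin e e'). split; [now apply Rmin_glb_lt|].
  intros s' H. apply Rmin_Rgt_l in H. destruct H. auto.
Qed.

Lemma Rbar_interval_convex (a b : Rbar) (s1 s2 s : R) :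
  Rbar_lt a s1 -> Rbar_lt s2 b -> s1 <= s <= s2 -> Rbar_lt a s /\ Rbar_lt s b.
Proof.
  intros Ha Hb Hs. split.
  - apply Rbar_lt_le_trans with s1; [exact Ha|]. simpl. lra.
  - apply Rbar_le_lt_trans with s2; [|exact Hb]. simpl. lra.
Qed.

Lemma Rbar_interval_inhabited (a b : Rbar) :
  Rbar_lt a b -> exists s : R, Rbar_lt a s /\ Rbar_lt s b.
Proof.
  destruct a as [a| |], b as [b| |]; simpl; try contradiction; intros H.
  - exists ((a + b) / 2). lra.
  - exists (a + 1). split; [lra|trivial].
  - exists (b - 1). split; [trivial|lra].
  - now exists 0.
Qed.

(** The endpoints [a'], [b'] may be infinite. The two derivatives are the usual expressions of dy/dx
    and of the second derivative of [y] with respect to [x] in a parameter. *)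
Definition graph_of_curve (a b : Rbar) (X Y X1 Y1 X2 Y2 : R -> R)
    (h : R -> R) (a' b' : Rbar) : Prop :=
  Rbar_lt a' b' /\
  (forall u v, graph h a' b' u v <->
     exists s : R, (Rbar_lt a s /\ Rbar_lt s b) /\ u = X s /\ v = Y s) /\
  (forall s : R, Rbar_lt a s -> Rbar_lt s b ->
     is_derive h (X s) (Y1 s / X1 s) /\
     is_derive (Derive h) (X s) ((Y2 s * X1 s - Y1 s * X2 s) / X1 s ^ 3)).

(** Since [X] is strictly increasing and continuous, its image is the open interval between its
    infimum and its supremum in [Rbar], and [h] is [Y] composed with the inverse of [X]. *)
Lemma graph_of_increasing_curve (a b : Rbar) X Y X1 Y1 X2 Y2 :
  Rbar_lt a b ->
  (forall s : R, Rbar_lt a s -> Rbar_lt s b ->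
     is_derive X s (X1 s) /\ is_derive X1 s (X2 s) /\
     is_derive Y s (Y1 s) /\ is_derive Y1 s (Y2 s) /\ 0 < X1 s) ->
  exists h a' b', graph_of_curve a b X Y X1 Y1 X2 Y2 h a' b'.
Proof.
  intros Hab H.
  set (I := fun s : R => Rbar_lt a s /\ Rbar_lt s b).
  assert (Xinc : forall s1 s2 : R, I s1 -> I s2 -> s1 < s2 -> X s1 < X s2).
  { intros s1 s2 [h1 _] [_ h2] Hlt.
    destruct (@MVT_is_derive X X1 s1 s2) as (c & Hc & E).
    - intros s Hs. rewrite Rmin_left, Rmax_right in Hs by lra.
      destruct (Rbar_interval_convex h1 h2 Hs) as [k1 k2]. now apply H.
    - rewrite Rmin_left, Rmax_right in Hc by lra.
      destruct (Rbar_interval_convex h1 h2 Hc) as [k1 k2].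
      destruct (H c k1 k2) as (_ & _ & _ & _ & Hp). nra. }
  assert (Xinj : forall s1 s2 : R, I s1 -> I s2 -> X s1 < X s2 -> s1 < s2).
  { intros s1 s2 h1 h2 Hlt. destruct (Rtotal_order s1 s2) as [|[E|Hgt]]; trivial.
    - subst. lra.
    - assert (X s2 < X s1) by (apply Xinc; assumption). lra. }
  set (E := fun u => exists s, I s /\ u = X s).
  set (a' := Glb_Rbar E). set (b' := Lub_Rbar E).
  destruct (Glb_Rbar_correct E) as [Ga Ga']. destruct (Lub_Rbar_correct E) as [Lb Lb'].
  fold a' in Ga, Ga'. fold b' in Lb, Lb'.
  assert (into : forall s, I s -> Rbar_lt a' (X s) /\ Rbar_lt (X s) b').
  { intros s Is. destruct (Rbar_open_interval (proj1 Is) (proj2 Is)) as [e [He Hs]].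
    assert (I1 : I (s - e / 2)) by (apply Hs; replace (s - e / 2 - s) with (- (e / 2)) by ring;
      rewrite Rabs_Ropp, Rabs_pos_eq; lra).
    assert (I2 : I (s + e / 2)) by (apply Hs; replace (s + e / 2 - s) with (e / 2) by ring;
      rewrite Rabs_pos_eq; lra).
    split.
    - apply Rbar_le_lt_trans with (X (s - e / 2)).
      + apply Ga. exists (s - e / 2). split; [exact I1|reflexivity].
      + simpl. apply Xinc; trivial. lra.
    - apply Rbar_lt_le_trans with (X (s + e / 2)).
      + simpl. apply Xinc; trivial. lra.
      + apply Lb. exists (s + e / 2). split; [exact I2|reflexivity]. }
  assert (onto : forall u : R, Rbar_lt a' u -> Rbar_lt u b' -> E u).
  { intros u Hu1 Hu2.
    assert (L1 : exists s, I s /\ X s < u).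
    { apply NNPP. intros N. apply (Rbar_lt_not_le _ _ Hu1). apply Ga'.
      intros z [s [Is ->]]. simpl. destruct (Rle_lt_dec u (X s)); trivial.
      exfalso. apply N. now exists s. }
    assert (L2 : exists s, I s /\ u < X s).
    { apply NNPP. intros N. apply (Rbar_lt_not_le _ _ Hu2). apply Lb'.
      intros z [s [Is ->]]. simpl. destruct (Rle_lt_dec (X s) u); trivial.
      exfalso. apply N. now exists s. }
    destruct L1 as (s1 & I1 & l1). destruct L2 as (s2 & I2 & l2).
    assert (s12 : s1 < s2) by (apply Xinj; trivial; lra).
    destruct (IVT_interv (fun s => X s - u) s1 s2) as (s & Hs & Es); try lra.
    - intros s Hs. destruct (Rbar_interval_convex (proj1 I1) (proj2 I2) Hs) as [k1 k2].
      apply continuity_pt_filterlim.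
      apply (continuous_minus (V := R_NormedModule) X (fun _ => u)); [|apply continuous_const].
      exact (is_derive_continuous (proj1 (H s k1 k2))).
    - destruct (Rbar_interval_convex (proj1 I1) (proj2 I2) Hs) as [k1 k2].
      exists s. split; [now split|lra]. }
  set (inv := fun u => epsilon (inhabits 0) (fun s => I s /\ u = X s)).
  assert (Hinv : forall u : R, Rbar_lt a' u -> Rbar_lt u b' -> I (inv u) /\ u = X (inv u)).
  { intros u h1 h2. exact (epsilon_spec (inhabits 0) _ (onto u h1 h2)). }
  assert (invX : forall s, I s -> inv (X s) = s).
  { intros s Is. destruct (into s Is) as [h1 h2]. destruct (Hinv _ h1 h2) as [h3 h4].
    destruct (Rtotal_order (inv (X s)) s) as [L|[L|L]]; trivial.
    - assert (X (inv (X s)) < X s) by (now apply Xinc). lra.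
    - assert (X s < X (inv (X s))) by (now apply Xinc). lra. }
  assert (dinv : forall s, I s -> is_derive inv (X s) (/ X1 s)).
  { intros s Is. destruct (H s (proj1 Is) (proj2 Is)) as (HX & _ & _ & _ & Hp).
    destruct (into s Is) as [i1 i2].
    destruct (Rbar_open_interval i1 i2) as [e0 [He0 Hin]].
    apply is_deriveP. intros e He.
    (* The first bound makes the increment of [inv] at most [2 / X1 s] times that of [u]; the second
       turns the remainder of [X] into at most [e] times the increment of [u] after division by
       [X1 s]. *)
    set (e' := Rmin (X1 s / 2) (e * X1 s * X1 s / 2)).
    assert (He' : 0 < e').
    { apply Rmin_glb_lt; [lra|]. apply Rdiv_lt_0_compat; [|lra].
      repeat apply Rmult_lt_0_compat; trivial. }
    assert (e1 : e' <= X1 s / 2) by apply Rmin_l.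
    assert (e2 : e' <= e * X1 s * X1 s / 2) by apply Rmin_r.
    destruct (proj1 (is_deriveP _ _ _) HX e' He') as [d [Hd K]].
    destruct (Rbar_open_interval (proj1 Is) (proj2 Is)) as [d' [Hd' Hs]].
    set (q := Rmin d d' / 2).
    assert (Hq : 0 < q /\ q < d /\ q < d').
    { unfold q. pose proof (Rmin_l d d'). pose proof (Rmin_r d d').
      assert (0 < Rmin d d') by now apply Rmin_glb_lt. lra. }
    assert (I1 : I (s - q)) by (apply Hs; replace (s - q - s) with (- q) by ring;
      rewrite Rabs_Ropp, Rabs_pos_eq; lra).
    assert (I2 : I (s + q)) by (apply Hs; replace (s + q - s) with q by ring;
      rewrite Rabs_pos_eq; lra).
    assert (x1 : X (s - q) < X s) by (apply Xinc; trivial; lra).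
    assert (x2 : X s < X (s + q)) by (apply Xinc; trivial; lra).
    exists (Rmin e0 (Rmin (X s - X (s - q)) (X (s + q) - X s))).
    split; [repeat apply Rmin_glb_lt; lra|].
    intros u Hu. apply Rmin_Rgt_l in Hu. destruct Hu as [Hu0 Hu].
    apply Rmin_Rgt_l in Hu. destruct Hu as [Hu1 Hu2].
    destruct (Hin u Hu0) as [j1 j2]. destruct (Hinv u j1 j2) as [h1 h2].
    rewrite (invX s Is). set (t := inv u) in *.
    apply Rgt_lt, Rabs_def2 in Hu1. apply Rgt_lt, Rabs_def2 in Hu2.
    assert (t1 : s - q < t) by (apply Xinj; trivial; lra).
    assert (t2 : t < s + q) by (apply Xinj; trivial; lra).
    assert (Kt := K t ltac:(apply Rabs_def1; lra)). rewrite <- h2 in Kt.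
    set (D := t - s) in *. set (du := u - X s) in *.
    assert (L : X1 s / 2 * Rabs D <= Rabs du).
    { assert (A := Rabs_triang du (- (du - X1 s * D))).
      replace (du + - (du - X1 s * D)) with (X1 s * D) in A by ring.
      rewrite Rabs_Ropp, Rabs_mult, (Rabs_pos_eq (X1 s)) in A by lra.
      pose proof (Rabs_pos D). nra. }
    replace (D - / X1 s * du) with (- (du - X1 s * D) / X1 s) by (field; lra).
    unfold Rdiv. rewrite Rabs_mult, Rabs_Ropp, Rabs_inv, (Rabs_pos_eq (X1 s)) by lra.
    apply Rmult_le_reg_r with (X1 s); [exact Hp|].
    rewrite Rmult_assoc, Rinv_l, Rmult_1_r by lra.
    eapply Rle_trans; [exact Kt|].
    apply Rle_trans with (e * X1 s * X1 s / 2 * Rabs D).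
    - apply Rmult_le_compat_r; [apply Rabs_pos|exact e2].
    - replace (e * X1 s * X1 s / 2 * Rabs D) with (e * X1 s * (X1 s / 2 * Rabs D)) by field.
      replace (e * Rabs du * X1 s) with (e * X1 s * Rabs du) by ring.
      apply Rmult_le_compat_l; [|exact L]. apply Rmult_le_pos; lra. }
  set (h := fun u => Y (inv u)).
  assert (dh : forall s, I s -> is_derive h (X s) (Y1 s / X1 s)).
  { intros s Is. destruct (H s (proj1 Is) (proj2 Is)) as (_ & _ & HY & _ & Hp).
    unfold Rdiv. rewrite Rmult_comm.
    apply (is_derive_comp (V := R_NormedModule) Y inv (X s)); [|now apply dinv].
    now rewrite invX. }
  exists h, a', b'. split; [|split].
  - destruct (Rbar_interval_inhabited Hab) as [s Is].
    destruct (into s Is) as [h1 h2]. exact (Rbar_lt_trans _ _ _ h1 h2).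
  - intros u v. split.
    + intros (h1 & h2 & ->). destruct (Hinv u h1 h2) as [h3 h4]. exists (inv u). auto.
    + intros (s & Is & -> & ->). destruct (into s Is) as [h1 h2].
      split; [exact h1|]. split; [exact h2|]. unfold h. now rewrite invX.
  - intros s k1 k2. assert (Is : I s) by (now split). split; [now apply dh|].
    destruct (H s k1 k2) as (_ & HX1 & _ & HY1 & Hp).
    destruct (into s Is) as [i1 i2]. destruct (Rbar_open_interval i1 i2) as [e0 [He0 Hin]].
    apply (is_derive_ext_loc (fun u => Y1 (inv u) / X1 (inv u))).
    + exists (mkposreal e0 He0). intros u Hu. destruct (Hin u Hu) as [j1 j2].
      destruct (Hinv u j1 j2) as [h3 h4]. symmetry. rewrite h4 at 1.
      rewrite (is_derive_unique _ _ _ (dh _ h3)). reflexivity.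
    + eapply is_derive_eq.
      * apply (is_derive_comp (V := R_NormedModule) (fun s => Y1 s / X1 s) inv (X s));
          [|now apply dinv].
        rewrite invX by trivial. apply is_derive_div; [exact HY1|exact HX1|lra].
      * unfold scal. simpl. unfold mult. simpl. field. lra.
Qed.

(** The nonvanishing [X1] is continuous, so it has constant sign on the interval; if it is negative,
    the parameter is reversed. *)
Lemma graph_of_curve_exists (a b : Rbar) X Y X1 Y1 X2 Y2 :
  Rbar_lt a b ->
  (forall s : R, Rbar_lt a s -> Rbar_lt s b ->
     is_derive X s (X1 s) /\ is_derive X1 s (X2 s) /\
     is_derive Y s (Y1 s) /\ is_derive Y1 s (Y2 s) /\ X1 s <> 0) ->
  exists h a' b', graph_of_curve a b X Y X1 Y1 X2 Y2 h a' b'.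
Proof.
  intros Hab H. destruct (Rbar_interval_inhabited Hab) as [s0 [l0 r0]].
  assert (sign : forall s s' : R, Rbar_lt a s -> Rbar_lt s b -> Rbar_lt a s' -> Rbar_lt s' b ->
    X1 s < 0 -> 0 < X1 s' -> False).
  { intros s s' l r l' r' Hn Hp.
    assert (cont : forall t u z : R, Rbar_lt a t -> Rbar_lt u b -> t <= z <= u ->
      continuity_pt X1 z /\ X1 z <> 0).
    { intros t u z Ht Hu Hz. destruct (Rbar_interval_convex Ht Hu Hz) as [k1 k2].
      destruct (H z k1 k2) as (_ & HX1 & _ & _ & Hz0). split; [|exact Hz0].
      apply continuity_pt_filterlim. eapply is_derive_continuous. exact HX1. }
    destruct (Rtotal_order s s') as [L|[L|L]].
    - destruct (IVT_interv X1 s s') as (z & Hz & Ez); trivial.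
      + intros z Hz. now apply (cont s s').
      + now apply (cont s s' z).
    - subst. lra.
    - destruct (IVT_interv (fun z => - X1 z) s' s) as (z & Hz & Ez); try lra.
      + intros z Hz. apply continuity_pt_opp. now apply (cont s' s).
      + apply (cont s' s z); trivial. lra. }
  destruct (H s0 l0 r0) as (_ & _ & _ & _ & N0).
  destruct (Rdichotomy _ _ N0) as [Hneg|Hpos].
  - destruct (@graph_of_increasing_curve (Rbar_opp b) (Rbar_opp a)
      (fun s => X (- s)) (fun s => Y (- s)) (fun s => - X1 (- s)) (fun s => - Y1 (- s))
      (fun s => X2 (- s)) (fun s => Y2 (- s))) as (h & a' & b' & h1 & h2 & h3).
    + now apply Rbar_opp_lt in Hab.
    + intros s l r.
      assert (l' : Rbar_lt a (- s)).
      { apply Rbar_opp_lt. simpl. rewrite Ropp_involutive. exact r. }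
      assert (r' : Rbar_lt (- s) b).
      { apply Rbar_opp_lt. simpl. rewrite Ropp_involutive. exact l. }
      destruct (H (- s) l' r') as (HX & HX1 & HY & HY1 & Hz).
      assert (D : forall f f' : R -> R, is_derive f (- s) (f' (- s)) ->
        is_derive (fun s => f (- s)) s (- f' (- s))).
      { intros f f' Hf. replace (- f' (- s)) with ((-1) * f' (- s)) by ring.
        apply (is_derive_comp (V := R_NormedModule) f (fun s => - s) s); [exact Hf|].
        auto_derive; trivial. }
      assert (D' : forall f f' : R -> R, is_derive f (- s) (f' (- s)) ->
        is_derive (fun s => - f (- s)) s (f' (- s))).
      { intros f f' Hf. rewrite <- (Ropp_involutive (f' (- s))).
        apply (is_derive_opp (V := R_NormedModule) (fun s => f (- s))). now apply D. }
      split; [now apply D|]. split; [now apply D'|]. split; [now apply D|].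
      split; [now apply D'|].
      destruct (Rdichotomy _ _ Hz) as [L|L]; [lra|].
      exfalso. exact (sign s0 (- s) l0 r0 l' r' Hneg L).
    + exists h, a', b'. split; [exact h1|]. split.
      * intros u v. rewrite h2. split; intros (s & [l r] & -> & ->).
        -- exists (- s). split; [|now split]. split; apply Rbar_opp_lt; simpl;
             rewrite Ropp_involutive; trivial.
        -- exists (- s). rewrite Ropp_involutive. split; [|now split].
           split; apply Rbar_opp_lt; simpl; rewrite Ropp_involutive, Rbar_opp_involutive; trivial.
      * intros s l r. destruct (h3 (- s)) as [k1 k2].
        -- now apply Rbar_opp_lt in r.
        -- now apply Rbar_opp_lt in l.
        -- rewrite Ropp_involutive in k1, k2. destruct (H s l r) as (_ & _ & _ & _ & Hz).
           split.
           ++ replace (Y1 s / X1 s) with (- Y1 s / - X1 s) by (field; exact Hz). exact k1.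
           ++ replace ((Y2 s * X1 s - Y1 s * X2 s) / X1 s ^ 3)
                with ((Y2 s * - X1 s - - Y1 s * X2 s) / (- X1 s) ^ 3) by (field; exact Hz).
              exact k2.
  - apply graph_of_increasing_curve; trivial. intros s l r.
    destruct (H s l r) as (k1 & k2 & k3 & k4 & k5). repeat (split; trivial).
    destruct (Rdichotomy _ _ k5) as [L|L]; trivial.
    exfalso. exact (sign s s0 l r l0 r0 L Hpos).
Qed.

(** * The determining equations of the canonical form *)

Lemma box_constant u0 v0 r f :
  0 < r -> smooth2 (in_box u0 v0 r) f ->
  (forall u v, in_box u0 v0 r u v -> dx f u v = 0) ->
  (forall u v, in_box u0 v0 r u v -> dy f u v = 0) ->
  forall u v, in_box u0 v0 r u v -> f u v = f u0 v0.
Proof.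
  intros Hr sf Hx Hy u v H.
  assert (H0 : Rabs (u0 - u0) < r /\ Rabs (v0 - v0) < r) by (rewrite !Rminus_diag, Rabs_R0; lra).
  destruct (@MVT_is_derive (fun z => f z v) (fun z => dx f z v) u0 u) as (c & Hc & Ec).
  { intros z Hz. apply (is_dx sf). split; [|apply H].
    now apply (@between_interval u0 r u0 u z); [|apply H|]. }
  rewrite Hx in Ec.
  2:{ split; [|apply H]. now apply (@between_interval u0 r u0 u c); [|apply H|]. }
  destruct (@MVT_is_derive (fun z => f u0 z) (fun z => dy f u0 z) v0 v) as (d & Hd & Ed).
  { intros z Hz. apply (is_dy sf). split; [apply H0|].
    now apply (@between_interval v0 r v0 v z); [|apply H|]. }
  rewrite Hy in Ed; [lra|].
  split; [apply H0|]. now apply (@between_interval v0 r v0 v d); [|apply H|].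
Qed.

Lemma determining_equations_solution u0 v0 r xi eta beta :
  let O := in_box u0 v0 r in
  0 < r -> smooth2 O xi -> smooth2 O eta -> smooth2 O beta ->
  (forall u v, O u v -> dy beta u v = 0) ->
  (forall u v, O u v -> dy (dy xi) u v = 0) ->
  (forall u v, O u v -> dy (dy eta) u v = 2 * dx (dy xi) u v) ->
  (forall u v, O u v -> 2 * dx (dy eta) u v - dx (dx xi) u v
     = - (3 * (v * v / 2 + beta u v) * dy xi u v)) ->
  (forall u v, O u v -> dx (dx eta) u v
     - (v * v / 2 + beta u v) * (dy eta u v - 2 * dx xi u v) + v * eta u v
     + dx beta u v * xi u v = 0) ->
  exists k m, forall u v, O u v ->
    xi u v = k * u + m /\ eta u v = - (2 * k * v) /\
    4 * k * beta u v + (k * u + m) * dx beta u v = 0.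
Proof.
  intros O Hr sx se sb Hb e3 e2 e1 e0.
  assert (Ho : open2 O) by apply open2_box.
  assert (s1 : smooth2 O (fun _ v => v)) by now apply smooth2_snd.
  assert (s2 : smooth2 O (fun u _ => u)) by now apply smooth2_fst.
  assert (d11 : forall u v, dx (fun u _ => u) u v = 1).
  { intros. apply (is_derive_unique (fun u => u)), is_derive_var. }
  assert (d22 : forall u v, dy (fun _ v => v) u v = 1).
  { intros. apply (is_derive_unique (fun u => u)), is_derive_var. }
  assert (d21 : forall u v, dy (fun u _ => u) u v = 0) by (intros u v; exact (dy_const u u v)).
  assert (d12 : forall u v, dx (fun _ v => v) u v = 0) by (intros u v; exact (dx_const v u v)).
  assert (c1 : forall f, smooth2 O f -> forall u v, O u v -> dy (dx (dx f)) u v = dx (dx (dy f)) u v).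
  { intros f sf u v H. rewrite (dydx Ho (smooth2_dx sf) H).
    apply (dx_ext Ho); trivial. intros. now apply (dydx Ho). }
  assert (p1 : forall u v, O u v -> dx (dx (dy xi)) u v = - (v * dy xi u v)).
  { intros u v H. assert (D := dy_ext Ho e1 H). revert D. unfold Rdiv. dsimp Ho.
    rewrite c1, e3, Hb, d22 by trivial.
    rewrite (dydx Ho (smooth2_dy se) H), (dx_ext Ho e2 H). dsimp Ho. lra. }
  (* As the second v-derivative of [xi] is zero, one more v-derivative of [p1] leaves only [- xi_v],
     coming from the explicit factor [v]. *)
  assert (xi_v : forall u v, O u v -> dy xi u v = 0).
  { intros u v H. assert (D := dy_ext Ho p1 H). revert D. dsimp Ho.
    rewrite c1, e3, d22 by (trivial; now apply smooth2_dy).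
    assert (Z : forall u v, O u v -> dx (dy (dy xi)) u v = 0).
    { intros u' v' H'. rewrite (dx_ext Ho e3 H'). apply dx_const. }
    rewrite (dx_ext Ho Z H), dx_const. lra. }
  assert (xi_uv : forall u v, O u v -> dx (dy xi) u v = 0).
  { intros u v H. rewrite (dx_ext Ho xi_v H). apply dx_const. }
  assert (xi_vu : forall u v, O u v -> dy (dx xi) u v = 0).
  { intros u v H. rewrite (dydx Ho sx H). auto. }
  assert (eta_vv : forall u v, O u v -> dy (dy eta) u v = 0).
  { intros u v H. rewrite e2, xi_uv by trivial. ring. }
  assert (eta_uv : forall u v, O u v -> 2 * dx (dy eta) u v = dx (dx xi) u v).
  { intros u v H. assert (D := e1 u v H). rewrite xi_v in D by trivial. lra. }
  assert (p2 : forall u v, O u v -> dx (dx (dy eta)) u v + 2 * v * dx xi u v + eta u v = 0).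
  { intros u v H. assert (D := dy_ext Ho e0 H). revert D. unfold Rdiv. dsimp Ho.
    rewrite c1, Hb, d22, eta_vv, xi_vu, xi_v by trivial.
    rewrite (dydx Ho sb H), (dx_ext Ho Hb H), dx_const. lra. }
  assert (p3 : forall u v, O u v -> dy eta u v = - (2 * dx xi u v)).
  { intros u v H. assert (D := dy_ext Ho p2 H). revert D. dsimp Ho.
    rewrite c1 by (trivial; now apply smooth2_dy).
    assert (Z : forall u v, O u v -> dx (dy (dy eta)) u v = 0).
    { intros u' v' H'. rewrite (dx_ext Ho eta_vv H'). apply dx_const. }
    rewrite (dx_ext Ho Z H), dx_const, d22, xi_vu by trivial. lra. }
  (* The u-derivative of [p3] gives [eta_uv = - 2 xi_uu], while [e1] gives [2 eta_uv = xi_uu]; both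
     therefore vanish. *)
  assert (xi_uu : forall u v, O u v -> dx (dx xi) u v = 0).
  { intros u v H. assert (D := dx_ext Ho p3 H). revert D. dsimp Ho.
    assert (D' := eta_uv u v H). lra. }
  assert (eta_uv0 : forall u v, O u v -> dx (dy eta) u v = 0).
  { intros u v H. assert (D' := eta_uv u v H). rewrite xi_uu in D' by trivial. lra. }
  assert (p4 : forall u v, O u v -> eta u v = - (2 * v * dx xi u v)).
  { intros u v H. assert (D := p2 u v H).
    rewrite (dx_ext Ho eta_uv0 H), dx_const in D. lra. }
  set (k := dx xi u0 v0). set (m := xi u0 v0 - k * u0).
  assert (Hk : forall u v, O u v -> dx xi u v = k).
  { apply box_constant; trivial. now apply smooth2_dx. }
  assert (Hxi : forall u v, O u v -> xi u v = k * u + m).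
  { intros u v H.
    assert (Z : xi u v - k * u = xi u0 v0 - k * u0).
    { apply (@box_constant u0 v0 r (fun u v => xi u v - k * u)); trivial; fold O.
      - sm Ho.
      - intros u' v' H'. dsimp Ho. rewrite Hk, d11 by trivial. ring.
      - intros u' v' H'. dsimp Ho. rewrite xi_v, d21 by trivial. ring. }
    unfold m. lra. }
  assert (Heta : forall u v, O u v -> eta u v = - (2 * k * v)).
  { intros u v H. rewrite p4, Hk by trivial. ring. }
  exists k, m. intros u v H. split; [auto|]. split; [auto|].
  assert (D := e0 u v H).
  assert (Z : forall u v, O u v -> dx eta u v = 0).
  { intros u' v' H'. rewrite (dx_ext Ho Heta H'). dsimp Ho. rewrite d12. ring. }
  rewrite (dx_ext Ho Z H), dx_const, p3, Hk, Heta, Hxi in D by trivial. lra.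
Qed.

(** At most one value of [p] is excluded: the slope whose direction is vertical in the original
    coordinates. Shifting the argument moves it to 0, and the shifted cubic is tested at 1, -1, 2
    and -2. *)
Lemma cubic_vanishes m n c0 c1 c2 c3 :
  (m <> 0 \/ n <> 0) ->
  (forall p, m + p * n <> 0 -> c0 + c1 * p + c2 * p ^ 2 + c3 * p ^ 3 = 0) ->
  c0 = 0 /\ c1 = 0 /\ c2 = 0 /\ c3 = 0.
Proof.
  intros Hmn H.
  assert (G : exists z, forall t, t <> 0 ->
    c0 + c1 * (z + t) + c2 * (z + t) ^ 2 + c3 * (z + t) ^ 3 = 0).
  { destruct (Req_dec n 0) as [->|Hn].
    - exists 0. intros t _. apply H. lra.
    - exists (- m / n). intros t Ht. apply H.
      replace (m + (- m / n + t) * n) with (t * n) by (field; exact Hn).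
      now apply Rmult_integral_contrapositive_currified. }
  destruct G as [z G].
  set (e0 := c0 + c1 * z + c2 * z ^ 2 + c3 * z ^ 3).
  set (e1 := c1 + 2 * c2 * z + 3 * c3 * z ^ 2). set (e2 := c2 + 3 * c3 * z).
  assert (K : forall t, t <> 0 -> e0 + e1 * t + e2 * t ^ 2 + c3 * t ^ 3 = 0).
  { intros t Ht. rewrite <- (G t Ht). unfold e0, e1, e2. ring. }
  assert (K1 := K 1 ltac:(lra)). assert (K2 := K (-1) ltac:(lra)).
  assert (K3 := K 2 ltac:(lra)). assert (K4 := K (-2) ltac:(lra)).
  assert (Z3 : c3 = 0) by lra. assert (Z2 : e2 = 0) by lra.
  assert (Z1 : e1 = 0) by lra. assert (Z0 : e0 = 0) by lra.
  unfold e2 in Z2. rewrite Z3 in Z2. assert (Y2 : c2 = 0) by lra.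
  unfold e1 in Z1. rewrite Z3, Y2 in Z1. assert (Y1 : c1 = 0) by lra.
  unfold e0 in Z0. rewrite Z3, Y2, Y1 in Z0. repeat split; lra.
Qed.

(** * Differentiation with respect to the parameter of a flow *)

Lemma open3_preim2 O O' a b :
  open3 O -> open2 O' -> C3 0 O a -> C3 0 O b ->
  open3 (fun t x y => O t x y /\ O' (a t x y) (b t x y)).
Proof.
  intros Ho Ho' Ha Hb t x y [Hx Hx']. rewrite C3_0 in Ha, Hb.
  destruct (proj1 (open2P O') Ho' _ _ Hx') as [e [He H]].
  destruct (Ho t x y Hx) as [d0 [p0 H0]].
  destruct (proj1 (cont3P _ _ _ _) (Ha _ _ _ Hx) e He) as [d1 [p1 H1]].
  destruct (proj1 (cont3P _ _ _ _) (Hb _ _ _ Hx) e He) as [d2 [p2 H2]].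
  exists (Rmin d0 (Rmin d1 d2)). split; [repeat apply Rmin_glb_lt; trivial|].
  intros t' x' y' (k1 & k2 & k3).
  apply Rmin_Rgt_l in k1, k2, k3. destruct k1 as [a1 k1], k2 as [a2 k2], k3 as [a3 k3].
  apply Rmin_Rgt_l in k1, k2, k3. destruct k1, k2, k3.
  split; [apply H0|apply H; [apply H1|apply H2]]; repeat split; trivial.
Qed.

Lemma open2_slice O t : open3 O -> open2 (O t).
Proof.
  intros Ho. apply open2P. intros x y Hx. destruct (Ho t x y Hx) as [e [He H]].
  exists e. split; [exact He|]. intros x' y' h h'. apply H.
  split; [|now split]. rewrite Rminus_diag, Rabs_R0. exact He.
Qed.

Lemma smooth2_slice O f t : open3 O -> smooth3 O f -> smooth2 (O t) (f t).
Proof.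
  intros Ho Hf n. pose proof (@open2_slice O t Ho) as Hs.
  apply (@C3_comp n (fun _ => O t) O f (fun _ _ _ => t) (fun _ x _ => x) (fun _ _ y => y)); trivial.
  - now apply C3_const.
  - now apply C3_2.
  - now apply C3_3.
Qed.

Lemma is_derive_param O f t x y :
  smooth3 O f -> O t x y -> is_derive (fun t => f t x y) t (d1 f t x y).
Proof. intros sf Hx. exact (proj1 (proj1 (proj2 (C3_d (sf 1%nat))) _ _ _ Hx)). Qed.

Lemma is_derive_param_jet1 O f t x y :
  open3 O -> smooth3 O f -> O t x y -> forall x1 y1,
  is_derive (fun t => jet1 (f t) x y x1 y1) t (jet1 (d1 f t) x y x1 y1).
Proof.
  intros Ho sf Hx x1 y1. unfold jet1.
  assert (A := is_derive_param (smooth3_d2 sf) Hx). rewrite (schwarz12 Ho (sf 2%nat) Hx) in A.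
  assert (B := is_derive_param (smooth3_d3 sf) Hx). rewrite (schwarz13 Ho (sf 2%nat) Hx) in B.
  apply (is_derive_plus (V := R_NormedModule) (fun t => dx (f t) x y * x1)
    (fun t => dy (f t) x y * y1)).
  - exact (is_derive_scal_l (V := R_NormedModule) (fun t => d2 f t x y) t _ x1 A).
  - exact (is_derive_scal_l (V := R_NormedModule) (fun t => d3 f t x y) t _ y1 B).
Qed.

(** Symmetry of second derivatives, applied twice, moves the time derivative inside the second-order
    space derivatives. *)
Lemma is_derive_param_jet2 O f t x y :
  open3 O -> smooth3 O f -> O t x y -> forall x1 y1 x2 y2,
  is_derive (fun t => jet2 (f t) x y x1 y1 x2 y2) t (jet2 (d1 f t) x y x1 y1 x2 y2).
Proof.
  intros Ho sf Hx x1 y1 x2 y2. unfold jet2. pose proof (@open2_slice O t Ho) as Hs.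
  assert (A := is_derive_param (smooth3_d2 (smooth3_d2 sf)) Hx).
  rewrite (schwarz12 Ho (smooth3_d2 sf 2%nat) Hx) in A.
  assert (A' : d2 (d1 (d2 f)) t x y = d2 (d2 (d1 f)) t x y).
  { apply (dx_ext Hs (f := d1 (d2 f) t) (g := d2 (d1 f) t)); trivial.
    intros u v Hu. exact (schwarz12 Ho (sf 2%nat) Hu). }
  rewrite A' in A.
  assert (B := is_derive_param (smooth3_d2 (smooth3_d3 sf)) Hx).
  rewrite (schwarz12 Ho (smooth3_d3 sf 2%nat) Hx) in B.
  assert (B' : d2 (d1 (d3 f)) t x y = d2 (d3 (d1 f)) t x y).
  { apply (dx_ext Hs (f := d1 (d3 f) t) (g := d3 (d1 f) t)); trivial.
    intros u v Hu. exact (schwarz13 Ho (sf 2%nat) Hu). }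
  rewrite B' in B.
  assert (C := is_derive_param (smooth3_d3 (smooth3_d3 sf)) Hx).
  rewrite (schwarz13 Ho (smooth3_d3 sf 2%nat) Hx) in C.
  assert (C' : d3 (d1 (d3 f)) t x y = d3 (d3 (d1 f)) t x y).
  { apply (dy_ext Hs (f := d1 (d3 f) t) (g := d3 (d1 f) t)); trivial.
    intros u v Hu. exact (schwarz13 Ho (sf 2%nat) Hu). }
  rewrite C' in C.
  apply (is_derive_ext (fun t => ((x1 ^ 2 * d2 (d2 f) t x y + (2 * x1 * y1) * d2 (d3 f) t x y)
     + y1 ^ 2 * d3 (d3 f) t x y) + jet1 (f t) x y x2 y2)).
  { intros z. unfold dx, dy, d2, d3. simpl. ring. }
  eapply is_derive_eq.
  - apply (is_derive_plus (V := R_NormedModule)); [|exact (is_derive_param_jet1 Ho sf Hx x2 y2)].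
    apply (is_derive_plus (V := R_NormedModule)).
    + apply (is_derive_plus (V := R_NormedModule)).
      * apply (is_derive_scal (fun t => d2 (d2 f) t x y) t (x1 ^ 2)). exact A.
      * apply (is_derive_scal (fun t => d2 (d3 f) t x y) t (2 * x1 * y1)). exact B.
    + apply (is_derive_scal (fun t => d3 (d3 f) t x y) t (y1 ^ 2)). exact C.
  - unfold dx, dy, d2, d3, plus. simpl. ring.
Qed.

(** The relation [y = h (x)] is differentiated twice along the curve, and the equation is inserted
    for the second derivative of [h]. *)
Lemma solution_curve E h (a b : Rbar) (x y x1 y1 : R -> R) (s x2 y2 : R) :
  solution_on E h a b ->
  locally s (fun s => is_derive x s (x1 s) /\ is_derive y s (y1 s) /\
                      (Rbar_lt a (x s) /\ Rbar_lt (x s) b /\ y s = h (x s))) ->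
  is_derive x1 s x2 -> is_derive y1 s y2 -> x1 s <> 0 ->
  y2 * x1 s - y1 s * x2 - x1 s ^ 3 * ode_rhs E (x s) (y s) (y1 s / x1 s) = 0.
Proof.
  intros Hh Hl Hx1 Hy1 Hz.
  assert (D : locally s (fun s => y1 s = x1 s * Derive h (x s))).
  { apply locally_locally in Hl. apply (filter_imp _ _ (F := locally s)) with (2 := Hl).
    intros z Hz'. destruct (locally_singleton _ _ Hz') as (k1 & k2 & k3 & k4 & k5).
    destruct (Hh (x z) k3 k4) as (l1 & _ & _).
    apply Derive_correct in l1.
    rewrite <- (is_derive_unique _ _ _ k2).
    apply is_derive_unique. apply (is_derive_ext_loc (fun z => h (x z))).
    - apply (filter_imp _ _ (F := locally z)) with (2 := Hz'). intros t (_ & _ & _ & _ & Et).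
      now symmetry.
    - exact (is_derive_comp (V := R_NormedModule) h x z _ _ l1 k1). }
  destruct (locally_singleton _ _ Hl) as (k1 & k2 & k3 & k4 & k5).
  destruct (Hh (x s) k3 k4) as (l1 & l2 & l3).
  apply Derive_correct in l2. rewrite l3 in l2.
  assert (D2 : is_derive (fun s => x1 s * Derive h (x s)) s
    (x2 * Derive h (x s) + x1 s * (x1 s * ode_rhs E (x s) (h (x s)) (Derive h (x s))))).
  { apply (is_derive_mult x1 (fun s => Derive h (x s)) s); [exact Hx1| |apply Rmult_comm].
    exact (is_derive_comp (V := R_NormedModule) (Derive h) x s _ _ l2 k1). }
  assert (Y2 : y2 = x2 * Derive h (x s)
                    + x1 s * (x1 s * ode_rhs E (x s) (h (x s)) (Derive h (x s)))).
  { rewrite <- (is_derive_unique _ _ _ Hy1). apply is_derive_unique.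
    apply (is_derive_ext_loc (fun s => x1 s * Derive h (x s))); [|exact D2].
    apply (filter_imp _ _ (F := locally s)) with (2 := D). intros t Et. now symmetry. }
  rewrite (locally_singleton _ _ D), Y2, k5.
  replace (x1 s * Derive h (x s) / x1 s) with (Derive h (x s)) by (field; exact Hz). ring.
Qed.

(** Converse of [solution_curve]: every abscissa of the graph is some [X s], and there the
    derivatives recorded in [graph_of_curve] turn the parametric equation into the equation for
    [h]. *)
Lemma curve_solution E (a b : Rbar) X Y X1 Y1 X2 Y2 h (a' b' : Rbar) :
  graph_of_curve a b X Y X1 Y1 X2 Y2 h a' b' ->
  (forall s : R, Rbar_lt a s -> Rbar_lt s b -> X1 s <> 0 /\
     Y2 s * X1 s - Y1 s * X2 s - X1 s ^ 3 * ode_rhs E (X s) (Y s) (Y1 s / X1 s) = 0) ->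
  solution_on E h a' b'.
Proof.
  intros (_ & Hg & Hd) H x l r.
  destruct (proj1 (Hg x (h x))) as (s & [l' r'] & Ex & Ey); [now repeat split|].
  destruct (Hd s l' r') as [d1 d2]. destruct (H s l' r') as [Hz He].
  rewrite <- Ex in d1, d2.
  split; [eexists; exact d1|]. split; [eexists; exact d2|].
  rewrite (is_derive_unique _ _ _ d2), (is_derive_unique _ _ _ d1), Ey, Ex.
  apply Rmult_eq_reg_l with (X1 s ^ 3); [|now apply pow_nonzero].
  replace (X1 s ^ 3 * ((Y2 s * X1 s - Y1 s * X2 s) / X1 s ^ 3))
    with (Y2 s * X1 s - Y1 s * X2 s) by (field; exact Hz). lra.
Qed.

(** * The equation in canonical coordinates *)

Section Normal.
Variables (E : ode) (O : R -> R -> Prop) (U V l : R -> R -> R) (px py r s : R)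
  (X Y : R -> R -> R).
Hypothesis Ho : open2 O.
Hypothesis sU : smooth2 O U.
Hypothesis sV : smooth2 O V.
Hypothesis sl : smooth2 O l.
Hypothesis Hrect : forall x y, O x y -> rectifies E U V l x y.
Hypothesis Hinv : local_inverse O U V px py r s X Y.

Notation u0 := (U px py).
Notation v0 := (V px py).
Notation B := (in_box u0 v0 s).

Lemma box_O x y : in_box px py r x y -> O x y.
Proof. apply Hinv. Qed.

Lemma open_B : open2 B.
Proof. apply open2_box. Qed.

Lemma smooth_X : smooth2 B X.
Proof. apply Hinv. Qed.

Lemma smooth_Y : smooth2 B Y.
Proof. apply Hinv. Qed.

Lemma XY_box u v : B u v -> in_box px py r (X u v) (Y u v).
Proof. intros H. now apply Hinv. Qed.

Lemma XY_O u v : B u v -> O (X u v) (Y u v).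
Proof. intros H. now apply box_O, XY_box. Qed.

Lemma U_XY u v : B u v -> U (X u v) (Y u v) = u.
Proof. intros H. now apply Hinv. Qed.

Lemma V_XY u v : B u v -> V (X u v) (Y u v) = v.
Proof. intros H. now apply Hinv. Qed.

Lemma XY_UV x y : in_box px py r x y -> B (U x y) (V x y) ->
  X (U x y) (V x y) = x /\ Y (U x y) (V x y) = y.
Proof. intros H1 H2. now apply Hinv. Qed.

Lemma s_pos : 0 < s.
Proof. apply Hinv. Qed.

Lemma r_pos : 0 < r.
Proof. apply Hinv. Qed.

Lemma DXY u v : B u v ->
  dx U (X u v) (Y u v) * dx X u v + dy U (X u v) (Y u v) * dx Y u v = 1 /\
  dx U (X u v) (Y u v) * dy X u v + dy U (X u v) (Y u v) * dy Y u v = 0 /\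
  dx V (X u v) (Y u v) * dx X u v + dy V (X u v) (Y u v) * dx Y u v = 0 /\
  dx V (X u v) (Y u v) * dy X u v + dy V (X u v) (Y u v) * dy Y u v = 1.
Proof.
  intros H. pose proof open_B as HB. pose proof (XY_O H) as HO.
  assert (Cx : forall W, smooth2 O W -> dx (fun u v => W (X u v) (Y u v)) u v
    = dx W (X u v) (Y u v) * dx X u v + dy W (X u v) (Y u v) * dx Y u v).
  { intros W sW. apply is_derive_unique.
    exact (chain2 (a := fun u => X u v) (b := fun u => Y u v) Ho sW HO
      (is_dx smooth_X H) (is_dx smooth_Y H)). }
  assert (Cy : forall W, smooth2 O W -> dy (fun u v => W (X u v) (Y u v)) u v
    = dx W (X u v) (Y u v) * dy X u v + dy W (X u v) (Y u v) * dy Y u v).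
  { intros W sW. apply is_derive_unique.
    exact (chain2 (a := fun v => X u v) (b := fun v => Y u v) Ho sW HO
      (is_dy smooth_X H) (is_dy smooth_Y H)). }
  rewrite <- !Cx, <- !Cy by assumption.
  rewrite (dx_ext HB U_XY H), (dy_ext HB U_XY H), (dx_ext HB V_XY H), (dy_ext HB V_XY H).
  repeat split.
  - apply (is_derive_unique (fun u => u)), is_derive_var.
  - exact (dy_const u u v).
  - exact (dx_const v u v).
  - apply (is_derive_unique (fun u => u)), is_derive_var.
Qed.

Definition beta (u v : R) : R := l (X u v) (Y u v).

Lemma smooth_beta : smooth2 B beta.
Proof.
  exact (smooth2_comp open_B Ho sl smooth_X smooth_Y XY_O).
Qed.

(** The direction [d/dv] leaves [U] fixed and [dl] is proportional to [dU]; multiplying by the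
    nonzero Jacobian avoids dividing by a component of [dU], either of which may vanish. *)
Lemma dy_beta u v : B u v -> dy beta u v = 0.
Proof.
  intros H. pose proof (XY_O H) as HO. destruct (DXY H) as (_ & D2 & _ & _).
  destruct (Hrect HO) as (J & Hl & _).
  assert (E1 : dy beta u v = dx l (X u v) (Y u v) * dy X u v + dy l (X u v) (Y u v) * dy Y u v).
  { apply is_derive_unique.
    exact (chain2 (a := fun v => X u v) (b := fun v => Y u v) Ho sl HO
      (is_dy smooth_X H) (is_dy smooth_Y H)). }
  rewrite E1. apply Rmult_eq_reg_l with (2 := J). unfold jac. revert D2 Hl.
  generalize (dx U (X u v) (Y u v)) (dy U (X u v) (Y u v)) (dx V (X u v) (Y u v))
    (dy V (X u v) (Y u v)) (dx l (X u v) (Y u v)) (dy l (X u v) (Y u v)) (dy X u v) (dy Y u v).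
  intros Ux Uy Vx Vy lx ly Xv Yv D2 Hl.
  transitivity (Vy * (lx * (Ux * Xv) + (ly * Ux) * Yv) - Vx * ((lx * Uy) * Xv + ly * Uy * Yv));
    [ring|].
  rewrite Hl. replace (Ux * Xv) with (- Uy * Yv) by lra.
  transitivity (Yv * Vy * (ly * Ux - lx * Uy) - Vx * ly * (Ux * Xv + Uy * Yv)); [ring|].
  rewrite D2, Hl. ring.
Qed.

(** The coefficient of the canonical equation as a function of [u] alone, represented by the slice
    through the base point. *)
Definition beta1 (u : R) : R := beta u v0.

Lemma B_b u v : B u v -> B u v0.
Proof.
  intros [h _]. split; [exact h|]. rewrite Rminus_diag, Rabs_R0. exact s_pos.
Qed.

Lemma beta_b u v : B u v -> beta u v = beta1 u.
Proof.
  intros H. pose proof (B_b H) as H0.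
  destruct (@MVT_is_derive (fun v => beta u v) (fun v => dy beta u v) v0 v) as (c & Hc & Ec).
  - intros z Hz. apply (is_dy smooth_beta). split; [apply H|].
    now apply (@between_interval v0 s v0 v z); [apply H0|apply H|].
  - rewrite dy_beta in Ec; [unfold beta1; lra|]. split; [apply H|].
    now apply (@between_interval v0 s v0 v c); [apply H0|apply H|].
Qed.

Lemma b_derive u v : B u v -> is_derive beta1 u (dx beta u v).
Proof.
  intros H. apply (is_derive_ext_loc (fun u => beta u v)); [|apply (is_dx smooth_beta H)].
  apply (filter_imp (fun u => B u v)); [intros; now apply beta_b|].
  exact (open3_2 (t := 0) open_B H).
Qed.

Lemma l_b x y : in_box px py r x y -> B (U x y) (V x y) -> l x y = beta1 (U x y).
Proof.
  intros H1 H2. rewrite <- (beta_b H2). unfold beta.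
  destruct (XY_UV H1 H2) as [-> ->]. reflexivity.
Qed.

(* Integral curves of the canonical equation give solutions of [E]. *)
Lemma canonical_curve v w t :
  locally t (fun t => B t (v t) /\ is_derive v t (w t)) ->
  is_derive w t (- (v t ^ 2 / 2 + beta1 t)) ->
  let q := - (v t ^ 2 / 2 + beta1 t) in
  let x1 := jet1 X t (v t) 1 (w t) in let y1 := jet1 Y t (v t) 1 (w t) in
  let x2 := jet2 X t (v t) 1 (w t) 0 q in let y2 := jet2 Y t (v t) 1 (w t) 0 q in
  x1 <> 0 ->
  y2 * x1 - y1 * x2 - x1 ^ 3 * ode_rhs E (X t (v t)) (Y t (v t)) (y1 / x1) = 0.
Proof.
  intros Hl Hw q x1 y1 x2 y2 Hz.
  destruct (locally_singleton _ _ Hl) as [HB Hv]. pose proof (XY_O HB) as HO.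
  set (x := fun t => X t (v t)). set (y := fun t => Y t (v t)).
  set (fx := fun t => jet1 X t (v t) 1 (w t)). set (fy := fun t => jet1 Y t (v t) 1 (w t)).
  assert (D1 : locally t (fun t => B t (v t) /\ is_derive x t (fx t) /\ is_derive y t (fy t))).
  { apply (filter_imp _ _ (F := locally t)) with (2 := Hl). intros z [hB hv].
    split; [exact hB|]. split.
    - apply (@is_derive_jet1 B X (fun t => t) v (fun _ => 1) w z open_B smooth_X hB); trivial.
      apply is_derive_var.
    - apply (@is_derive_jet1 B Y (fun t => t) v (fun _ => 1) w z open_B smooth_Y hB); trivial.
      apply is_derive_var. }
  assert (X2 : is_derive fx t x2).
  { apply (@is_derive_jet2 B X (fun t => t) v (fun _ => 1) w t open_B smooth_X HB); trivial.
    - apply is_derive_var.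
    - apply is_derive_cst. }
  assert (Y2 : is_derive fy t y2).
  { apply (@is_derive_jet2 B Y (fun t => t) v (fun _ => 1) w t open_B smooth_Y HB); trivial.
    - apply is_derive_var.
    - apply is_derive_cst. }
  assert (jets : forall W g g2, smooth2 O W ->
    (forall z, B z (v z) -> W (x z) (y z) = g z) ->
    forall g1, (forall z, B z (v z) -> is_derive v z (w z) -> is_derive g z (g1 z)) ->
    is_derive g1 t g2 ->
    jet1 W (x t) (y t) x1 y1 = g1 t /\ jet2 W (x t) (y t) x1 y1 x2 y2 = g2).
  { intros W g g2 sW Eg g1 Hg1 Hg2.
    assert (L : locally t (fun z => jet1 W (x z) (y z) (fx z) (fy z) = g1 z)).
    { apply (filter_and _ _ D1) in Hl. apply locally_locally in Hl.
      apply (filter_imp _ _ (F := locally t)) with (2 := Hl).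
      intros z Hz'. destruct (locally_singleton _ _ Hz') as [(hB & h1 & h2) (_ & hv)].
      rewrite <- (is_derive_unique _ _ _ (Hg1 z hB hv)). symmetry. apply is_derive_unique.
      apply (is_derive_ext_loc (fun z => W (x z) (y z))).
      - apply (filter_imp _ _ (F := locally z)) with (2 := Hz'). intros z' [[hB' _] _].
        now apply Eg.
      - apply (@is_derive_jet1 O W x y fx fy z Ho sW); trivial. now apply XY_O. }
    split; [exact (locally_singleton _ _ L)|].
    rewrite <- (is_derive_unique _ _ _ Hg2). symmetry. apply is_derive_unique.
    apply (is_derive_ext_loc (fun z => jet1 W (x z) (y z) (fx z) (fy z))); [exact L|].
    destruct (locally_singleton _ _ D1) as (_ & h1 & h2).
    apply (@is_derive_jet2 O W x y fx fy t Ho sW); trivial. }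
  destruct (jets U (fun z => z) 0 sU (fun z h => U_XY h) (fun _ => 1)) as [ju1 ju2].
  { intros. apply is_derive_var. }
  { apply is_derive_cst. }
  destruct (jets V v q sV (fun z h => V_XY h) w) as [jv1 jv2]; trivial.
  destruct (Hrect HO) as (J & _ & _).
  assert (R := rectifies_jet y1 x2 y2 (Hrect HO) Hz).
  change (X t (v t)) with (x t) in R. change (Y t (v t)) with (y t) in R.
  rewrite ju1, ju2, jv1, jv2 in R.
  assert (EV : V (x t) (y t) = v t) by (now apply V_XY).
  assert (El : l (x t) (y t) = beta1 t) by (rewrite <- (beta_b HB); reflexivity).
  rewrite EV, El in R. unfold q in R.
  apply Rmult_eq_reg_l with (2 := J). rewrite Rmult_0_r.
  change (X t (v t)) with (x t). change (Y t (v t)) with (y t). rewrite <- R. field.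
Qed.

Lemma open_box_X py0 px0 e :
  open2 (fun u v => B u v /\ in_box px0 py0 e (X u v) (Y u v)).
Proof.
  apply (@open3_preim2 (fun _ => B) (in_box px0 py0 e) (fun _ => X) (fun _ => Y)).
  - apply open_B.
  - apply open2_box.
  - apply smooth_X.
  - apply smooth_Y.
Qed.

Definition along (W : vfield) (g : R -> R -> R) (x y : R) : R :=
  v1 W x y * dx g x y + v2 W x y * dy g x y.

(** * From a symmetry flow to the determining equations *)

Section Necessity.
Variables (W : vfield) (eps : R) (F1 F2 : R -> R -> R -> R).
Hypothesis Heps : 0 < eps.
Hypothesis HF : local_flow W px py eps F1 F2.
Hypothesis Hmaps : forall t, Rabs t < eps -> maps_solutions E px py eps (F1 t) (F2 t).

(** The domains are nested so that each composition makes sense: the flow is given on [Of]; [O1] is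
    its pullback by the inverse chart; on [O2] the image lies in the source box of the chart; on
    [O3] the canonical coordinates of the image lie in [B]. All are open, so small times are covered
    near each point at time 0. *)
Let Of t x y := Rabs t < eps /\ in_box px py eps x y.

Lemma open_Of : open3 Of.
Proof.
  intros t x y [h h']. destruct (proj1 (open2P _) (@open2_box px py eps) _ _ h') as [e [He H]].
  exists (Rmin e (eps - Rabs t)). split; [apply Rmin_glb_lt; lra|].
  intros t' x' y' (k1 & k2 & k3). apply Rmin_Rgt_l in k1, k2, k3.
  split; [|apply H; lra].
  replace t' with ((t' - t) + t) by ring. eapply Rle_lt_trans; [apply Rabs_triang|]. lra.
Qed.

Lemma smooth_F1 : smooth3 Of F1.
Proof. intros n t x y [h h']. apply (HF h h'). Qed.

Lemma smooth_F2 : smooth3 Of F2.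
Proof. intros n t x y [h h']. apply (HF h h'). Qed.

Let O1 t u v := Rabs t < eps /\ B u v /\ in_box px py eps (X u v) (Y u v).

Lemma open_O1 : open3 O1.
Proof.
  intros t u v [h h'].
  destruct (proj1 (open2P _) (@open_box_X py px eps) _ _ h') as [e [He H]].
  exists (Rmin e (eps - Rabs t)). split; [apply Rmin_glb_lt; lra|].
  intros t' x' y' (k1 & k2 & k3). apply Rmin_Rgt_l in k1, k2, k3.
  split; [|apply H; lra].
  replace t' with ((t' - t) + t) by ring. eapply Rle_lt_trans; [apply Rabs_triang|]. lra.
Qed.

Definition G1 (t u v : R) : R := F1 t (X u v) (Y u v).
Definition G2 (t u v : R) : R := F2 t (X u v) (Y u v).

Lemma smooth_lift_B g : smooth2 B g -> smooth3 O1 (fun _ => g).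
Proof. intros Hg n. apply (C3_sub (O' := fun _ => B)); [|apply Hg]. intros t u v h. apply h. Qed.

Lemma smooth_comp_F F : smooth3 Of F -> smooth3 O1 (fun t u v => F t (X u v) (Y u v)).
Proof.
  intros sF n.
  apply (@C3_comp n O1 Of F (fun t _ _ => t) (fun _ => X) (fun _ => Y) open_O1 open_Of (sF n)).
  - apply C3_1, open_O1.
  - apply (smooth_lift_B smooth_X).
  - apply (smooth_lift_B smooth_Y).
  - intros t u v (h1 & h2 & h3). now split.
Qed.

Let O2 t u v := O1 t u v /\ in_box px py r (G1 t u v) (G2 t u v).

Lemma open_O2 : open3 O2.
Proof.
  apply open3_preim2.
  - apply open_O1.
  - apply open2_box.
  - apply (smooth_comp_F smooth_F1).
  - apply (smooth_comp_F smooth_F2).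
Qed.

(** [(Uh, Vh)] is the flow of [W] written in canonical coordinates at both ends; [(G1, G2)] is so
    only at the source. *)
Definition Uh (t u v : R) : R := U (G1 t u v) (G2 t u v).
Definition Vh (t u v : R) : R := V (G1 t u v) (G2 t u v).

Lemma smooth_comp_G g : smooth2 O g -> smooth3 O2 (fun t u v => g (G1 t u v) (G2 t u v)).
Proof.
  intros sg. apply (@smooth3_comp2 O2 O g G1 G2 open_O2 Ho sg).
  - intros n. apply (C3_sub (O' := O1)); [intros t u v h; apply h|].
    apply (smooth_comp_F smooth_F1).
  - intros n. apply (C3_sub (O' := O1)); [intros t u v h; apply h|].
    apply (smooth_comp_F smooth_F2).
  - intros t u v [_ h]. now apply box_O.
Qed.

Let O3 t u v := O2 t u v /\ B (Uh t u v) (Vh t u v).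

Lemma open_O3 : open3 O3.
Proof.
  apply open3_preim2.
  - apply open_O2.
  - apply open_B.
  - apply (smooth_comp_G sU).
  - apply (smooth_comp_G sV).
Qed.

Lemma smooth_O3 g : smooth3 O1 g -> smooth3 O3 g.
Proof. intros H n. apply (C3_sub (O' := O1)); [|apply H]. intros t u v h. apply h. Qed.

Lemma smooth_Uh : smooth3 O3 Uh.
Proof. intros n. apply (C3_sub (O' := O2)); [|apply (smooth_comp_G sU)]. intros t u v h. apply h. Qed.

Lemma smooth_Vh : smooth3 O3 Vh.
Proof. intros n. apply (C3_sub (O' := O2)); [|apply (smooth_comp_G sV)]. intros t u v h. apply h. Qed.

Lemma zero_eps : Rabs 0 < eps.
Proof. rewrite Rabs_R0. exact Heps. Qed.

Lemma G_0 u v : B u v -> in_box px py eps (X u v) (Y u v) -> G1 0 u v = X u v /\ G2 0 u v = Y u v.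
Proof.
  intros h1 h2. destruct (HF zero_eps h2) as (_ & _ & k1 & k2 & _). now split.
Qed.

Lemma O3_0 u v : O3 0 u v <-> B u v /\ in_box px py eps (X u v) (Y u v).
Proof.
  split.
  - intros h. apply h.
  - intros [h1 h2]. destruct (G_0 h1 h2) as [k1 k2]. unfold O3, O2, O1, Uh, Vh.
    rewrite k1, k2, U_XY, V_XY by trivial.
    repeat split; trivial; try apply h1; try apply h2; try apply zero_eps;
      now apply XY_box.
Qed.

Lemma Uh_0 u v : O3 0 u v -> Uh 0 u v = u.
Proof.
  intros h. apply O3_0 in h. destruct h as [h1 h2]. destruct (G_0 h1 h2) as [k1 k2].
  unfold Uh. rewrite k1, k2. now apply U_XY.
Qed.

Lemma Vh_0 u v : O3 0 u v -> Vh 0 u v = v.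
Proof.
  intros h. apply O3_0 in h. destruct h as [h1 h2]. destruct (G_0 h1 h2) as [k1 k2].
  unfold Vh. rewrite k1, k2. now apply V_XY.
Qed.

Lemma d1_along u v g : smooth2 O g -> O3 0 u v ->
  d1 (fun t u v => g (G1 t u v) (G2 t u v)) 0 u v = along W g (X u v) (Y u v).
Proof.
  intros sg h. apply O3_0 in h. destruct h as [h1 h2]. destruct (G_0 h1 h2) as [k1 k2].
  destruct (HF zero_eps h2) as (_ & _ & l1 & l2 & l3 & l4). rewrite l1, l2 in l3, l4.
  unfold d1. apply is_derive_unique.
  assert (HO : O (G1 0 u v) (G2 0 u v)) by (rewrite k1, k2; now apply XY_O).
  assert (D := chain2 (a := fun t => G1 t u v) (b := fun t => G2 t u v) Ho sg HO l3 l4).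
  cbv beta in D. rewrite k1, k2 in D.
  replace (along W g (X u v) (Y u v)) with (dx g (X u v) (Y u v) * v1 W (X u v) (Y u v)
    + dy g (X u v) (Y u v) * v2 W (X u v) (Y u v)) by (unfold along; ring).
  exact D.
Qed.

Lemma slope_nonzero (gx gy jx jy : R) :
  jx <> 0 -> gx * 1 + gy * (jy / jx) = 0 -> gx * jx + gy * jy = 0.
Proof.
  intros Hj N. replace (gx * jx + gy * jy) with (jx * (gx * 1 + gy * (jy / jx)))
    by (field; exact Hj). rewrite N. ring.
Qed.

(* The image of the canonical integral curve through [(u, v)] with slope [p] under the
   flow at time [t] is again an integral curve. *)
Lemma flow_curve u v p : B u v -> in_box px py eps (X u v) (Y u v) ->
  jet1 X u v 1 p <> 0 ->
  let q := - (v ^ 2 / 2 + beta1 u) in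
  locally 0 (fun t => O3 t u v /\
    jet2 (Vh t) u v 1 p 0 q * jet1 (Uh t) u v 1 p - jet1 (Vh t) u v 1 p * jet2 (Uh t) u v 1 p 0 q
    + (Vh t u v ^ 2 / 2 + beta1 (Uh t u v)) * jet1 (Uh t) u v 1 p ^ 3 = 0).
Proof.
  intros h1 h2 Hz q.
  assert (H0 : O3 0 u v) by (now apply O3_0).
  assert (sG1 : smooth3 O3 G1) by exact (smooth_O3 (smooth_comp_F smooth_F1)).
  assert (sG2 : smooth3 O3 G2) by exact (smooth_O3 (smooth_comp_F smooth_F2)).
  pose proof open_O3 as HO3. pose proof open_B as HB.
  (* The image curve must not be vertical. At time 0 it is the curve itself, which is not vertical
     by hypothesis, and continuity extends this to small times. *)
  assert (Z0 : locally 0 (fun t => jet1 (G1 t) u v 1 p <> 0)).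
  { assert (C := is_derive_continuous (is_derive_param_jet1 HO3 sG1 H0 1 p)).
    assert (E0 : jet1 (G1 0) u v 1 p = jet1 X u v 1 p).
    { pose proof (@open2_slice O3 0 HO3) as HS.
      assert (Eg : forall u v, O3 0 u v -> G1 0 u v = X u v).
      { intros u' v' h. apply O3_0 in h. now apply G_0. }
      unfold jet1. rewrite (dx_ext HS Eg H0), (dy_ext HS Eg H0). reflexivity. }
    rewrite <- E0 in Hz. destruct (nonzero_open Hz) as [e [He Hn]].
    destruct (proj1 (continuousP _ _) C e He) as [d [Hd Hc]].
    exists (mkposreal d Hd). intros t Ht. apply Hn. apply Hc. exact Ht. }
  assert (L : locally 0 (fun t => O3 t u v)) by exact (open3_1 HO3 H0).
  apply (filter_imp _ _ (F := locally 0)) with (2 := filter_and _ _ L Z0).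
  clear L Z0. intros t [Ht Hzt]. split; [exact Ht|].
  assert (Hteps : Rabs t < eps) by apply Ht.
  assert (Hs : 0 < s - Rabs (u - u0)) by (destruct h1; lra).
  (* [maps_solutions] concerns genuine solutions, so the data [(u, v, p)] have to be realised by
     one. The radius is the distance from [u] to the ends of the interval on which [beta1] is
     controlled. *)
  destruct (@picard_quadratic beta1 u (s - Rabs (u - u0)) v p Hs) as (d & V0 & V1 & pd & i1 & i2 & HV).
  { intros z Hz'. apply (is_derive_continuous (l := dx beta z v0)). apply b_derive.
    split; [|rewrite Rminus_diag, Rabs_R0; exact s_pos].
    replace (z - u0) with ((z - u) + (u - u0)) by ring.
    eapply Rle_lt_trans; [apply Rabs_triang|]. lra. }
  set (V2 := fun z => - (V0 z ^ 2 / 2 + beta1 z)).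
  assert (Hc0 : forall z, Rabs (z - u) < d -> continuous V0 z /\ continuous V1 z).
  { intros z Hz'. destruct (HV z Hz'). split; eapply is_derive_continuous; eassumption. }
  assert (Hud : Rabs (u - u) < d) by (rewrite Rminus_diag, Rabs_R0; exact pd).
  destruct (Hc0 u Hud) as [cV0 cV1].
  assert (Lz : forall g, smooth2 (O3 t) g -> jet1 g u v 1 p <> 0 ->
     locally u (fun z => jet1 g z (V0 z) 1 (V1 z) <> 0)).
  { intros g sg Hg. pose proof (@open2_slice O3 t HO3) as HS.
    assert (C : continuous (fun z => jet1 g z (V0 z) 1 (V1 z)) u).
    { destruct (HV u Hud) as [k1 k2].
      apply (is_derive_continuous
        (@is_derive_jet2 (O3 t) g (fun z => z) V0 (fun _ => 1) V1 u HS sg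
          (eq_ind_r (fun a => O3 t u a) Ht i1) (is_derive_var u) k1 _ _
          (is_derive_cst 1 u) k2)). }
    assert (Hg' : jet1 g u (V0 u) 1 (V1 u) <> 0) by (rewrite i1, i2; exact Hg).
    destruct (nonzero_open Hg') as [e [He Hn]].
    destruct (proj1 (continuousP _ _) C e He) as [d' [Hd' Hc]].
    exists (mkposreal d' Hd'). intros z Hz'. apply Hn. apply Hc. exact Hz'. }
  assert (sXt : smooth2 (O3 t) X).
  { apply (smooth2_sub (O' := B)); [|apply smooth_X]. intros a c h. apply h. }
  assert (sYt : smooth2 (O3 t) Y).
  { apply (smooth2_sub (O' := B)); [|apply smooth_Y]. intros a c h. apply h. }
  assert (sGt1 : smooth2 (O3 t) (G1 t)) by (now apply smooth2_slice).
  assert (sGt2 : smooth2 (O3 t) (G2 t)) by (now apply smooth2_slice).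
  assert (sUt : smooth2 (O3 t) (Uh t)) by (apply smooth2_slice; [exact HO3|apply smooth_Uh]).
  assert (sVt : smooth2 (O3 t) (Vh t)) by (apply smooth2_slice; [exact HO3|apply smooth_Vh]).
  pose proof (@open2_slice O3 t HO3) as HS.
  assert (LO : locally u (fun z => O3 t z (V0 z))).
  { assert (Ht' : O3 t u (V0 u)) by (rewrite i1; exact Ht).
    destruct (proj1 (open2P _) HS _ _ Ht') as [e [He Ho']].
    destruct (proj1 (continuousP _ _) cV0 e He) as [d' [Hd' Hc]].
    exists (mkposreal (Rmin e d') (Rmin_glb_lt _ _ _ He Hd')). intros z Hz'.
    assert (Hz2 : Rabs (z - u) < Rmin e d') by exact Hz'.
    apply Rmin_Rgt_l in Hz2. destruct Hz2. apply Ho'; [assumption|]. now apply Hc. }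
  assert (Ld : locally u (fun z => Rabs (z - u) < d)).
  { exists (mkposreal d pd). intros z Hz'. exact Hz'. }
  destruct (filter_and _ _ (filter_and _ _ (Lz X sXt Hz) (Lz (G1 t) sGt1 Hzt))
    (filter_and _ _ LO Ld)) as [dl Hdl].
  assert (K : forall z, Rabs (z - u) < dl ->
    jet1 X z (V0 z) 1 (V1 z) <> 0 /\ jet1 (G1 t) z (V0 z) 1 (V1 z) <> 0 /\
    O3 t z (V0 z) /\ is_derive V0 z (V1 z) /\ is_derive V1 z (V2 z)).
  { intros z Hz'. destruct (Hdl z Hz') as [[k1 k2] [k3 k4]].
    destruct (HV z k4) as [k5 k6]. exact (conj k1 (conj k2 (conj k3 (conj k5 k6)))). }
  clear Lz LO Ld Hdl.
  set (x := fun z => X z (V0 z)). set (y := fun z => Y z (V0 z)).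
  set (J := fun (g : R -> R -> R) z => jet1 g z (V0 z) 1 (V1 z)).
  set (J2 := fun (g : R -> R -> R) z => jet2 g z (V0 z) 1 (V1 z) 0 (V2 z)).
  assert (DJ : forall g z, smooth2 (O3 t) g -> Rabs (z - u) < dl ->
    is_derive (fun z => g z (V0 z)) z (J g z) /\ is_derive (J g) z (J2 g z)).
  { intros g z sg Hz'. destruct (K z Hz') as (_ & _ & k3 & k4 & k5). split.
    - apply (@is_derive_jet1 (O3 t) g (fun z => z) V0 (fun _ => 1) V1 z HS sg k3); trivial.
      apply is_derive_var.
    - apply (@is_derive_jet2 (O3 t) g (fun z => z) V0 (fun _ => 1) V1 z HS sg k3); trivial.
      + apply is_derive_var.
      + apply is_derive_cst. }
  assert (Ldl : forall z, Rabs (z - u) < dl -> locally z (fun z => Rabs (z - u) < dl)).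
  { intros z Hz'. exists (mkposreal (dl - Rabs (z - u)) ltac:(lra)). intros z' Hz2.
    assert (Hz3 : Rabs (z' - z) < dl - Rabs (z - u)) by exact Hz2.
    replace (z' - u) with ((z' - z) + (z - u)) by ring.
    eapply Rle_lt_trans; [apply Rabs_triang|]. lra. }
  (* In the original coordinates the canonical solution is a curve without vertical tangent, hence
     the graph of a function [f], which solves [E] by [canonical_curve]. *)
  destruct (@graph_of_curve_exists (u - dl) (u + dl) x y (J X) (J Y) (J2 X) (J2 Y))
    as (f & a & c & Hgr).
  { simpl. pose proof (cond_pos dl). lra. }
  { simpl. intros z hz1 hz2. assert (Hz' : Rabs (z - u) < dl) by (apply Rabs_def1; lra).
    destruct (DJ X z sXt Hz'). destruct (DJ Y z sYt Hz'). repeat (split; trivial).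
    now apply K. }
  assert (Hsol : solution_on E f a c).
  { apply (curve_solution Hgr). simpl. intros z hz1 hz2.
    assert (Hz' : Rabs (z - u) < dl) by (apply Rabs_def1; lra).
    destruct (K z Hz') as (k1 & k2 & k3 & k4 & k5). split; [exact k1|].
    apply (@canonical_curve V0 V1 z); trivial.
    apply (filter_imp _ _ (F := locally z)) with (2 := Ldl z Hz'). intros z' Hz2.
    destruct (K z' Hz2) as (_ & _ & k3' & k4' & _). split; [apply k3'|exact k4']. }
  destruct Hgr as (Hac & Hgr & Hfd).
  assert (cur : forall xx yy, graph f a c xx yy ->
    exists z, Rabs (z - u) < dl /\ xx = x z /\ yy = y z).
  { intros xx yy h. apply Hgr in h. destruct h as (z & [hz1 hz2] & e1 & e2).
    exists z. split; [|now split]. simpl in hz1, hz2. apply Rabs_def1; lra. }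
  assert (ruc : forall z, Rabs (z - u) < dl -> graph f a c (x z) (y z)).
  { intros z hz. apply Hgr. exists z. apply Rabs_def2 in hz. simpl. repeat split; lra. }
  destruct (Hmaps Hteps Hac Hsol) as (h & a' & c' & Hac' & Hhs & Hhg).
  { intros xx yy hg. destruct (cur _ _ hg) as (z & hz & -> & ->). apply (K z hz). }
  (* In [maps_solutions] the abscissa ranges over [Rbar]; only finite values matter. *)
  { intros [xx| |] l' r'; [|destruct c; contradiction|destruct a; contradiction].
    change (Derive (fun z => F1 t z (f z)) xx <> 0). destruct (cur xx (f xx)) as (z & hz & e1 & e2);
      [exact (conj l' (conj r' eq_refl))|].
    assert (hz' := hz). apply Rabs_def2 in hz'.
    destruct (Hfd z ltac:(simpl; lra) ltac:(simpl; lra)) as [df _].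
    destruct (K z hz) as (k1 & k2 & k3 & k4 & k5).
    assert (HOf : Of t (x z) (y z)) by (split; [exact Hteps|apply k3]).
    assert (sFt : smooth2 (Of t) (F1 t)) by (apply smooth2_slice; [apply open_Of|apply smooth_F1]).
    pose proof (@open2_slice Of t open_Of) as HSf.
    subst xx.
    assert (HOf' : Of t (x z) (f (x z))) by (rewrite e2; exact HOf).
    assert (D1 := chain2 (a := fun w => w) (b := f) HSf sFt HOf'
      (is_derive_var (x z)) df).
    destruct (DJ X z sXt hz) as [dX _]. destruct (DJ Y z sYt hz) as [dY _].
    destruct (DJ (G1 t) z sGt1 hz) as [dG _].
    assert (D2 := chain2 (a := x) (b := y) HSf sFt HOf dX dY).
    assert (Eq : J (G1 t) z = dx (F1 t) (x z) (y z) * J X z + dy (F1 t) (x z) (y z) * J Y z).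
    { rewrite <- (is_derive_unique _ _ _ dG). exact (is_derive_unique _ _ _ D2). }
    intros N. apply k2. fold (J (G1 t) z).
    assert (N' := eq_trans (eq_sym (is_derive_unique _ _ _ D1)) N). rewrite e2 in N'.
    rewrite Eq. fold (J X z) in k1.
    exact (slope_nonzero k1 N'). }
  assert (Hu : Rabs (u - u) < dl) by (rewrite Rminus_diag, Rabs_R0; apply cond_pos).
  (* The image curve lies on the graph of the solution [h], so it satisfies [E] in parametric form;
     [rectifies_jet] at the image point then gives the canonical equation. *)
  assert (N1 := solution_curve (x := fun z => G1 t z (V0 z)) (y := fun z => G2 t z (V0 z))
    (x1 := J (G1 t)) (y1 := J (G2 t)) (s := u) (x2 := J2 (G1 t) u) (y2 := J2 (G2 t) u) Hhs).
  assert (N2 : J2 (G2 t) u * J (G1 t) u - J (G2 t) u * J2 (G1 t) u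
    - J (G1 t) u ^ 3 * ode_rhs E (G1 t u (V0 u)) (G2 t u (V0 u)) (J (G2 t) u / J (G1 t) u) = 0).
  { apply N1.
    - apply (filter_imp _ _ (F := locally u)) with (2 := Ldl u Hu). intros z hz.
      destruct (DJ (G1 t) z sGt1 hz) as [k1 _]. destruct (DJ (G2 t) z sGt2 hz) as [k2 _].
      split; [exact k1|]. split; [exact k2|].
      apply (proj2 (Hhg (G1 t z (V0 z)) (G2 t z (V0 z)))).
      exists (x z), (y z). split; [now apply ruc|]. now split.
    - now apply DJ.
    - now apply DJ.
    - apply (K u Hu). }
  clear N1.
  destruct (K u Hu) as (_ & k2 & k3 & _ & _).
  set (x' := G1 t u (V0 u)) in *. set (y' := G2 t u (V0 u)) in *.
  assert (Hb : in_box px py r x' y') by apply k3.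
  assert (HO' : O x' y') by (now apply box_O).
  (* Jets of [g] along the image curve are jets of the composite along the original one: both are
     derivatives of the same function of [z]. *)
  assert (jets : forall g, smooth2 O g -> smooth2 (O3 t) (fun u v => g (G1 t u v) (G2 t u v)) ->
    jet1 g x' y' (J (G1 t) u) (J (G2 t) u) = J (fun u v => g (G1 t u v) (G2 t u v)) u /\
    jet2 g x' y' (J (G1 t) u) (J (G2 t) u) (J2 (G1 t) u) (J2 (G2 t) u)
      = J2 (fun u v => g (G1 t u v) (G2 t u v)) u).
  { intros g sg sgt.
    assert (P : forall z, Rabs (z - u) < dl ->
      jet1 g (G1 t z (V0 z)) (G2 t z (V0 z)) (J (G1 t) z) (J (G2 t) z)
      = J (fun u v => g (G1 t u v) (G2 t u v)) z).
    { intros z hz. destruct (K z hz) as (_ & _ & k & _ & _).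
      destruct (DJ (G1 t) z sGt1 hz) as [l1 _]. destruct (DJ (G2 t) z sGt2 hz) as [l2 _].
      destruct (DJ _ z sgt hz) as [l3 _]. rewrite <- (is_derive_unique _ _ _ l3).
      symmetry. apply is_derive_unique.
      apply (@is_derive_jet1 O g (fun z => G1 t z (V0 z)) (fun z => G2 t z (V0 z)) (J (G1 t))
        (J (G2 t)) z Ho sg); trivial. apply box_O, k. }
    split; [now apply P|].
    destruct (DJ _ u sgt Hu) as [_ l4]. rewrite <- (is_derive_unique _ _ _ l4).
    symmetry. apply is_derive_unique.
    apply (is_derive_ext_loc
      (fun z => jet1 g (G1 t z (V0 z)) (G2 t z (V0 z)) (J (G1 t) z) (J (G2 t) z))).
    - apply (filter_imp _ _ (F := locally u)) with (2 := Ldl u Hu). intros z hz. now apply P.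
    - destruct (DJ (G1 t) u sGt1 Hu) as [l1 l2]. destruct (DJ (G2 t) u sGt2 Hu) as [l3 l5].
      apply (@is_derive_jet2 O g (fun z => G1 t z (V0 z)) (fun z => G2 t z (V0 z)) (J (G1 t))
        (J (G2 t)) u Ho sg); trivial. }
  destruct (jets U sU sUt) as [ju1 ju2]. destruct (jets V sV sVt) as [jv1 jv2].
  assert (Rj := rectifies_jet (J (G2 t) u) (J2 (G1 t) u) (J2 (G2 t) u) (Hrect HO') k2).
  fold (J (G1 t) u) in Rj. rewrite N2, Rmult_0_r, ju1, ju2, jv1, jv2 in Rj.
  assert (El : l x' y' = beta1 (U x' y')) by (apply l_b; [exact Hb|apply k3]).
  rewrite El in Rj. unfold J, J2, x', y', V2 in Rj. rewrite i1, i2 in Rj. exact Rj.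
Qed.

(** The time derivative at 0 of the identity in [flow_curve]. At time 0 the canonical flow is the
    identity, so the jets of [Uh] are 1 and 0 and those of [Vh] are [p] and [q]; the term with
    factor 3 comes from the cube of the first jet of [Uh]. *)
Lemma flow_equation u v p : B u v -> in_box px py eps (X u v) (Y u v) ->
  jet1 X u v 1 p <> 0 ->
  let q := - (v ^ 2 / 2 + beta1 u) in
  jet2 (d1 Vh 0) u v 1 p 0 q + q * jet1 (d1 Uh 0) u v 1 p - p * jet2 (d1 Uh 0) u v 1 p 0 q
  + (v * d1 Vh 0 u v + dx beta u v * d1 Uh 0 u v) - 3 * q * jet1 (d1 Uh 0) u v 1 p = 0.
Proof.
  intros h1 h2 Hz q. assert (H0 : O3 0 u v) by (now apply O3_0).
  pose proof open_O3 as HO3. pose proof (@open2_slice O3 0 HO3) as HS.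
  assert (L := flow_curve h1 h2 Hz).
  set (a1 := fun t => jet1 (Uh t) u v 1 p). set (a2 := fun t => jet2 (Uh t) u v 1 p 0 q).
  set (a3 := fun t => jet1 (Vh t) u v 1 p). set (a4 := fun t => jet2 (Vh t) u v 1 p 0 q).
  set (a5 := fun t => Vh t u v). set (a6 := fun t => Uh t u v).
  assert (D1 : is_derive a1 0 (jet1 (d1 Uh 0) u v 1 p))
    by exact (is_derive_param_jet1 HO3 smooth_Uh H0 1 p).
  assert (D2 : is_derive a2 0 (jet2 (d1 Uh 0) u v 1 p 0 q))
    by exact (is_derive_param_jet2 HO3 smooth_Uh H0 1 p 0 q).
  assert (D3 : is_derive a3 0 (jet1 (d1 Vh 0) u v 1 p))
    by exact (is_derive_param_jet1 HO3 smooth_Vh H0 1 p).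
  assert (D4 : is_derive a4 0 (jet2 (d1 Vh 0) u v 1 p 0 q))
    by exact (is_derive_param_jet2 HO3 smooth_Vh H0 1 p 0 q).
  assert (D5 : is_derive a5 0 (d1 Vh 0 u v)) by exact (is_derive_param smooth_Vh H0).
  assert (D6 : is_derive a6 0 (d1 Uh 0 u v)) by exact (is_derive_param smooth_Uh H0).
  assert (xu : forall u v, O3 0 u v -> dx (Uh 0) u v = 1).
  { intros u' v' h. rewrite (dx_ext HS Uh_0 h).
    apply (is_derive_unique (fun u => u)), is_derive_var. }
  assert (yu : forall u v, O3 0 u v -> dy (Uh 0) u v = 0).
  { intros u' v' h. rewrite (dy_ext HS Uh_0 h). exact (dy_const u' u' v'). }
  assert (xv : forall u v, O3 0 u v -> dx (Vh 0) u v = 0).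
  { intros u' v' h. rewrite (dx_ext HS Vh_0 h). exact (dx_const v' u' v'). }
  assert (yv : forall u v, O3 0 u v -> dy (Vh 0) u v = 1).
  { intros u' v' h. rewrite (dy_ext HS Vh_0 h).
    apply (is_derive_unique (fun u => u)), is_derive_var. }
  assert (z1 : a1 0 = 1) by (unfold a1, jet1; rewrite xu, yu by trivial; ring).
  assert (z3 : a3 0 = p) by (unfold a3, jet1; rewrite xv, yv by trivial; ring).
  assert (z2 : a2 0 = 0).
  { unfold a2, jet2, jet1. rewrite (dx_ext HS xu H0), (dx_ext HS yu H0), (dy_ext HS yu H0).
    rewrite xu, yu, !dx_const, !dy_const by trivial. ring. }
  assert (z4 : a4 0 = q).
  { unfold a4, jet2, jet1. rewrite (dx_ext HS xv H0), (dx_ext HS yv H0), (dy_ext HS yv H0).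
    rewrite xv, yv, !dx_const, !dy_const by trivial. ring. }
  assert (z5 : a5 0 = v) by (now apply Vh_0).
  assert (z6 : a6 0 = u) by (now apply Uh_0).
  assert (Db : is_derive beta1 (a6 0) (dx beta u v)) by (rewrite z6; now apply b_derive).
  assert (L' : locally 0 (fun t => 0 = a4 t * a1 t - a3 t * a2 t
    + (a5 t ^ 2 / 2 + beta1 (a6 t)) * a1 t ^ 3)).
  { apply (filter_imp _ _ (F := locally 0)) with (2 := L). intros t [_ Ht]. now symmetry. }
  assert (Z : is_derive (fun t => a4 t * a1 t - a3 t * a2 t
    + (a5 t ^ 2 / 2 + beta1 (a6 t)) * a1 t ^ 3) 0 0).
  { apply (is_derive_ext_loc (fun _ => 0)); [exact L'|].
    apply is_derive_cst. }
  refine (eq_trans _ (is_derive_unique _ _ _ Z)). symmetry. apply is_derive_unique.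
  clear Z L' L. auto_derive.
  - repeat split; eexists; eassumption.
  - change (fun x => a1 x) with a1. change (fun x => a2 x) with a2.
    change (fun x => a3 x) with a3. change (fun x => a4 x) with a4.
    change (fun x => a5 x) with a5. change (fun x => a6 x) with a6.
    change (fun x => beta1 x) with beta1.
    rewrite (is_derive_unique _ _ _ D1), (is_derive_unique _ _ _ D2),
      (is_derive_unique _ _ _ D3), (is_derive_unique _ _ _ D4), (is_derive_unique _ _ _ D5),
      (is_derive_unique _ _ _ D6), (is_derive_unique _ _ _ Db).
    rewrite z1, z2, z3, z4, z5, z6. unfold q. field.
Qed.

(** The linearized equation is a cubic polynomial in the slope [p], known to vanish whenever
    [X_u + p X_v] is nonzero. These two derivatives are not both zero, since the inverse chart has
    an invertible Jacobian, so all four coefficients vanish. *)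
Lemma flow_determining u v : O3 0 u v ->
  dy (dy (d1 Uh 0)) u v = 0 /\
  dy (dy (d1 Vh 0)) u v = 2 * dx (dy (d1 Uh 0)) u v /\
  2 * dx (dy (d1 Vh 0)) u v - dx (dx (d1 Uh 0)) u v
    = - (3 * (v * v / 2 + beta u v) * dy (d1 Uh 0) u v) /\
  dx (dx (d1 Vh 0)) u v
    - (v * v / 2 + beta u v) * (dy (d1 Vh 0) u v - 2 * dx (d1 Uh 0) u v) + v * d1 Vh 0 u v
    + dx beta u v * d1 Uh 0 u v = 0.
Proof.
  intros H. apply O3_0 in H. destruct H as [h1 h2].
  set (q := - (v ^ 2 / 2 + beta1 u)).
  destruct (@cubic_vanishes (dx X u v) (dy X u v)
    (dx (dx (d1 Vh 0)) u v + q * (dy (d1 Vh 0) u v - 2 * dx (d1 Uh 0) u v) + v * d1 Vh 0 u v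
      + dx beta u v * d1 Uh 0 u v)
    (2 * dx (dy (d1 Vh 0)) u v - dx (dx (d1 Uh 0)) u v - 3 * q * dy (d1 Uh 0) u v)
    (dy (dy (d1 Vh 0)) u v - 2 * dx (dy (d1 Uh 0)) u v)
    (- dy (dy (d1 Uh 0)) u v)) as (c0 & c1 & c2 & c3).
  - destruct (DXY h1) as (k1 & k2 & k3 & k4).
    destruct (Req_dec (dx X u v) 0) as [Ex|]; [|now left].
    destruct (Req_dec (dy X u v) 0) as [Ey|]; [|now right].
    exfalso. rewrite Ex in k1, k3. rewrite Ey in k2, k4.
    assert (Q : (dx U (X u v) (Y u v) * 0 + dy U (X u v) (Y u v) * dx Y u v)
      * (dx V (X u v) (Y u v) * 0 + dy V (X u v) (Y u v) * dy Y u v) = 1)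
      by (rewrite k1, k4; ring).
    assert (Q' : (dx U (X u v) (Y u v) * 0 + dy U (X u v) (Y u v) * dy Y u v)
      * (dx V (X u v) (Y u v) * 0 + dy V (X u v) (Y u v) * dx Y u v) = 0)
      by (rewrite k2; ring).
    lra.
  - intros p Hp. assert (Hz : jet1 X u v 1 p <> 0).
    { unfold jet1. intros Q. apply Hp. rewrite <- Q. ring. }
    refine (eq_trans _ (flow_equation h1 h2 Hz)). fold q. unfold jet2, jet1. ring.
  - assert (Eb := beta_b h1). unfold q in *. rewrite <- Eb in *.
    split; [lra|]. split; [lra|]. split; lra.
Qed.

(** The determining equations are solved on a canonical box. Reading the time derivatives of [Uh]
    and [Vh] at 0 as [W U] and [W V] brings the result back to germs at [(px, py)]. *)
Lemma flow_normal_form : exists k m,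
  locally_2d (fun x y => along W U x y = k * U x y + m /\ along W V x y = - (2 * k * V x y))
    px py /\
  locally u0 (fun u => 4 * k * beta1 u + (k * u + m) * Derive beta1 u = 0).
Proof.
  pose proof open_O3 as HO3. pose proof (@open2_slice O3 0 HO3) as HS.
  assert (cr : in_box px py r px py) by exact (in_box_center px py r_pos).
  assert (cB : B u0 v0) by exact (in_box_center u0 v0 s_pos).
  destruct (XY_UV cr cB) as [ex ey].
  assert (H0 : O3 0 u0 v0).
  { apply O3_0. split; [exact cB|]. rewrite ex, ey. now apply in_box_center. }
  destruct (proj1 (open2P _) HS _ _ H0) as [sg [Hsg Hin]].
  assert (sub : forall u v, in_box u0 v0 sg u v -> O3 0 u v).
  { intros u v [h1 h2]. now apply Hin. }
  assert (subB : forall u v, in_box u0 v0 sg u v -> B u v).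
  { intros u v h. apply sub, O3_0 in h. apply h. }
  destruct (@determining_equations_solution u0 v0 sg (d1 Uh 0) (d1 Vh 0) beta) as (k & m & Hkm);
    trivial.
  - apply (smooth2_sub (O' := O3 0)); [exact sub|]. apply smooth2_slice; [exact HO3|].
    apply smooth3_d1, smooth_Uh.
  - apply (smooth2_sub (O' := O3 0)); [exact sub|]. apply smooth2_slice; [exact HO3|].
    apply smooth3_d1, smooth_Vh.
  - apply (smooth2_sub (O' := B)); [exact subB|exact smooth_beta].
  - intros u v h. now apply dy_beta, subB.
  - intros u v h. exact (proj1 (flow_determining (sub _ _ h))).
  - intros u v h. exact (proj1 (proj2 (flow_determining (sub _ _ h)))).
  - intros u v h. exact (proj1 (proj2 (proj2 (flow_determining (sub _ _ h))))).
  - intros u v h. exact (proj2 (proj2 (proj2 (flow_determining (sub _ _ h))))).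
  - exists k, m. split.
    + assert (cO : O px py) by (now apply box_O).
      destruct (smooth2_box_near sU cO Ho Hsg) as (d1' & p1 & K1).
      destruct (smooth2_box_near sV cO Ho Hsg) as (d2' & p2 & K2).
      pose proof r_pos as pr.
      assert (Hd : 0 < Rmin r (Rmin d1' d2')) by (repeat apply Rmin_glb_lt; trivial).
      exists (mkposreal _ Hd). simpl. intros x y hx hy.
      apply Rmin_Rgt_l in hx, hy. destruct hx as [x1 hx], hy as [y1 hy].
      apply Rmin_Rgt_l in hx, hy. destruct hx as [x2 x3], hy as [y2 y3].
      assert (hb : in_box u0 v0 sg (U x y) (V x y)).
      { split; [now apply K1|now apply K2]. }
      destruct (XY_UV (conj x1 y1) (subB _ _ hb)) as [e1 e2].
      destruct (Hkm _ _ hb) as (k1 & k2 & _).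
      rewrite <- k1, <- k2. unfold Uh, Vh.
      rewrite (d1_along sU (sub _ _ hb)), (d1_along sV (sub _ _ hb)), e1, e2. now split.
    + exists (mkposreal sg Hsg). intros u hu.
      assert (hb : in_box u0 v0 sg u v0) by (split; [exact hu|rewrite Rminus_diag, Rabs_R0; exact Hsg]).
      destruct (Hkm _ _ hb) as (_ & _ & k3).
      rewrite (is_derive_unique _ _ _ (b_derive (subB _ _ hb))). exact k3.
Qed.
End Necessity.

Lemma symmetry_normal_form W : point_symmetry E px py W -> exists k m,
  locally_2d (fun x y => along W U x y = k * U x y + m /\ along W V x y = - (2 * k * V x y))
    px py /\
  locally u0 (fun u => 4 * k * beta1 u + (k * u + m) * Derive beta1 u = 0).
Proof.
  intros (_ & _ & eps & F1 & F2 & He & HF & Hm). exact (flow_normal_form He HF Hm).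
Qed.

(** A right inverse of a 2 by 2 matrix is a left inverse: the determinants multiply to 1, and
    Cramer's rule expresses the second matrix through the first. *)
Lemma left_right_inverse (a1 a2 a3 a4 b1 b2 b3 b4 : R) :
  a1 * b1 + a2 * b3 = 1 -> a1 * b2 + a2 * b4 = 0 ->
  a3 * b1 + a4 * b3 = 0 -> a3 * b2 + a4 * b4 = 1 ->
  b1 * a1 + b2 * a3 = 1 /\ b1 * a2 + b2 * a4 = 0 /\
  b3 * a1 + b4 * a3 = 0 /\ b3 * a2 + b4 * a4 = 1.
Proof.
  intros h1 h2 h3 h4.
  set (D := a1 * a4 - a2 * a3). set (D' := b1 * b4 - b2 * b3).
  assert (HD : D * D' = 1).
  { transitivity ((a1 * b1 + a2 * b3) * (a3 * b2 + a4 * b4)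
      - (a1 * b2 + a2 * b4) * (a3 * b1 + a4 * b3)); [unfold D, D'; ring|].
    rewrite h1, h2, h3, h4. ring. }
  assert (e1 : b1 = a4 * D').
  { transitivity (b1 * (a3 * b2 + a4 * b4) - b2 * (a3 * b1 + a4 * b3)); [rewrite h3, h4; ring|].
    unfold D'. ring. }
  assert (e2 : b2 = - a2 * D').
  { transitivity (b2 * (a1 * b1 + a2 * b3) - b1 * (a1 * b2 + a2 * b4)); [rewrite h1, h2; ring|].
    unfold D'. ring. }
  assert (e3 : b3 = - a3 * D').
  { transitivity (b3 * (a3 * b2 + a4 * b4) - b4 * (a3 * b1 + a4 * b3)); [rewrite h3, h4; ring|].
    unfold D'. ring. }
  assert (e4 : b4 = a1 * D').
  { transitivity (b4 * (a1 * b1 + a2 * b3) - b3 * (a1 * b2 + a2 * b4)); [rewrite h1, h2; ring|].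
    unfold D'. ring. }
  clearbody D'. subst b1 b2 b3 b4. unfold D in HD. repeat split; lra.
Qed.

(** * Explicit symmetry flows when [l] vanishes *)

Section Sufficiency.
Variables (W : vfield) (k m : R) (rho : R).
Hypothesis Hrho : 0 < rho.
Hypothesis Hl : forall x y, in_box px py rho x y -> l x y = 0.
Hypothesis HWU : forall x y, in_box px py rho x y -> along W U x y = k * U x y + m.
Hypothesis HWV : forall x y, in_box px py rho x y -> along W V x y = - (2 * k * V x y).

(** [Ef t] is the integral of [exp (k s)] from 0 to [t]. Characterising it by its properties treats
    [k = 0] together with the other values. *)
Variable Ef : R -> R.
Hypothesis Ef0 : Ef 0 = 0.
Hypothesis EfD : forall t, is_derive Ef t (exp (k * t)).
Hypothesis EfE : forall t, k * Ef t + 1 = exp (k * t).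

(** [(g1, g2)] is the flow of [(k u + m) d/du - 2 k v d/dv] started at the canonical coordinates of
    [(x, y)]; [(F1, F2)] is the same flow in the original coordinates. *)
Let g1 (t x y : R) : R := exp (k * t) * U x y + m * Ef t.
Let g2 (t x y : R) : R := exp (- (2 * k) * t) * V x y.
Let F1 (t x y : R) : R := X (g1 t x y) (g2 t x y).
Let F2 (t x y : R) : R := Y (g1 t x y) (g2 t x y).

Lemma smooth_Ef n A : open3 A -> C3 n A (fun t _ _ => Ef t).
Proof.
  intros HA.
  assert (H0 : C3 0 A (fun t _ _ => Ef t)).
  { apply C3_0. intros t x y _. apply cont3P. intros e He.
    destruct (proj1 (continuousP _ _) (is_derive_continuous (EfD t)) e He) as [d [Hd H]].
    exists d. split; [exact Hd|]. intros t' x' y' (h & _). now apply H. }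
  destruct n as [|n]; [exact H0|].
  apply (C3_intro (f1 := fun t _ _ => exp (k * t)) (f2 := fun _ _ _ => 0)
    (f3 := fun _ _ _ => 0)); trivial.
  - intros t x y _. split; [apply EfD|].
    split; apply is_derive_cst.
  - apply (C3_exp HA (f := fun t _ _ => k * t)).
    apply C3_mult; trivial; [now apply C3_const|now apply C3_1].
  - now apply C3_const.
  - now apply C3_const.
Qed.

Let A1 (t x y : R) : Prop := in_box px py r x y /\ B (U x y) (V x y).

Lemma open_A1 : open3 A1.
Proof.
  apply (@open3_preim2 (fun _ => in_box px py r) B (fun _ => U) (fun _ => V)).
  - apply open2_box.
  - apply open_B.
  - apply (C3_sub (O' := fun _ => O)); [|apply sU]. intros t x y. apply box_O.
  - apply (C3_sub (O' := fun _ => O)); [|apply sV]. intros t x y. apply box_O.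
Qed.

Lemma smooth_A1 g : smooth2 O g -> smooth3 A1 (fun _ => g).
Proof.
  intros sg n. apply (C3_sub (O' := fun _ => O)); [|apply sg]. intros t x y [h _]. now apply box_O.
Qed.

Lemma smooth_g1 : smooth3 A1 g1.
Proof.
  pose proof open_A1 as HA. intros n. unfold g1.
  apply C3_plus; [exact HA| |]; apply C3_mult; trivial.
  - apply (C3_exp HA (f := fun t _ _ => k * t)).
    apply C3_mult; trivial; [now apply C3_const|now apply C3_1].
  - apply (smooth_A1 sU).
  - now apply C3_const.
  - now apply smooth_Ef.
Qed.

Lemma smooth_g2 : smooth3 A1 g2.
Proof.
  pose proof open_A1 as HA. intros n. unfold g2. apply C3_mult; trivial.
  - apply (C3_exp HA (f := fun t _ _ => - (2 * k) * t)).
    apply C3_mult; trivial; [now apply C3_const|now apply C3_1].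
  - apply (smooth_A1 sV).
Qed.

Let A2 (t x y : R) : Prop := A1 t x y /\ B (g1 t x y) (g2 t x y).

Lemma open_A2 : open3 A2.
Proof.
  apply open3_preim2; [apply open_A1|apply open_B|apply smooth_g1|apply smooth_g2].
Qed.

Lemma smooth_comp_g h : smooth2 B h -> smooth3 A2 (fun t x y => h (g1 t x y) (g2 t x y)).
Proof.
  intros sh. apply (@smooth3_comp2 A2 B h g1 g2 open_A2 open_B sh).
  - intros n. apply (C3_sub (O' := A1)); [|apply smooth_g1]. intros t x y hh. apply hh.
  - intros n. apply (C3_sub (O' := A1)); [|apply smooth_g2]. intros t x y hh. apply hh.
  - intros t x y [_ hh]. exact hh.
Qed.

Let A3 (t x y : R) : Prop := A2 t x y /\ in_box px py rho (F1 t x y) (F2 t x y).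

Lemma open_A3 : open3 A3.
Proof.
  apply open3_preim2.
  - apply open_A2.
  - apply open2_box.
  - apply (smooth_comp_g smooth_X).
  - apply (smooth_comp_g smooth_Y).
Qed.

Lemma g1_0 x y : g1 0 x y = U x y.
Proof. unfold g1. rewrite Rmult_0_r, exp_0, Ef0. ring. Qed.

Lemma g2_0 x y : g2 0 x y = V x y.
Proof. unfold g2. rewrite Rmult_0_r, exp_0. ring. Qed.

Lemma A3_center : A3 0 px py.
Proof.
  assert (cr : in_box px py r px py) by exact (in_box_center px py r_pos).
  assert (cB : B u0 v0) by exact (in_box_center u0 v0 s_pos).
  destruct (XY_UV cr cB) as [ex ey].
  unfold A3, A2, A1, F1, F2. rewrite g1_0, g2_0, ex, ey.
  split; [split; [split|]|]; trivial. now apply in_box_center.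
Qed.

(** The canonical velocity of the flow is [(W U, W V)], that is, the Jacobian of [(U, V)] applied to
    [W]; the Jacobian of [(X, Y)], its inverse, sends it back to [W]. *)
Lemma is_derive_F t x y : A3 t x y ->
  is_derive (fun t => F1 t x y) t (v1 W (F1 t x y) (F2 t x y)) /\
  is_derive (fun t => F2 t x y) t (v2 W (F1 t x y) (F2 t x y)).
Proof.
  intros [[_ hB] hr].
  assert (D1 : is_derive (fun t => g1 t x y) t (k * g1 t x y + m)).
  { unfold g1. assert (De := EfD t). auto_derive.
    - eexists. exact De.
    - change (fun x => Ef x) with Ef. rewrite (is_derive_unique _ _ _ De).
      replace (k * (exp (k * t) * U x y + m * Ef t) + m)
        with (k * exp (k * t) * U x y + m * (k * Ef t + 1)) by ring.
      rewrite EfE. ring. }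
  assert (D2 : is_derive (fun t => g2 t x y) t (- (2 * k * g2 t x y))).
  { unfold g2. auto_derive; trivial. ring. }
  destruct (DXY hB) as (k1 & k2 & k3 & k4).
  assert (EU := U_XY hB). assert (EV := V_XY hB).
  assert (WU := HWU hr). assert (WV := HWV hr). unfold along, F1, F2 in WU, WV.
  rewrite EU in WU. rewrite EV in WV.
  assert (E1 := chain2 (a := fun t => g1 t x y) (b := fun t => g2 t x y) open_B smooth_X hB D1 D2).
  assert (E2 := chain2 (a := fun t => g1 t x y) (b := fun t => g2 t x y) open_B smooth_Y hB D1 D2).
  cbv beta in E1, E2. revert E1 E2. rewrite <- WU, <- WV.
  revert k1 k2 k3 k4. unfold F1, F2. fold (F1 t x y) (F2 t x y).
  set (ux := dx U _ _). set (uy := dy U _ _). set (vx := dx V _ _). set (vy := dy V _ _).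
  set (xu := dx X _ _). set (xv := dy X _ _). set (yu := dx Y _ _). set (yv := dy Y _ _).
  set (w1 := v1 W _ _). set (w2 := v2 W _ _).
  intros k1 k2 k3 k4 E1 E2.
  destruct (@left_right_inverse ux uy vx vy xu xv yu yv k1 k2 k3 k4) as (j1 & j2 & j3 & j4).
  split.
  - replace w1 with (xu * (w1 * ux + w2 * uy) + xv * (w1 * vx + w2 * vy)); [exact E1|].
    transitivity (w1 * (xu * ux + xv * vx) + w2 * (xu * uy + xv * vy)); [ring|].
    rewrite j1, j2. ring.
  - replace w2 with (yu * (w1 * ux + w2 * uy) + yv * (w1 * vx + w2 * vy)); [exact E2|].
    transitivity (w1 * (yu * ux + yv * vx) + w2 * (yu * uy + yv * vy)); [ring|].
    rewrite j3, j4. ring.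
Qed.

(** In canonical coordinates the map multiplies [u] by [exp (k t)], up to a translation, and [v] by
    [exp (- 2 k t)]. Both [v''] and [v^2] are then multiplied by [exp (- 4 k t)], so
    [v'' = - v^2 / 2] is preserved; [rectifies_jet] transports this to [E]. *)
Lemma scaling_maps_solutions eps t :
  (forall x y, in_box px py eps x y -> A3 t x y) ->
  (forall x y, in_box px py eps x y -> in_box px py rho x y) ->
  maps_solutions E px py eps (F1 t) (F2 t).
Proof.
  intros HA Hr f a c Hac Hf Hg HD.
  pose proof (@open2_slice A3 t open_A3) as HS.
  assert (sF1 : smooth2 (A3 t) (F1 t)).
  { apply smooth2_slice; [apply open_A3|]. intros n. apply (C3_sub (O' := A2)).
    - intros t' x y h. apply h.
    - apply (smooth_comp_g smooth_X). }
  assert (sF2 : smooth2 (A3 t) (F2 t)).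
  { apply smooth2_slice; [apply open_A3|]. intros n. apply (C3_sub (O' := A2)).
    - intros t' x y h. apply h.
    - apply (smooth_comp_g smooth_Y). }
  set (J := fun (g : R -> R -> R) z => jet1 g z (f z) 1 (Derive f z)).
  set (J2 := fun (g : R -> R -> R) z => jet2 g z (f z) 1 (Derive f z) 0 (Derive (Derive f) z)).
  assert (Hbox : forall z : R, Rbar_lt a z -> Rbar_lt z c -> in_box px py eps z (f z)).
  { intros z l' r'. apply Hg. exact (conj l' (conj r' eq_refl)). }
  assert (DJ : forall A g (z : R), open2 A -> smooth2 A g -> A z (f z) ->
    Rbar_lt a z -> Rbar_lt z c ->
    is_derive (fun z => g z (f z)) z (J g z) /\ is_derive (J g) z (J2 g z)).
  { intros A g z HA' sg hz l' r'. destruct (Hf z l' r') as (f1 & f2 & _).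
    apply Derive_correct in f1, f2. split.
    - apply (@is_derive_jet1 A g (fun z => z) f (fun _ => 1) (Derive f) z HA' sg hz); trivial.
      apply is_derive_var.
    - apply (@is_derive_jet2 A g (fun z => z) f (fun _ => 1) (Derive f) z HA' sg hz); trivial.
      + apply is_derive_var.
      + apply is_derive_cst. }
  assert (nz : forall z : R, Rbar_lt a z -> Rbar_lt z c -> J (F1 t) z <> 0).
  { intros z l' r'. destruct (DJ (A3 t) (F1 t) z HS sF1 (HA _ _ (Hbox z l' r')) l' r') as [d _].
    rewrite <- (is_derive_unique _ _ _ d). exact (HD z l' r'). }
  destruct (@graph_of_curve_exists a c (fun z => F1 t z (f z)) (fun z => F2 t z (f z))
    (J (F1 t)) (J (F2 t)) (J2 (F1 t)) (J2 (F2 t)) Hac) as (h & a' & c' & Hgr).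
  { intros z l' r'. pose proof (HA _ _ (Hbox z l' r')) as hz.
    destruct (DJ (A3 t) (F1 t) z HS sF1 hz l' r') as [d1 d2].
    destruct (DJ (A3 t) (F2 t) z HS sF2 hz l' r') as [d3 d4].
    exact (conj d1 (conj d2 (conj d3 (conj d4 (nz z l' r'))))). }
  exists h, a', c'. split; [apply Hgr|]. split.
  - apply (curve_solution Hgr). intros z l' r'. split; [now apply nz|].
    pose proof (HA _ _ (Hbox z l' r')) as hz.
    assert (hO : O z (f z)) by (apply box_O; apply hz).
    assert (hB : B (g1 t z (f z)) (g2 t z (f z))) by apply hz.
    assert (hO' : O (F1 t z (f z)) (F2 t z (f z))) by exact (XY_O hB).
    destruct (Rbar_open_interval l' r') as [e [He Hin]].
    assert (jets : forall g c0 c1 gg, smooth2 O g -> smooth2 O gg ->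
      (forall x y, A3 t x y -> g (F1 t x y) (F2 t x y) = c1 * gg x y + c0) ->
      jet1 g (F1 t z (f z)) (F2 t z (f z)) (J (F1 t) z) (J (F2 t) z) = c1 * J gg z /\
      jet2 g (F1 t z (f z)) (F2 t z (f z)) (J (F1 t) z) (J (F2 t) z) (J2 (F1 t) z) (J2 (F2 t) z)
        = c1 * J2 gg z).
    { intros g c0 c1 gg sg sgg Hgg.
      (* The identity of first jets is needed on the whole interval, because the identity of second
         jets is its derivative. *)
      assert (P : forall z : R, Rbar_lt a z -> Rbar_lt z c ->
        jet1 g (F1 t z (f z)) (F2 t z (f z)) (J (F1 t) z) (J (F2 t) z) = c1 * J gg z).
      { clear z l' r' hz hO hB hO' He Hin. intros z l' r'.
        pose proof (HA _ _ (Hbox z l' r')) as hz.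
        assert (hO : O z (f z)) by (apply box_O; apply hz).
        assert (hB : B (g1 t z (f z)) (g2 t z (f z))) by apply hz.
        assert (hO' : O (F1 t z (f z)) (F2 t z (f z))) by exact (XY_O hB).
        destruct (Rbar_open_interval l' r') as [e' [He' Hin']].
        destruct (DJ (A3 t) (F1 t) z HS sF1 hz l' r') as [d1 _].
        destruct (DJ (A3 t) (F2 t) z HS sF2 hz l' r') as [d3 _].
        destruct (DJ O gg z Ho sgg hO l' r') as [d5 _].
        assert (Q1 := @is_derive_jet1 O g (fun z => F1 t z (f z)) (fun z => F2 t z (f z))
          (J (F1 t)) (J (F2 t)) z Ho sg hO' d1 d3).
        rewrite <- (is_derive_unique _ _ _ Q1). apply is_derive_unique.
        apply (is_derive_ext_loc (fun z => c1 * gg z (f z) + c0)).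
        - exists (mkposreal e' He'). intros z' hz'. destruct (Hin' z' hz') as [n1 n2].
          symmetry. apply Hgg. apply HA. now apply Hbox.
        - rewrite <- (Rplus_0_r (c1 * J gg z)).
          apply (is_derive_plus (V := R_NormedModule) (fun z => c1 * gg z (f z)) (fun _ => c0)).
          + exact (is_derive_scal (fun z => gg z (f z)) z c1 _ d5).
          + apply is_derive_cst. }
      split; [now apply P|].
      destruct (DJ (A3 t) (F1 t) z HS sF1 hz l' r') as [d1 d2].
      destruct (DJ (A3 t) (F2 t) z HS sF2 hz l' r') as [d3 d4].
      destruct (DJ O gg z Ho sgg hO l' r') as [_ d6].
      assert (Q2 := @is_derive_jet2 O g (fun z => F1 t z (f z)) (fun z => F2 t z (f z))
          (J (F1 t)) (J (F2 t)) z Ho sg hO' d1 d3 _ _ d2 d4).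
      rewrite <- (is_derive_unique _ _ _ Q2). apply is_derive_unique.
      apply (is_derive_ext_loc (fun z => c1 * J gg z)).
      - exists (mkposreal e He). intros z' hz'. destruct (Hin z' hz') as [n1 n2].
        symmetry. now apply P.
      - exact (is_derive_scal (J gg) z c1 _ d6). }
    destruct (jets U (m * Ef t) (exp (k * t)) U sU sU) as [ju1 ju2].
    { intros x y h0. assert (hq : B (g1 t x y) (g2 t x y)) by apply h0. exact (U_XY hq). }
    destruct (jets V 0 (exp (- (2 * k) * t)) V sV sV) as [jv1 jv2].
    { intros x y h0. assert (hq : B (g1 t x y) (g2 t x y)) by apply h0.
      rewrite Rplus_0_r. exact (V_XY hq). }
    destruct (Hrect hO') as (Jn & _ & _).
    assert (Rj := rectifies_jet (J (F2 t) z) (J2 (F1 t) z) (J2 (F2 t) z) (Hrect hO') (nz z l' r')).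
    rewrite ju1, ju2, jv1, jv2 in Rj.
    assert (l1 : l (F1 t z (f z)) (F2 t z (f z)) = 0) by (apply Hl; apply hz).
    assert (l2 : l z (f z) = 0) by (apply Hl; now apply Hr, Hbox).
    assert (Rs := rectifies_jet (Derive f z) 0 (Derive (Derive f) z) (Hrect hO) R1_neq_R0).
    fold (J U z) (J V z) (J2 U z) (J2 V z) in Rs.
    destruct (Hf z l' r') as (_ & _ & f3). rewrite f3, Rdiv_1_r in Rs.
    rewrite l1 in Rj. rewrite l2 in Rs.
    assert (EV : V (F1 t z (f z)) (F2 t z (f z)) = exp (- (2 * k) * t) * V z (f z)).
    { unfold F1, F2. rewrite V_XY by exact hB. reflexivity. }
    rewrite EV in Rj.
    apply Rmult_eq_reg_l with (2 := Jn). rewrite <- Rj, Rmult_0_r.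
    assert (Ee : exp (- (2 * k) * t) * (exp (k * t) * exp (k * t)) = 1).
    { rewrite <- !exp_plus, <- exp_0. f_equal. ring. }
    revert Rs Ee. generalize (exp (- (2 * k) * t)) (exp (k * t)). intros w ee Rs Ee.
    (* The parametric equation is homogeneous of weight [w * ee] up to the relation [w * ee^2 = 1],
       which accounts for the second summand. *)
    transitivity (w * ee * (J2 V z * J U z - J V z * J2 U z + V z (f z) ^ 2 / 2 * J U z ^ 3)
      + (w * (ee * ee) - 1) * (w * ee * (V z (f z) ^ 2 / 2) * J U z ^ 3)); [field|].
    rewrite Ee. rewrite Rplus_0_r in Rs. rewrite Rs. ring.
  - intros u v. rewrite (proj1 (proj2 Hgr) u v). split.
    + intros (z & [l' r'] & -> & ->). exists z, (f z).
      split; [exact (conj l' (conj r' eq_refl))|]. now split.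
    + intros (x & y & (l' & r' & ->) & -> & ->). exists x. now repeat split.
Qed.

Lemma scaling_symmetry :
  smooth_near (v1 W) px py -> smooth_near (v2 W) px py -> point_symmetry E px py W.
Proof.
  intros s1 s2. split; [exact s1|]. split; [exact s2|].
  destruct (open_A3 A3_center) as [e0 [He0 H0]].
  set (e := Rmin e0 rho).
  assert (He : 0 < e) by (now apply Rmin_glb_lt).
  assert (HA : forall t x y, Rabs t < e -> in_box px py e x y -> A3 t x y).
  { intros t x y ht [hx hy]. pose proof (Rmin_l e0 rho) as Hm. fold e in Hm.
    apply H0. split; [rewrite Rminus_0_r; lra|split; lra]. }
  exists e, F1, F2. split; [exact He|]. split.
  - intros t x y ht hx. pose proof (HA t x y ht hx) as h.
    assert (h2 : A2 t x y) by apply h.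
    split; [|split; [|split; [|split]]].
    + intros n. exact (smooth_comp_g smooth_X n h2).
    + intros n. exact (smooth_comp_g smooth_Y n h2).
    + unfold F1. rewrite g1_0, g2_0. apply XY_UV; apply h2.
    + unfold F2. rewrite g1_0, g2_0. apply XY_UV; apply h2.
    + now apply is_derive_F.
  - intros t ht. apply scaling_maps_solutions.
    + intros x y hx. now apply HA.
    + intros x y. apply in_box_le. apply Rmin_r.
Qed.
End Sufficiency.

Lemma exp_primitive (k : R) : exists Ef : R -> R, Ef 0 = 0 /\
  (forall t, is_derive Ef t (exp (k * t))) /\ (forall t, k * Ef t + 1 = exp (k * t)).
Proof.
  destruct (Req_dec k 0) as [->|Hk].
  - exists (fun t => t). split; [reflexivity|]. split; intros t; rewrite Rmult_0_l, exp_0.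
    + apply is_derive_var.
    + ring.
  - exists (fun t => (exp (k * t) - 1) / k). split; [|split].
    + rewrite Rmult_0_r, exp_0. field. exact Hk.
    + intros t. auto_derive; trivial. field. exact Hk.
    + intros t. field. exact Hk.
Qed.

Lemma normal_form_symmetry W k m :
  smooth_near (v1 W) px py -> smooth_near (v2 W) px py -> zero_near l px py ->
  locally_2d (fun x y => along W U x y = k * U x y + m /\ along W V x y = - (2 * k * V x y))
    px py ->
  point_symmetry E px py W.
Proof.
  intros s1 s2 [d1 H1] [d2 H2].
  destruct (exp_primitive k) as (Ef & E0 & E1 & E2).
  assert (Hd : 0 < Rmin d1 d2) by (apply Rmin_glb_lt; apply cond_pos).
  pose proof (Rmin_l d1 d2). pose proof (Rmin_r d1 d2).
  apply (@scaling_symmetry W k m (Rmin d1 d2) Hd) with (Ef := Ef); trivial.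
  - intros x y [h h']. apply H1; lra.
  - intros x y [h h']. apply H2; lra.
  - intros x y [h h']. apply H2; lra.
Qed.

End Normal.

(** * The Lie algebra *)

Lemma locally_2dP (P : R -> R -> Prop) px py :
  locally_2d P px py <-> exists r, 0 < r /\ forall x y, in_box px py r x y -> P x y.
Proof.
  split.
  - intros [d H]. exists d. split; [apply cond_pos|]. intros x y [h h']. now apply H.
  - intros (r & Hr & H). exists (mkposreal r Hr). intros x y h h'. apply H. now split.
Qed.

Lemma locally_2d_imp (P Q : R -> R -> Prop) px py :
  (forall x y, P x y -> Q x y) -> locally_2d P px py -> locally_2d Q px py.
Proof. intros H [d Hd]. exists d. intros x y hx hy. now apply H, Hd. Qed.

Lemma smooth_nearP f px py :
  smooth_near f px py <-> exists r, 0 < r /\ smooth2 (in_box px py r) f.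
Proof.
  unfold smooth_near. rewrite locally_2dP. split; intros (r & Hr & H); exists r; split; trivial.
  - now apply smooth2P; [apply open2_box|].
  - now apply smooth2P; [apply open2_box|].
Qed.

Section Algebra.
Variables (E : ode) (px py : R) (O : R -> R -> Prop) (U V l : R -> R -> R) (b : R -> R).
Hypothesis Ho : open2 O.
Hypothesis Hp : O px py.
Hypothesis sU : smooth2 O U.
Hypothesis sV : smooth2 O V.
Hypothesis HJ : forall x y, O x y -> jac U V x y <> 0.

Notation g := (point_symmetry E px py).

(** In the coordinates [(U, V)] the germ is [(k u + m) d/du - 2 k v d/dv]; stating this through the
    action on [U] and [V] avoids pushing vector fields forward. *)
Definition normal_form (k m : R) (W : vfield) : Prop :=
  locally_2d (fun x y => along W U x y = k * U x y + m /\ along W V x y = - (2 * k * V x y))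
    px py.

Hypothesis HN : forall W, g W -> exists k m, normal_form k m W /\
  locally (U px py) (fun u => 4 * k * b u + (k * u + m) * Derive b u = 0).
Hypothesis HS : zero_near l px py -> forall W k m,
  smooth_near (v1 W) px py -> smooth_near (v2 W) px py -> normal_form k m W -> g W.
Hypothesis Hlb : locally_2d (fun x y => l x y = b (U x y)) px py.

Lemma locally_2d_O : locally_2d O px py.
Proof.
  destruct (proj1 (open2P O) Ho _ _ Hp) as [e [He H]]. exists (mkposreal e He). exact H.
Qed.

Lemma locally_U (P : R -> Prop) : locally (U px py) P -> locally_2d (fun x y => P (U x y)) px py.
Proof.
  intros [d Hd]. destruct (smooth2_cont sU Hp d) as [d' H]. exists d'.
  intros x y hx hy. apply Hd. now apply H.
Qed.

Lemma veq_sym W W' : veq_near px py W W' -> veq_near px py W' W.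
Proof. intros [d H]. exists d. intros x y hx hy. destruct (H x y hx hy). now split. Qed.

Lemma normal_form_germ k m W W' :
  veq_near px py W W' -> normal_form k m W -> normal_form k m W'.
Proof.
  intros H1 H2. refine (locally_2d_imp _ (locally_2d_and _ _ _ _ H1 H2)).
   intros x y [[e1 e2] h]. unfold along in *. now rewrite <- e1, <- e2.
Qed.

Lemma normal_form_comb k m k' m' W W' a c :
  normal_form k m W -> normal_form k' m' W' ->
  normal_form (a * k + c * k') (a * m + c * m') (vcomb a W c W').
Proof.
  intros H1 H2. refine (locally_2d_imp _ (locally_2d_and _ _ _ _ H1 H2)).
   intros x y [[e1 e2] [e3 e4]]. unfold along in *. simpl.
  split.
  - transitivity (a * (v1 W x y * dx U x y + v2 W x y * dy U x y)
      + c * (v1 W' x y * dx U x y + v2 W' x y * dy U x y)); [ring|]. rewrite e1, e3. ring.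
  - transitivity (a * (v1 W x y * dx V x y + v2 W x y * dy V x y)
      + c * (v1 W' x y * dx V x y + v2 W' x y * dy V x y)); [ring|]. rewrite e2, e4. ring.
Qed.

Lemma normal_form_vzero : normal_form 0 0 vzero.
Proof.
  apply locally_2d_forall. intros x y. unfold along. simpl. split; ring.
Qed.

(** The differentials [dU] and [dV] are independent, so a field is determined by its action on [U]
    and [V]. *)
Lemma normal_form_unique k m W W' :
  normal_form k m W -> normal_form k m W' -> veq_near px py W W'.
Proof.
  intros H1 H2.
  refine (locally_2d_imp _ (locally_2d_and _ _ _ _ locally_2d_O (locally_2d_and _ _ _ _ H1 H2))).
   intros x y (hO & [e1 e2] & [e3 e4]). unfold along in *.
  rewrite <- e3 in e1. rewrite <- e4 in e2. assert (J := HJ hO). unfold jac in J.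
  split.
  - apply Rmult_eq_reg_l with (2 := J).
    apply (f_equal (fun z => dy V x y * z)) in e1. apply (f_equal (fun z => dy U x y * z)) in e2.
    cbv beta in e1, e2. lra.
  - apply Rmult_eq_reg_l with (2 := J).
    apply (f_equal (fun z => dx V x y * z)) in e1. apply (f_equal (fun z => dx U x y * z)) in e2.
    cbv beta in e1, e2. lra.
Qed.

(** If [k U + m] vanishes near the base, then [k dU = 0], and [dU] is nonzero because the Jacobian
    is. *)
Lemma normal_form_inj k m W :
  normal_form k m W -> veq_near px py W vzero -> k = 0 /\ m = 0.
Proof.
  intros H1 H2. apply (normal_form_germ H2) in H1. apply locally_2dP in H1.
  destruct H1 as (r & Hr & H).
  assert (H0 : forall x y, in_box px py r x y -> k * U x y + m = 0).
  { intros x y h. destruct (H x y h) as [e _]. rewrite <- e. unfold along. simpl. ring. }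
  assert (c0 : in_box px py r px py) by now apply in_box_center.
  assert (Hb : open2 (in_box px py r)) by apply open2_box.
  assert (Dx : k * dx U px py = 0).
  { transitivity (dx (fun x y => k * U x y) px py);
      [symmetry; exact (Derive_scal (fun u => U u py) k px)|].
    transitivity (dx (fun _ _ => - m) px py); [|exact (dx_const (- m) px py)].
    apply (dx_ext Hb (f := fun x y => k * U x y)); trivial. intros x y h.
    specialize (H0 x y h). lra. }
  assert (Dy : k * dy U px py = 0).
  { transitivity (dy (fun x y => k * U x y) px py);
      [symmetry; exact (Derive_scal (fun u => U px u) k py)|].
    transitivity (dy (fun _ _ => - m) px py); [|exact (dy_const (- m) px py)].
    apply (dy_ext Hb (f := fun x y => k * U x y)); trivial. intros x y h.
    specialize (H0 x y h). lra. }
  assert (Hk : k = 0).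
  { apply Rmult_eq_reg_r with (2 := HJ Hp). unfold jac.
    transitivity (k * dx U px py * dy V px py - k * dy U px py * dx V px py); [ring|].
    rewrite Dx, Dy. ring. }
  split; [exact Hk|]. specialize (H0 px py c0). rewrite Hk in H0. lra.
Qed.

(** Cramer's rule for the linear system [W U = k U + m], [W V = - 2 k V]. *)
Definition normal_field (k m : R) : vfield :=
  MkVfield
    (fun x y => ((k * U x y + m) * dy V x y + 2 * k * V x y * dy U x y) / jac U V x y)
    (fun x y => (- (2 * k * V x y * dx U x y) - (k * U x y + m) * dx V x y) / jac U V x y).

Lemma normal_field_normal_form k m : normal_form k m (normal_field k m).
Proof.
  refine (locally_2d_imp _ locally_2d_O).
   intros x y h. assert (J := HJ h). unfold along, jac in *. simpl. unfold jac.
  split; field; exact J.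
Qed.

Lemma normal_field_smooth k m :
  smooth_near (v1 (normal_field k m)) px py /\ smooth_near (v2 (normal_field k m)) px py.
Proof.
  assert (H : forall f, smooth2 O f -> smooth_near f px py).
  { intros f sf. refine (locally_2d_imp _ locally_2d_O).
     intros x y. now apply smooth2P. }
  assert (sJ : smooth2 O (jac U V)) by (unfold jac; sm Ho).
  split; apply H; simpl; sm Ho.
Qed.

Lemma bracket_germ W1 W2 W1' W2' :
  veq_near px py W1 W1' -> veq_near px py W2 W2' ->
  veq_near px py (bracket W1 W2) (bracket W1' W2').
Proof.
  intros H1 H2. apply locally_2dP. apply locally_2dP in H1, H2.
  destruct H1 as (r1 & p1 & H1). destruct H2 as (r2 & p2 & H2).
  exists (Rmin r1 r2). split; [now apply Rmin_glb_lt|].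
  assert (Hb := @open2_box px py (Rmin r1 r2)).
  assert (G1 : forall x y, in_box px py (Rmin r1 r2) x y ->
    v1 W1 x y = v1 W1' x y /\ v2 W1 x y = v2 W1' x y).
  { intros x y h. apply H1. exact (in_box_le (Rmin_l r1 r2) h). }
  assert (G2 : forall x y, in_box px py (Rmin r1 r2) x y ->
    v1 W2 x y = v1 W2' x y /\ v2 W2 x y = v2 W2' x y).
  { intros x y h. apply H2. exact (in_box_le (Rmin_r r1 r2) h). }
  intros x y h. simpl.
  rewrite (dx_ext Hb (fun x y h => proj1 (G1 x y h)) h), (dy_ext Hb (fun x y h => proj1 (G1 x y h)) h),
    (dx_ext Hb (fun x y h => proj2 (G1 x y h)) h), (dy_ext Hb (fun x y h => proj2 (G1 x y h)) h),
    (dx_ext Hb (fun x y h => proj1 (G2 x y h)) h), (dy_ext Hb (fun x y h => proj1 (G2 x y h)) h),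
    (dx_ext Hb (fun x y h => proj2 (G2 x y h)) h), (dy_ext Hb (fun x y h => proj2 (G2 x y h)) h).
  destruct (G1 x y h) as [-> ->]. destruct (G2 x y h) as [-> ->]. now split.
Qed.

(** The second derivatives of [f] cancel by symmetry. The functions [h1] and [h2] are closed forms
    for [W1 f] and [W2 f], so that the outer derivatives can be computed. *)
Lemma along_bracket A W1 W2 f h1 h2 x y :
  open2 A -> smooth2 A f ->
  smooth2 A (v1 W1) -> smooth2 A (v2 W1) -> smooth2 A (v1 W2) -> smooth2 A (v2 W2) ->
  (forall x y, A x y -> along W1 f x y = h1 x y) ->
  (forall x y, A x y -> along W2 f x y = h2 x y) -> A x y ->
  along (bracket W1 W2) f x y = along W1 h2 x y - along W2 h1 x y.
Proof.
  intros HA sf a1 a2 c1 c2 E1 E2 hx.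
  assert (X := dydx HA sf hx). unfold along at 2 3.
  rewrite <- (dx_ext HA E1 hx), <- (dy_ext HA E1 hx), <- (dx_ext HA E2 hx), <- (dy_ext HA E2 hx).
  unfold along. simpl. dsimp HA. rewrite X. ring.
Qed.

Lemma bracket_normal_form W1 W2 k1 m1 k2 m2 :
  smooth_near (v1 W1) px py -> smooth_near (v2 W1) px py ->
  smooth_near (v1 W2) px py -> smooth_near (v2 W2) px py ->
  normal_form k1 m1 W1 -> normal_form k2 m2 W2 ->
  normal_form 0 (k2 * m1 - k1 * m2) (bracket W1 W2).
Proof.
  rewrite !smooth_nearP. unfold normal_form. rewrite !locally_2dP.
  intros (r1 & p1 & s1) (r2 & p2 & s2) (r3 & p3 & s3) (r4 & p4 & s4) (r5 & p5 & H5) (r6 & p6 & H6).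
  destruct (proj1 (locally_2dP _ _ _) locally_2d_O) as (r7 & p7 & H7).
  set (r := Rmin (Rmin (Rmin r1 r2) (Rmin r3 r4)) (Rmin (Rmin r5 r6) r7)).
  assert (pr : 0 < r) by (repeat apply Rmin_glb_lt; trivial).
  assert (L : r <= r1 /\ r <= r2 /\ r <= r3 /\ r <= r4 /\ r <= r5 /\ r <= r6 /\ r <= r7).
  { unfold r. repeat split; eauto using Rle_trans, Rmin_l, Rmin_r. }
  destruct L as (l1 & l2 & l3 & l4 & l5 & l6 & l7).
  exists r. split; [exact pr|]. set (A := in_box px py r).
  assert (HA : open2 A) by apply open2_box.
  assert (sub : forall r' f, r <= r' -> smooth2 (in_box px py r') f -> smooth2 A f).
  { intros r' f Hr. apply smooth2_sub. intros x y. now apply in_box_le. }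
  assert (sUA : smooth2 A U).
  { apply (smooth2_sub (O' := O)); trivial. intros x y h. apply H7. now apply (in_box_le l7). }
  assert (sVA : smooth2 A V).
  { apply (smooth2_sub (O' := O)); trivial. intros x y h. apply H7. now apply (in_box_le l7). }
  assert (G5 : forall x y, A x y -> along W1 U x y = k1 * U x y + m1 /\
    along W1 V x y = - (2 * k1 * V x y)) by (intros x y h; apply H5; now apply (in_box_le l5)).
  assert (G6 : forall x y, A x y -> along W2 U x y = k2 * U x y + m2 /\
    along W2 V x y = - (2 * k2 * V x y)) by (intros x y h; apply H6; now apply (in_box_le l6)).
  intros x y h. destruct (G5 x y h) as [e1 e2]. destruct (G6 x y h) as [e3 e4].
  apply sub in s1, s2, s3, s4; trivial.
  rewrite (@along_bracket A W1 W2 U (fun x y => k1 * U x y + m1) (fun x y => k2 * U x y + m2));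
    trivial; try (intros; now apply G5); try (intros; now apply G6).
  rewrite (@along_bracket A W1 W2 V (fun x y => - (2 * k1 * V x y)) (fun x y => - (2 * k2 * V x y)));
    trivial; try (intros; now apply G5); try (intros; now apply G6).
  unfold along in *. dsimp HA. split.
  - transitivity (k2 * (v1 W1 x y * dx U x y + v2 W1 x y * dy U x y)
      - k1 * (v1 W2 x y * dx U x y + v2 W2 x y * dy U x y)); [ring|]. rewrite e1, e3. ring.
  - transitivity (- (2 * k2) * (v1 W1 x y * dx V x y + v2 W1 x y * dy V x y)
      + 2 * k1 * (v1 W2 x y * dx V x y + v2 W2 x y * dy V x y)); [ring|]. rewrite e2, e4. ring.
Qed.

Lemma derived_normal_form W : derived px py g W -> exists m, normal_form 0 m W.
Proof.
  intros H. induction H as [W1 W2 G1 G2| |a W1 c W2 _ [m1 I1] _ [m2 I2]|W1 W2 _ [m I] HE].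
  - destruct (HN G1) as (k1 & m1 & N1 & _). destruct (HN G2) as (k2 & m2 & N2 & _).
    eexists. apply (@bracket_normal_form W1 W2 k1 m1 k2 m2); trivial; try apply G1; apply G2.
  - exists 0. apply normal_form_vzero.
  - exists (a * m1 + c * m2). replace 0 with (a * 0 + c * 0) by ring.
    now apply normal_form_comb.
  - exists m. now apply (normal_form_germ HE).
Qed.

(** Brackets of symmetries have [k = 0], and the bracket of two fields with [k = 0] is zero, so two
    derivation steps suffice. *)
Lemma symmetries_solvable : solvable px py g.
Proof.
  exists 2%nat. intros W H. simpl in H.
  apply normal_form_unique with (k := 0) (m := 0); [|apply normal_form_vzero].
  induction H as [W1 W2 G1 G2| |a W1 c W2 _ I1 _ I2|W1 W2 _ I HE].
  - destruct (derived_normal_form G1) as (m1 & N1).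
    destruct (derived_normal_form G2) as (m2 & N2).
    (* Membership in [derived] carries no statement of smoothness, so the bracket is computed on the
       explicit smooth fields that have the same germs. *)
    apply (normal_form_germ (W := bracket (normal_field 0 m1) (normal_field 0 m2))).
    + apply bracket_germ; eapply normal_form_unique; (apply normal_field_normal_form || eassumption).
    + destruct (normal_field_smooth 0 m1). destruct (normal_field_smooth 0 m2).
      replace 0 with (0 * m1 - 0 * m2) at 2 by ring.
      apply bracket_normal_form; trivial; apply normal_field_normal_form.
  - apply normal_form_vzero.
  - replace 0 with (a * 0 + c * 0) by ring. now apply normal_form_comb.
  - now apply (normal_form_germ HE).
Qed.

Lemma two_dimensional_basis : two_dimensional px py g ->
  exists W1 W2 k1 m1 k2 m2, g W1 /\ g W2 /\ normal_form k1 m1 W1 /\ normal_form k2 m2 W2 /\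
    locally (U px py) (fun u => 4 * k1 * b u + (k1 * u + m1) * Derive b u = 0) /\
    locally (U px py) (fun u => 4 * k2 * b u + (k2 * u + m2) * Derive b u = 0) /\
    k2 * m1 - k1 * m2 <> 0.
Proof.
  intros (W1 & W2 & Hind & Hg).
  assert (G1 : g W1).
  { apply Hg. exists 1, 0. apply locally_2d_forall. intros x y. simpl. split; ring. }
  assert (G2 : g W2).
  { apply Hg. exists 0, 1. apply locally_2d_forall. intros x y. simpl. split; ring. }
  destruct (HN G1) as (k1 & m1 & N1 & L1). destruct (HN G2) as (k2 & m2 & N2 & L2).
  exists W1, W2, k1, m1, k2, m2. repeat (split; [assumption|]). intros D.
  assert (Z : forall a c, a * k1 + c * k2 = 0 -> a * m1 + c * m2 = 0 -> a = 0 /\ c = 0).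
  { intros a c e1 e2. apply Hind. apply (normal_form_unique (k := 0) (m := 0)).
    - rewrite <- e1 at 1. rewrite <- e2. now apply normal_form_comb.
    - apply normal_form_vzero. }
  (* If the determinant vanished, the combinations with coefficients [(m2, - m1)] and [(k2, - k1)]
     would be zero germs. Independence would give zero for all four constants, and then [W1] itself
     would be the zero germ. *)
  destruct (Z m2 (- m1)) as [z1 z2]; [lra|lra|].
  destruct (Z k2 (- k1)) as [z3 z4]; [lra|lra|].
  destruct (Z 1 0) as [z5 _]; lra.
Qed.

Lemma two_dimensional_iff : two_dimensional px py g <-> zero_near l px py.
Proof.
  split.
  - intros H.
    destruct (two_dimensional_basis H) as (W1 & W2 & k1 & m1 & k2 & m2 & _ & _ & _ & _ & L1 & L2 & D).
    assert (Z : locally (U px py) (fun u => b u = 0)).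
    { apply (filter_imp _ _ (F := locally (U px py))) with (2 := filter_and _ _ L1 L2).
      intros u [e1 e2].
      (* The two constraints are linear in [b] and its derivative, with determinant
         [4 * (k1 * m2 - k2 * m1)], free of [u] and nonzero; eliminating [b] isolates the
         derivative. *)
      assert (b' : Derive b u = 0).
      { apply Rmult_eq_reg_l with (2 := D).
        transitivity (k2 * (4 * k1 * b u + (k1 * u + m1) * Derive b u)
          - k1 * (4 * k2 * b u + (k2 * u + m2) * Derive b u)); [ring|]. rewrite e1, e2. ring. }
      rewrite b' in e1, e2. destruct (Req_dec k1 0) as [K|K].
      - destruct (Req_dec k2 0) as [K'|K']; [exfalso; apply D; rewrite K, K'; ring|].
        apply Rmult_eq_reg_l with (2 := K'). lra.
      - apply Rmult_eq_reg_l with (2 := K). lra. }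
    apply locally_U in Z.
    refine (locally_2d_imp _ (locally_2d_and _ _ _ _ Hlb Z)).
     intros x y [e1 e2]. now rewrite e1.
  (* The basis consists of the scaling [u d/du - 2 v d/dv] and the translation [d/du]. *)
  - intros Hl. exists (normal_field 1 0), (normal_field 0 1).
    assert (Hk : forall a c, normal_form a c (vcomb a (normal_field 1 0) c (normal_field 0 1))).
    { intros a c. replace a with (a * 1 + c * 0) at 1 by ring.
      replace c with (a * 0 + c * 1) at 2 by ring.
      apply normal_form_comb; apply normal_field_normal_form. }
    split.
    + intros a c Hz. exact (normal_form_inj (Hk a c) Hz).
    + intros W. split.
      * intros G. destruct (HN G) as (k & m & N & _). exists k, m.
        exact (normal_form_unique N (Hk k m)).
      * intros (a & c & He).
        assert (N := normal_form_germ (veq_sym He) (Hk a c)).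
        assert (N' := normal_form_unique N (normal_field_normal_form a c)).
        destruct (normal_field_smooth a c) as [s1 s2].
        assert (sm_germ : forall f f', locally_2d (fun x y => f x y = f' x y) px py ->
          smooth_near f' px py -> smooth_near f px py).
        { intros f f' Hf. rewrite !smooth_nearP. apply locally_2dP in Hf.
          destruct Hf as (r1 & p1 & H1). intros (r2 & p2 & H2). exists (Rmin r1 r2).
          split; [now apply Rmin_glb_lt|].
          apply (smooth2_ext (@open2_box px py _) (f := f')).
          - intros x y h. symmetry. apply H1. exact (in_box_le (Rmin_l r1 r2) h).
          - apply (smooth2_sub (O' := in_box px py r2)); trivial.
            intros x y h. exact (in_box_le (Rmin_r r1 r2) h). }
        apply (HS Hl (k := a) (m := c)); trivial.
        -- apply (sm_germ _ _) with (2 := s1). destruct N' as [d N']. exists d.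
           intros x y hx hy. apply (N' x y hx hy).
        -- apply (sm_germ _ _) with (2 := s2). destruct N' as [d N']. exists d.
           intros x y hx hy. apply (N' x y hx hy).
Qed.

(** The bracket of the two basis elements has normal form [(0, k2 * m1 - k1 * m2)], and this
    determinant is nonzero by independence. *)
Lemma two_dimensional_not_abelian : two_dimensional px py g -> ~ abelian px py g.
Proof.
  intros H Hab.
  destruct (two_dimensional_basis H) as (W1 & W2 & k1 & m1 & k2 & m2 & G1 & G2 & N1 & N2 & _ & _ & D).
  apply D. eapply (normal_form_inj (k := 0)); [|exact (Hab W1 W2 G1 G2)].
  apply bracket_normal_form; trivial; try apply G1; apply G2.
Qed.
End Algebra.

Theorem theorem13p3 (E : ode) (px py : R)
  (hsmooth : smooth_ode E px py)
  (c : chart) (hAB : applicable E c px py)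
  (hF : zero_near (invF E) px py)
  (hN : zero_near (invN c E) px py)
  (hOmega : zero_near (Omega c E) px py) :
  (two_dimensional px py (point_symmetry E px py) <-> zero_near (invL c E) px py) /\
  (two_dimensional px py (point_symmetry E px py) ->
     solvable px py (point_symmetry E px py) /\
     ~ abelian px py (point_symmetry E px py)).
Proof.
  destruct hsmooth as (hP & hQ & hR & hS). rewrite smooth_nearP in hP, hQ, hR, hS.
  destruct hP as (r1 & q1 & sP). destruct hQ as (r2 & q2 & sQ).
  destruct hR as (r3 & q3 & sR). destruct hS as (r4 & q4 & sS).
  apply locally_2dP in hF, hN, hOmega.
  destruct hF as (r5 & q5 & hF). destruct hN as (r6 & q6 & hN).
  destruct hOmega as (r7 & q7 & hOm).
  set (ra := Rmin (Rmin (Rmin r1 r2) (Rmin r3 r4)) (Rmin (Rmin r5 r6) r7)).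
  assert (pra : 0 < ra) by (repeat apply Rmin_glb_lt; trivial).
  assert (L : ra <= r1 /\ ra <= r2 /\ ra <= r3 /\ ra <= r4 /\ ra <= r5 /\ ra <= r6 /\ ra <= r7).
  { unfold ra. repeat split; eauto using Rle_trans, Rmin_l, Rmin_r. }
  destruct L as (l1 & l2 & l3 & l4 & l5 & l6 & l7).
  (* The chart is given as applicable at the base point; continuity of [A] or [B] extends this to a
     smaller box, on which the structure equations are then used. *)
  assert (happ : exists r, 0 < r <= ra /\ forall x y, in_box px py r x y -> applicable E c x y).
  { assert (Hoa := @open2_box px py ra).
    assert (sub : forall r' f, ra <= r' -> smooth2 (in_box px py r') f ->
      smooth2 (in_box px py ra) f).
    { intros r' f Hr. apply smooth2_sub. intros x y. now apply in_box_le. }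
    assert (sP' := sub _ _ l1 sP). assert (sQ' := sub _ _ l2 sQ).
    assert (sR' := sub _ _ l3 sR). assert (sS' := sub _ _ l4 sS).
    assert (sI : smooth2 (in_box px py ra)
      (match c with chartA => invA E | chartB => invB E end)).
    { destruct c; [exact (smooth_invA Hoa sP' sQ' sR' sS')|exact (smooth_invB Hoa sP' sQ' sR' sS')]. }
    assert (h0 : (match c with chartA => invA E | chartB => invB E end) px py <> 0)
      by (destruct c; exact hAB).
    destruct (nonzero_open h0) as (e & He & Hn).
    destruct (smooth2_box_near sI (in_box_center px py pra) Hoa He) as (d & Hd & K).
    exists (Rmin d ra). split; [split; [now apply Rmin_glb_lt|apply Rmin_r]|].
    intros x y h. assert (h' := proj2 (K x y (in_box_le (Rmin_l d ra) h))). apply Hn in h'.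
    destruct c; exact h'. }
  destruct happ as (r & [pr lr] & happ).
  set (O := in_box px py r).
  assert (Ho : open2 O) by apply open2_box.
  assert (sub : forall r' f, ra <= r' -> smooth2 (in_box px py r') f -> smooth2 O f).
  { intros r' f Hr. apply smooth2_sub. intros x y. apply in_box_le. lra. }
  assert (inb : forall r' x y, ra <= r' -> O x y -> in_box px py r' x y).
  { intros r' x y Hr. apply in_box_le. lra. }
  destruct (@rectification E c px py r) as (U & V & l & sU & sV & sl & H);
    trivial; try (apply (sub _ _ l1 sP) || apply (sub _ _ l2 sQ) || apply (sub _ _ l3 sR)
      || apply (sub _ _ l4 sS)).
  { intros x y h. apply hF. now apply (inb r5). }
  { intros x y h. apply hN. now apply (inb r6). }
  { intros x y h. apply hOm. now apply (inb r7). }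
  fold O in sU, sV, sl, H.
  assert (Hrect : forall x y, O x y -> rectifies E U V l x y) by (intros x y h; apply (H x y h)).
  assert (cO : O px py) by now apply in_box_center.
  assert (HJ : forall x y, O x y -> jac U V x y <> 0) by (intros x y h; apply (Hrect x y h)).
  destruct (inverse_function Ho sU sV cO (HJ _ _ cO)) as (r' & s & X & Y & Hinv).
  assert (HlL : zero_near l px py <-> zero_near (invL c E) px py).
  { assert (HO : locally_2d O px py) by (apply locally_2dP; now exists r).
    split; intros Hz; refine (locally_2d_imp _ (locally_2d_and _ _ _ _ HO Hz));
      intros x y [h e]; now apply (H x y h). }
  rewrite <- HlL.
  set (b0 := beta1 V l px py X Y).
  assert (HN : forall W, point_symmetry E px py W -> exists k m, normal_form px py U V k m W /\
    locally (U px py) (fun u => 4 * k * b0 u + (k * u + m) * Derive b0 u = 0)).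
  { intros W. exact (symmetry_normal_form Ho sU sV sl Hrect Hinv (W := W)). }
  assert (HS : zero_near l px py -> forall W k m, smooth_near (v1 W) px py ->
    smooth_near (v2 W) px py -> normal_form px py U V k m W -> point_symmetry E px py W).
  { intros Hz W k m s1 s2. exact (normal_form_symmetry Ho sU sV Hrect Hinv s1 s2 Hz). }
  (* [l_b] asks for [(U, V)] to land in the target box of the inverse chart, which continuity
     ensures near the base point. *)
  assert (Hlb : locally_2d (fun x y => l x y = b0 (U x y)) px py).
  { pose proof (r_pos Hinv) as pr'. pose proof (s_pos Hinv) as ps'.
    destruct (smooth2_box_near sU cO Ho ps') as (da & pa & Ka).
    destruct (smooth2_box_near sV cO Ho ps') as (db & pb & Kb).
    apply locally_2dP. exists (Rmin r' (Rmin da db)).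
    split; [repeat apply Rmin_glb_lt; trivial|]. intros x y [hx hy].
    apply Rmin_Rgt_l in hx, hy. destruct hx as [hx1 hx], hy as [hy1 hy].
    apply Rmin_Rgt_l in hx, hy. destruct hx as [hx2 hx3], hy as [hy2 hy3].
    apply (l_b Ho sU sV sl Hrect Hinv); [now split|]. split; [now apply Ka|now apply Kb]. }
  split; [|intros Htwo; split].
  - exact (two_dimensional_iff Ho cO sU sV HJ HN HS Hlb).
  - exact (symmetries_solvable Ho cO sU sV HJ HN).
  - exact (two_dimensional_not_abelian Ho cO sU sV HJ HN Htwo).
Qed.
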